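(* Fix $s^*>0$ (a fixed constant of the problem), and let $\sigma_0>0$ and $0<\tau_1<\tau_2$. Let $W_1,W_2\in H^{(2)}(\mathbb{R})$. Then there is a unique pair $(f_0,f_1)\in H^{(0)}(\mathbb{R})\times H^{(0)}(\mathbb{R})$ such that the solution $W(y,\tau)$ of the Cauchy problem $$\frac{\partial W}{\partial \tau}-\frac12\sigma_0^2\frac{\partial^2 W}{\partial y^2}=\frac{s^*}{\sqrt{2\pi\tau}\,\sigma_0}\bigl(f_0(y)+\tau f_1(y)\bigr),\quad 0<\tau<\tau_2,\ y\in\mathbb{R},\qquad W(y,0)=0,\quad y\in\mathbb{R},$$ satisfies $$W(y,\tau_j)=W_j(y),\quad y\in\mathbb{R},\ j=1,2.$$ Moreover, there is a constant $C$ depending only on $\tau_1,\tau_2,\sigma_0$ (with $s^*$ fixed) such that, for all such $W_1,W_2$, the solution $(f_0,f_1)$ of this inverse problem satisfies $$\|f_0\|_{(0)}(\mathbb{R})+\|f_1\|_{(0)}(\mathbb{R})\le C\bigl(\|W_1\|_{(2)}(\mathbb{R})+\|W_2\|_{(2)}(\mathbb{R})\bigr).$$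
   Context: The Fourier transform in $y$ is $\mathcal{F}f(\xi)=(2\pi)^{-1/2}\int_{\mathbb{R}} f(y)e^{-i\xi y}\,dy$. The Sobolev space $H^{(l)}(\mathbb{R})$ has norm $\|f\|_{(l)}(\mathbb{R})=\left(\int_{\mathbb{R}}(1+\xi^2)^l|\mathcal{F}f(\xi)|^2\,d\xi\right)^{1/2}$; in particular $H^{(0)}(\mathbb{R})=L^2(\mathbb{R})$. For $f_0,f_1\in L^2(\mathbb{R})$ the solution of the Cauchy problem is the usual one, $W\in C([0,\tau_2];L^2(\mathbb{R}))$, given by Duhamel's formula for the heat equation; equivalently, for a.e. $\xi$ the function $\tau\mapsto\mathcal{F}W(\xi,\tau)$ solves the ordinary differential equation obtained by Fourier transforming the equation in $y$, with zero initial value. *)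

(* Defs.v *)
From HB Require Import structures.
From mathcomp Require Import all_boot all_order all_algebra.
From mathcomp Require Import complex.
From mathcomp Require Import all_classical all_reals all_analysis.

Set Implicit Arguments.
Unset Strict Implicit.
Unset Printing Implicit Defensive.

Import Order.TTheory GRing.Theory Num.Theory.
Import numFieldNormedType.Exports.

Local Open Scope classical_set_scope.
Local Open Scope ring_scope.
Local Open Scope complex_scope.

(* Elements of L^2(R) are represented by measurable functions; equality of
   elements is equality almost everywhere, [f = g %[ae mu]]. *)

Section Defs.
Context {R : realType}.
Implicit Types (f : R -> R) (g : R -> R[i]) (W : R -> R -> R).

(* Otherwise Re and Im are those of an abstract numClosedFieldType, with values
   in R[i]. *)
Local Notation Re := complex.Re.
Local Notation Im := complex.Im.
Local Notation normc := ComplexField.Normc.normc.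
Local Notation mu := (@lebesgue_measure R).

Definition L2 f : Prop := f \in Lfun mu 2%:E.

Definition L2C g : Prop := L2 (fun x => Re (g x)) /\ L2 (fun x => Im (g x)).

(* (2 pi)^(-1/2) \int_D f(y) e^(- i xi y) dy *)
Definition fourier_integral (D : set R) f (xi : R) : R[i] :=
  ((Num.sqrt (2 * pi))^-1)%:C *
  ((\int[mu]_(y in D) (f y * cos (xi * y)))
    -i* (\int[mu]_(y in D) (f y * sin (xi * y)))).

(* The integral over the whole line need not converge for f in L^2(R), where
   the transform is the limit in L^2 of the integrals over [-n, n]. *)
Definition is_fourier f g : Prop :=
  L2C g /\
  (fun n : nat => (\int[mu]_xi
     (normc (fourier_integral `[- n%:R, n%:R] f xi - g xi) ^+ 2)%:E)%E)
    @ \oo --> 0%E.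

(* Some representative, determined almost everywhere. *)
Definition fourier f : R -> R[i] := xget (fun=> 0) [set g | is_fourier f g].

Definition sobolev_norm (l : nat) f : \bar R :=
  ((\int[mu]_xi ((1 + xi ^+ 2) ^+ l * normc (fourier f xi) ^+ 2)%:E)
    `^ 2^-1)%E.

(* For l >= 0, H^(l)(R) is a subspace of L^2(R). *)
Definition sobolev (l : nat) f : Prop := L2 f /\ (sobolev_norm l f < +oo)%E.

Definition source (s sigma0 : R) (f0 f1 : R -> R) (tau y : R) : R :=
  s / (Num.sqrt (2 * pi * tau) * sigma0) * (f0 y + tau * f1 y).

(* The fundamental solution at time t, with pole z, of
   D_t - 1/2 sigma0^2 D_y^2 is the Gaussian density of mean z and standard
   deviation sigma0 sqrt t. *)
Definition duhamel (sigma0 : R) (F : R -> R -> R) (tau y : R) : R :=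
  \int[mu]_(theta in `]0, tau[) \int[mu]_z
    (normal_pdf z (sigma0 * Num.sqrt (tau - theta)) y * F theta z).

(* The equation, Fourier transformed in y, for one frequency xi. The transform
   of a real function is complex, so that the derivative in tau is taken on the
   real and the imaginary parts. *)
Definition transformed_equation (s sigma0 T : R) (f0 f1 : R -> R)
    (w : R -> R[i]) (xi : R) : Prop :=
  [/\ w 0 = 0,
      {within `[0, T], continuous (fun tau => Re (w tau))},
      {within `[0, T], continuous (fun tau => Im (w tau))} &
      forall tau : R, 0 < tau < T ->
        let rhs := (- (sigma0 ^+ 2 / 2 * xi ^+ 2))%:C * w tau
          + (s / (Num.sqrt (2 * pi * tau) * sigma0))%:C
            * (fourier f0 xi + tau%:C * fourier f1 xi) in
        is_derive tau 1 (fun t => Re (w t)) (Re rhs) /\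
        is_derive tau 1 (fun t => Im (w t)) (Im rhs)].

(* W tau y is the value of the solution at (y, tau). Duhamel's formula and the
   Fourier transformed equation characterize the same W, and both are required.
   In the last clause What is a choice, for each tau, of a representative of the
   transform of W tau: the representatives [fourier (W tau)] of uncountably many
   classes need not fit together at any xi. *)
Record cauchy_solution (s sigma0 T : R) (f0 f1 : R -> R) W : Prop := {
  cauchy_L2 : forall tau : R, 0 <= tau <= T -> L2 (W tau);
  cauchy_continuous : forall tau : R, 0 <= tau <= T ->
    'N[mu]_2%:E[EFin \o (W t \- W tau)%R]%E
      @[t --> within `[0, T] (nbhs tau)] --> 0%E;
  cauchy_initial : W 0 = cst 0 %[ae mu];
  cauchy_duhamel : forall tau : R, 0 < tau <= T ->
    W tau = duhamel sigma0 (source s sigma0 f0 f1) tau %[ae mu];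
  cauchy_equation : exists What : R -> R -> R[i],
    (forall tau : R, 0 <= tau <= T -> What tau = fourier (W tau) %[ae mu]) /\
    \forall xi \ae mu,
      transformed_equation s sigma0 T f0 f1 (fun tau => What tau xi) xi
}.

Definition inverse_solution (s sigma0 tau1 tau2 : R) (W1 W2 f0 f1 : R -> R) :
    Prop :=
  [/\ sobolev 0 f0, sobolev 0 f1 &
      exists W, [/\ cauchy_solution s sigma0 tau2 f0 f1 W,
        W tau1 = W1 %[ae mu] & W tau2 = W2 %[ae mu]]].

End Defs.

(* Main.v *)
Require Import Defs.
From HB Require Import structures.
From mathcomp Require Import all_boot all_order all_algebra.
From mathcomp Require Import complex ring lra.
From mathcomp Require Import all_classical all_reals all_analysis.
From mathcomp Require Import measurable_realfun.

(** The transform in y turns the Cauchy problem into a linear equation in tau for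
    each frequency xi. With a = sigma0^2 xi^2 / 2, its solution is a constant
    multiple of m_0(a, tau) F f_0 + m_1(a, tau) F f_1, where
      2 m_k(a, tau) = \int_0^tau e^(- a (tau - theta)) theta^(k - 1/2) dtheta.
    The data at the two times thus come from (F f_0, F f_1) by a real matrix for
    each frequency, and the theorem says that this matrix is invertible, with an
    inverse of size O(1 + xi^2): existence, uniqueness and the estimate follow at
    once by Plancherel's theorem.

    Put theta = u^2: then m_k = e^(- a tau) Phi_k(sqrt tau) with
    Phi_k(x) = \int_0^x u^(2 k) e^(a u^2) du, and comparing derivatives in x shows
    that the determinant m_0(tau_1) m_1(tau_2) - m_0(tau_2) m_1(tau_1) is at least
    m_0(tau_1) m_0(tau_2) times a positive constant that does not depend on xi
    ([Phi_gap], [mult_det]). Since m_1(tau) <= tau m_0(tau) ([mult1_le]) and m_0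
    decays no faster than the inverse of 1 + xi^2 ([mult0_ge]), Cramer's rule gives
    the bound on the inverse ([inv_le]).

    The L^2 theory is that of Hartley's transform, with the real kernel
    cas = cos + sin, which is a symmetric isometric involution of the real space
    L^2. Its even and odd parts are the real part and minus the imaginary part of
    Fourier's transform of a real function ([fourier_hat]), and multipliers that are
    real and even in xi act on both in the same way. A Gaussian weight in the
    frequency integrals gives Bessel's inequality ([hint_bessel]), by which the
    transform extends to L^2, and Parseval's identity for indicators of intervals
    ([hint_itvf]); testing against such indicators then shows that the extension is
    its own inverse ([is_hartleyK]).

    The function [sol] is the transform of the combination of multipliers above. It
    satisfies Duhamel's formula by Parseval's identity against the heat kernel and
    Fubini's theorem in time and frequency ([duhamel_hint]), and it is continuous in
    time because the multipliers have a modulus of continuity that is uniform in the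
    frequency ([mult_lip]). Conversely the transformed equation determines the
    transform of any solution by uniqueness for linear equations ([evol_uniq],
    [cauchy_solution_hart]). *)

Set Implicit Arguments.
Unset Strict Implicit.
Unset Printing Implicit Defensive.

Import Order.TTheory GRing.Theory Num.Theory.
Import numFieldNormedType.Exports.

Local Open Scope classical_set_scope.
Local Open Scope ring_scope.

Local Notation mu := lebesgue_measure.
Local Notation L1 f := (lebesgue_measure.-integrable setT (EFin \o f)).

(** * Square-integrable real functions *)
Section SquareIntegrable.
Context {R : realType}.
Implicit Types f g h u v : R -> R.

Lemma aeS (P Q : R -> Prop) : (forall x, P x -> Q x) ->
  (\forall x \ae (@lebesgue_measure R), P x) ->
  \forall x \ae (@lebesgue_measure R), Q x.
Proof.
by move=> PQ; apply: (@filterS _ _ (ae_filter_ringOfSetsType lebesgue_measure)).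
Qed.

Lemma aeI (P Q : R -> Prop) : (\forall x \ae (@lebesgue_measure R), P x) ->
  (\forall x \ae (@lebesgue_measure R), Q x) ->
  \forall x \ae (@lebesgue_measure R), P x /\ Q x.
Proof.
by move=> aP aQ; apply: (@filterI _ _ (ae_filter_ringOfSetsType lebesgue_measure)).
Qed.

Lemma ae_eqE {T} (f g : R -> T) : f = g %[ae mu] <->
  \forall x \ae (@lebesgue_measure R), f x = g x.
Proof. by split; apply: aeS => x // /(_ I). Qed.

Lemma L1_measurable f : L1 f -> measurable_fun setT f.
Proof. by move=> /integrableP[/measurable_EFinP]. Qed.

Lemma L1D f g : L1 f -> L1 g -> L1 (fun x => f x + g x).
Proof. exact: integrableD. Qed.

Lemma L1B f g : L1 f -> L1 g -> L1 (fun x => f x - g x).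
Proof. exact: integrableB. Qed.

Lemma L1Z c f : L1 f -> L1 (fun x => c * f x).
Proof. exact: integrableZl. Qed.

Lemma L1_le f g : measurable_fun setT f -> (forall x, `|f x| <= g x) ->
  L1 g -> L1 f.
Proof.
move=> mf fg ig; apply: (le_integrable _ _ _ ig) => //.
  exact/measurable_EFinP.
by move=> x _; rewrite /= lee_fin (le_trans (fg x))// ler_norm.
Qed.

Lemma L1_norm f : L1 f -> L1 (fun x => `|f x|).
Proof. by move=> /integrable_norm. Qed.

Lemma L1_lty f : measurable_fun setT f -> (forall x, 0 <= f x) ->
  (\int[mu]_x (f x)%:E < +oo)%E -> L1 f.
Proof.
move=> mf f0 fy; apply/integrableP; split; first exact/measurable_EFinP.
by under eq_integral do rewrite /= ger0_norm//.
Qed.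

Lemma L1_EFin f : L1 f -> (\int[mu]_x (f x)%:E = (\int[mu]_x f x)%:E)%E.
Proof. by move=> f1; rewrite fineK//; exact: integrable_fin_num. Qed.

Lemma RintZ c f : L1 f -> \int[mu]_x (c * f x) = c * \int[mu]_x f x.
Proof. by move=> f1; rewrite RintegralZl. Qed.

Lemma RintD f g : L1 f -> L1 g ->
  \int[mu]_x (f x + g x) = \int[mu]_x f x + \int[mu]_x g x.
Proof. by move=> f1 g1; rewrite RintegralD. Qed.

Lemma Rint_le f g : L1 f -> L1 g -> (forall x, f x <= g x) ->
  \int[mu]_x f x <= \int[mu]_x g x.
Proof. by move=> f1 g1 fg; apply: le_Rintegral. Qed.

Lemma Rint_norm_le f : L1 f -> `|\int[mu]_x f x| <= \int[mu]_x `|f x|.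
Proof. by move=> f1; apply: le_normr_Rintegral. Qed.

Lemma ae_eq_Rintegral f g : measurable_fun setT f -> measurable_fun setT g ->
  f = g %[ae mu] -> \int[mu]_x f x = \int[mu]_x g x.
Proof.
move=> mf mg fg; congr fine; apply: ae_eq_integral => //.
- exact/measurable_EFinP.
- exact/measurable_EFinP.
- by move/ae_eqE: fg; apply: aeS => x /= ->.
Qed.

Lemma L2P f : L2 f <-> measurable_fun setT f /\ L1 (fun x => f x ^+ 2).
Proof.
split.
  move=> f2; split; last exact: Lfun2_integrable_sqr.
  by move: f2; rewrite /L2 inE => /andP[]; rewrite inE.
move=> [mf /integrableP[_ fy]]; rewrite /L2 inE; apply/andP; split; rewrite inE//=.
rewrite /finite_norm unlock poweR_lty//.
apply: le_lt_trans fy.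
rewrite le_eqVlt; apply/orP; left; apply/eqP; apply: eq_integral => x _ /=.
by rewrite normrX powR_mulrn.
Qed.

Lemma L2_measurable f : L2 f -> measurable_fun setT f.
Proof. by move=> /L2P[]. Qed.

Lemma L2_sqr f : L2 f -> L1 (fun x => f x ^+ 2).
Proof. by move=> /L2P[]. Qed.

Lemma L2D f g : L2 f -> L2 g -> L2 (fun x => f x + g x).
Proof.
move=> /L2P[mf f2] /L2P[mg g2]; apply/L2P; split; first exact: measurable_funD.
apply: (@L1_le _ (fun x => 2 * (f x ^+ 2 + g x ^+ 2))).
- by apply: measurable_funX; exact: measurable_funD.
- by move=> x; rewrite ger0_norm ?sqr_ge0//; have := sqr_ge0 (f x - g x); lra.
- exact/L1Z/L1D.
Qed.

Lemma L2_mulb c (m f : R -> R) : measurable_fun setT m -> (forall x, `|m x| <= c) ->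
  L2 f -> L2 (fun x => m x * f x).
Proof.
move=> mm mc /L2P[mf f2]; apply/L2P; split; first exact: measurable_funM.
apply: (@L1_le _ (fun x => c ^+ 2 * f x ^+ 2)).
- by apply: measurable_funX; exact: measurable_funM.
- move=> x; rewrite ger0_norm ?sqr_ge0// exprMn ler_wpM2r ?sqr_ge0//.
  by rewrite -real_normK ?num_real// lerXn2r ?nnegrE// (le_trans _ (mc x)).
- exact: L1Z.
Qed.

Lemma L2Z c f : L2 f -> L2 (fun x => c * f x).
Proof. exact: (@L2_mulb `|c|). Qed.

Lemma L2B f g : L2 f -> L2 g -> L2 (fun x => f x - g x).
Proof.
move=> f2 g2; have := L2D f2 (L2Z (-1) g2).
by under [X in L2 X]eq_fun do rewrite mulN1r.
Qed.

Lemma L2_mul f g : L2 f -> L2 g -> L1 (fun x => f x * g x).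
Proof.
by move=> f2 g2; apply/(@Lfun1_integrable _ _ _ mu); exact: Lfun2_mul_Lfun1.
Qed.

Lemma L2_ae f g : measurable_fun setT g -> f = g %[ae mu] -> L2 f -> L2 g.
Proof.
move=> mg fg /L2P[mf f2]; apply/L2P; split => //; apply: L1_lty.
- exact: measurable_funX.
- by move=> x; exact: sqr_ge0.
- have /integrableP[_] := f2; apply: le_lt_trans; rewrite le_eqVlt; apply/orP; left.
  apply/eqP; apply: ae_eq_integral => //.
  + by apply/measurable_EFinP; exact: measurable_funX.
  + by apply: measurableT_comp => //; apply/measurable_EFinP; exact: measurable_funX.
  + by move/ae_eqE: fg; apply: aeS => x /= -> _; rewrite ger0_norm ?sqr_ge0.
Qed.

(** Both are real-valued, hence 0 when the integral diverges. *)
Definition sqn f : R := \int[mu]_x (f x ^+ 2).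

Definition ip f g : R := \int[mu]_x (f x * g x).

Lemma sqn_ge0 f : 0 <= sqn f.
Proof. by apply: Rintegral_ge0 => x _; exact: sqr_ge0. Qed.

Lemma ipC f g : ip f g = ip g f.
Proof. by apply: eq_Rintegral => x _; rewrite mulrC. Qed.

Lemma ipBl f g h : L2 f -> L2 g -> L2 h ->
  ip (fun x => f x - g x) h = ip f h - ip g h.
Proof.
move=> f2 g2 h2; rewrite /ip -RintegralB//.
- by apply: eq_Rintegral => x _; rewrite mulrBl.
- exact: L2_mul.
- exact: L2_mul.
Qed.

Lemma sqnE f : sqn f = ip f f.
Proof. by []. Qed.

Lemma sqnZ c f : L2 f -> sqn (fun x => c * f x) = c ^+ 2 * sqn f.
Proof.
move=> /L2_sqr f2; rewrite /sqn -RintegralZl//.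
by apply: eq_Rintegral => x _; rewrite exprMn.
Qed.

Lemma sqnBC f g : sqn (fun x => f x - g x) = sqn (fun x => g x - f x).
Proof. by apply: eq_Rintegral => x _; ring. Qed.

Lemma sqnD_le f g : L2 f -> L2 g ->
  sqn (fun x => f x + g x) <= 2 * (sqn f + sqn g).
Proof.
move=> f2 g2; rewrite /sqn -RintegralD//; try exact: L2_sqr.
rewrite -RintegralZl//; last by apply: L1D; exact: L2_sqr.
apply: le_Rintegral => //.
- exact/L2_sqr/L2D.
- by apply: L1Z; apply: L1D; exact: L2_sqr.
- by move=> x _; have := sqr_ge0 (f x - g x); lra.
Qed.

Lemma ip_le f g : L2 f -> L2 g -> `|ip f g| <= (sqn f + sqn g) / 2.
Proof.
move=> f2 g2; apply: (le_trans (le_normr_Rintegral _ _)) => //.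
  exact: L2_mul.
rewrite mulrC -RintegralD//; try exact: L2_sqr.
rewrite -RintegralZl//; last by apply: L1D; exact: L2_sqr.
apply: le_Rintegral => //.
- exact/L1_norm/L2_mul.
- by apply: L1Z; apply: L1D; exact: L2_sqr.
- move=> x _; rewrite normrM -[in leRHS](real_normK (num_real (f x))).
  rewrite -[in leRHS](real_normK (num_real (g x))).
  by have := sqr_ge0 (`|f x| - `|g x|); lra.
Qed.

Lemma sqn_eq0 f : L2 f -> sqn f = 0 -> f = cst 0 %[ae mu].
Proof.
move=> f2 f0; have mf := L2_measurable f2.
have /(ae_eq_integral_abs lebesgue_measure measurableT) [+ _] :
    measurable_fun setT (fun x => (f x ^+ 2)%:E).
  by apply/measurable_EFinP; exact: measurable_funX.
move=> /(_ _)/ae_eqE H; apply/ae_eqE; apply: aeS (H _); last first.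
  under eq_integral do rewrite abse_EFin ger0_norm ?sqr_ge0//.
  by rewrite L1_EFin ?[Rintegral _ _ _]f0//; exact: L2_sqr.
by move=> x /= [] /eqP; rewrite sqrf_eq0 => /eqP.
Qed.

(** Scaling the two factors of [ip_le] by a free parameter and its inverse makes
    the contribution of the fixed factor arbitrarily small. *)
Lemma cvg_ip (u : nat -> R -> R) v f : (forall n, L2 (u n)) -> L2 v -> L2 f ->
  sqn (fun x => u n x - v x) @[n --> \oo] --> 0 ->
  ip (u n) f @[n --> \oo] --> ip v f.
Proof.
move=> u2 v2 f2 uv; apply/cvgrPdist_le => /= e e0.
(* The weight that makes t * sqn f at most e; the 1 avoids dividing by 0. *)
pose t := e / (sqn f + 1).
have f1 : 0 < sqn f + 1 by rewrite ltr_wpDl// sqn_ge0.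
have t0 : 0 < t by rewrite divr_gt0.
move/cvgrPdist_le : uv => /(_ (t * e)); rewrite mulr_gt0// => /(_ isT).
apply: filterS => n; rewrite sub0r normrN ger0_norm ?sqn_ge0// => un.
rewrite -normrN opprB -ipBl//.
have d2 := L2B (u2 n) v2.
have := ip_le (L2Z t^-1 d2) f2.
rewrite sqnZ// /ip; under eq_Rintegral do rewrite -mulrA.
rewrite RintegralZl//; last exact: L2_mul.
rewrite -/(ip _ _) normrM gtr0_norm ?invr_gt0// => h.
have : `|ip (fun x => u n x - v x) f| <= t * ((t ^- 1 ^+ 2 * (t * e) + sqn f) / 2).
  rewrite -ler_pdivrMl//; apply: (le_trans h); rewrite ler_pM2r ?invr_gt0// lerD2r.
  by rewrite ler_wpM2l// sqr_ge0.
move=> /le_trans; apply; rewrite -exprVn.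
rewrite (_ : t * _ = (e + t * sqn f) / 2); last by field; rewrite gt_eqF.
have : t * sqn f <= e.
  by rewrite /t mulrAC ler_pdivrMr// ler_pM2l// lerDl.
lra.
Qed.

End SquareIntegrable.

(** * Completeness of L^2 *)
Section Completeness.
Context {R : realType}.
Implicit Types f g h u v : R -> R.

Lemma limn_einf_le_near (u : (\bar R)^nat) c :
  (\forall n \near \oo, (u n <= c)%E) -> (limn_einf u <= c)%E.
Proof.
move=> uc; rewrite limn_einf_lim; apply: lime_le.
  apply/cvg_ex; eexists; apply/ereal_nondecreasing_cvgn => a b ab.
  by apply: ereal_inf_le_tmp => // _ [n /= bn <-]; exists n => //=; rewrite (leq_trans ab).
by apply: filterS uc => n; apply: le_trans; apply: ereal_inf_lbound; exists n => /=.
Qed.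

(** Fatou's lemma for the squares also puts the limit in L^2. *)
Lemma sqn_fatou (w : nat -> R -> R) v c : (forall n, L2 (w n)) ->
  measurable_fun setT v ->
  (\forall x \ae (@lebesgue_measure R), w n x @[n --> \oo] --> v x) ->
  (\forall n \near \oo, sqn (w n) <= c) -> L2 v /\ sqn v <= c.
Proof.
move=> w2 mv wv wc.
have : (\int[mu]_x (v x ^+ 2)%:E <= c%:E)%E.
  have -> : (\int[mu]_x (v x ^+ 2)%:E)%E =
      (\int[mu]_x limn_einf (fun n => (w n x ^+ 2)%:E))%E.
    apply: ge0_ae_eq_integral => //.
    - by apply/measurable_EFinP; exact: measurable_funX.
    - under eq_fun do rewrite -[limn_einf _]oppeK -limn_esupN.
      apply: measurableT_comp => //; apply: measurable_fun_limn_esup => n.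
      apply: measurableT_comp => //; apply/measurable_EFinP.
      by apply: measurable_funX; exact: L2_measurable.
    - by move=> x _; rewrite lee_fin sqr_ge0.
    - move=> x _; rewrite limn_einf_lim; apply: lime_ge.
        apply/cvg_ex; eexists; apply/ereal_nondecreasing_cvgn => a b ab.
        by apply: ereal_inf_le_tmp => // _ [n /= bn <-]; exists n => //=;
          rewrite (leq_trans ab).
      apply: nearW => n; apply: le_ereal_inf_tmp => _ [m /= _ <-].
      by rewrite lee_fin sqr_ge0.
    - apply: aeS wv => x wvx _; apply/esym.
      have : (w n x ^+ 2)%:E @[n --> \oo] --> (v x ^+ 2)%:E.
        apply: cvg_EFin; first exact: nearW.
        by rewrite expr2; under eq_cvg do rewrite /= expr2; exact: cvgM.
      by move=> /cvg_limn_einf_sup[].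
  apply: le_trans (fatou _ _ _ _) _ => //.
  - by move=> n; apply/measurable_EFinP; apply: measurable_funX; exact: L2_measurable.
  - by move=> n x _; rewrite lee_fin sqr_ge0.
  - apply: limn_einf_le_near; apply: filterS wc => n wn.
    by rewrite L1_EFin ?lee_fin//; exact: L2_sqr.
move=> vc.
have v2 : L2 v.
  apply/L2P; split => //; apply: L1_lty.
  - exact: measurable_funX.
  - by move=> x; exact: sqr_ge0.
  - exact: le_lt_trans vc (ltry _).
by split => //; rewrite -lee_fin -L1_EFin//; exact: L2_sqr.
Qed.

Lemma sum_half_le (n : nat) : \sum_(k < n) (4^-1 : R) ^+ k <= 2.
Proof.
suff : \sum_(k < n) (4^-1 : R) ^+ k = (4 - 4 * 4^-1 ^+ n) / 3.
  move->; have : 0 <= (4^-1 : R) ^+ n by rewrite exprn_ge0.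
  lra.
elim: n => [|n IH]; first by rewrite big_ord0 expr0 mulr1 subrr mul0r.
by rewrite big_ord_recr/= IH exprS; field.
Qed.

(** The hypothesis is the square of [|a k.+1 - a k| <= c / 2 ^ k]; a bound on
    squares is what integrating a sum of squares provides. *)
Lemma cvgn_of_geometric_steps (a : nat -> R) c :
  (forall k, 4 ^+ k * (a k.+1 - a k) ^+ 2 <= c ^+ 2) -> 0 <= c -> cvgn a.
Proof.
move=> ac c0.
have -> : a = (fun n => a 0%N + series (telescope a) n).
  by apply/funext => n; exact: eq_sum_telescope.
apply: is_cvgD; first exact: is_cvg_cst.
apply: (@normed_cvg R R^o); apply: series_le_cvg (@is_cvg_geometric_series _ c 2^-1 _).
- by move=> n /=; rewrite normr_ge0.
- move=> n; by rewrite /= mulr_ge0 ?exprn_ge0.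
- move=> n /=; rewrite -ler_sqr ?nnegrE ?mulr_ge0 ?exprn_ge0 ?invr_ge0//.
  rewrite real_normK ?num_real// exprMn -exprM mulnC exprM.
  have -> : (2^-1 ^+ 2 : R) = 4^-1 by field.
  by rewrite exprVn ler_pdivlMr ?exprn_gt0// mulrC.
- by rewrite gtr0_norm// invf_lt1// ltr1n.
Qed.

(** Riesz-Fischer: a subsequence with square distances at most 16^-k converges
    almost everywhere, and Fatou's lemma identifies its pointwise limit as the
    limit in norm of the whole sequence. *)
Lemma L2_complete (u : nat -> R -> R) : (forall n, L2 (u n)) ->
  (forall e, 0 < e -> exists N, forall m n, (N <= m)%N -> (N <= n)%N ->
    sqn (fun x => u m x - u n x) <= e) ->
  exists2 v, L2 v & sqn (fun x => u n x - v x) @[n --> \oo] --> 0.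
Proof.
move=> u2 uC.
have /choice[N NP] : forall k : nat, exists N, forall m n, (N <= m)%N ->
    (N <= n)%N -> sqn (fun x => u m x - u n x) <= 16^-1 ^+ k.
  by move=> k; apply: uC; rewrite exprn_gt0// invr_gt0.
pose phi k := (\max_(i < k.+1) N i + k)%N.
have Nphi k m : (k <= m)%N -> (N k <= phi m)%N.
  move=> km; apply: leq_trans (leq_addr _ _).
  by apply: (@leq_bigmax_cond _ _ (fun i : 'I_m.+1 => N i) (Ordinal (_ : k < m.+1)%N)).
have phige k : (k <= phi k)%N by rewrite leq_addl.
pose d k x := u (phi k.+1) x - u (phi k) x.
have d2 k : L2 (d k) by exact: L2B.
have sd k : sqn (d k) <= 16^-1 ^+ k by apply: NP; apply: Nphi.
(* The weights 4 ^ k turn a pointwise bound on S into geometric steps, and leave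
   its integral summable. *)
pose S K x := \sum_(k < K) 4 ^+ k * d k x ^+ 2.
have S1 K : L1 (S K) /\ \int[mu]_x S K x <= 2.
  suff [S1 SK] : L1 (S K) /\ \int[mu]_x S K x = \sum_(k < K) 4 ^+ k * sqn (d k).
    split => //; rewrite SK; apply: le_trans (sum_half_le K).
    apply: ler_sum => k _; rewrite -ler_pdivlMl ?exprn_gt0//.
    rewrite -exprVn -exprMn; apply: le_trans (sd k) _.
    by rewrite (_ : 4^-1 * 4^-1 = 16^-1 :> R)//; field.
  rewrite /S; elim: K => [|K [IH1 IH2]].
    split; first by under [X in EFin \o X]eq_fun do rewrite big_ord0; exact: integrable0.
    under eq_Rintegral do rewrite big_ord0.
    by rewrite Rintegral_cst// mul0r big_ord0.
  have dK : L1 (fun x => 4 ^+ K * d K x ^+ 2) by exact/L1Z/L2_sqr.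
  split.
    by under [X in EFin \o X]eq_fun do rewrite big_ord_recr/=; exact: L1D.
  under eq_Rintegral do rewrite big_ord_recr/=.
  by rewrite RintegralD// IH2 big_ord_recr/= RintegralZl//; exact: L2_sqr.
have S0 K x : 0 <= S K x.
  by apply: sumr_ge0 => k _; rewrite mulr_ge0 ?sqr_ge0 ?exprn_ge0.
have Sle x : {homo S^~ x : m n / (m <= n)%N >-> m <= n}.
  apply: homo_leq => [y|y z t|n /=]; [exact: lexx|exact: le_trans|].
  by rewrite /S [leRHS]big_ord_recr/= lerDl mulr_ge0 ?sqr_ge0 ?exprn_ge0.
have Sbnd : \forall x \ae (@lebesgue_measure R), exists2 c, 0 <= c & forall K, S K x <= c ^+ 2.
  pose G x := limn_einf (fun K => (S K x)%:E).
  have mG : measurable_fun setT G.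
    rewrite /G; under eq_fun do rewrite -[limn_einf _]oppeK -limn_esupN.
    apply: measurableT_comp => //; apply: measurable_fun_limn_esup => n.
    by apply/measurable_EFinP; apply: (measurableT_comp _ (L1_measurable (S1 n).1)).
  have SG K x : ((S K x)%:E <= G x)%E.
    rewrite /G limn_einf_lim; apply: lime_ge.
      apply/cvg_ex; eexists; apply/ereal_nondecreasing_cvgn => a b ab.
      by apply: ereal_inf_le_tmp => // _ [n /= bn <-]; exists n => //=;
        rewrite (leq_trans ab).
    near=> n; apply: le_ereal_inf_tmp => _ [m /= nm <-].
    by rewrite lee_fin Sle// (leq_trans _ nm)//; near: n; exact: nbhs_infty_ge.
  have iG : lebesgue_measure.-integrable setT G.
    apply/integrableP; split => //.
    under eq_integral => x _ do rewrite gee0_abs ?(le_trans _ (SG 0%N x)) ?lee_fin//.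
    apply: le_lt_trans (fatou _ _ _ _) _ => //.
    - by move=> n; apply/measurable_EFinP; exact: (L1_measurable (S1 n).1).
    - by move=> n x _; rewrite lee_fin.
    - apply: (@le_lt_trans _ _ 2%:E); last exact: ltry.
      apply: limn_einf_le_near; apply: nearW => n.
      by rewrite L1_EFin ?lee_fin; case: (S1 n).
  apply: aeS (integrable_ae measurableT iG) => x /(_ I) fG.
  exists (Num.sqrt (fine (G x))); first exact: sqrtr_ge0.
  move=> K; rewrite sqr_sqrtr; last by rewrite fine_ge0// (le_trans _ (SG 0%N x)) ?lee_fin.
  by rewrite -lee_fin fineK.
have cu : \forall x \ae (@lebesgue_measure R), cvgn (fun k => u (phi k) x).
  apply: aeS Sbnd => x [c c0 Sc]; apply: (@cvgn_of_geometric_steps _ c) => // k.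
  apply: le_trans (Sc k.+1); rewrite /S big_ord_recr/= lerDr.
  exact: S0.
(* A measurable function that is the limit wherever it exists. *)
pose v x := fine (limn_esup (fun k => (u (phi k) x)%:E)).
have mv : measurable_fun setT v.
  apply: (measurableT_comp (fine_measurable _)) => //.
  apply: measurable_fun_limn_esup => n; apply/measurable_EFinP; exact: L2_measurable.
have uv : \forall x \ae (@lebesgue_measure R), u (phi k) x @[k --> \oo] --> v x.
  apply: aeS cu => x ux; rewrite /v.
  have : (u (phi k) x)%:E @[k --> \oo] --> (limn (fun k => u (phi k) x))%:E.
    by apply: cvg_EFin => //; exact: nearW.
  by move=> /cvg_limn_einf_sup[_ ->].
have key e : 0 < e -> exists N, forall n, (N <= n)%N ->
    L2 (fun x => u n x - v x) /\ sqn (fun x => u n x - v x) <= e.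
  move=> e0; have [M MP] := uC _ e0; exists M => n Mn.
  apply: (@sqn_fatou (fun k x => u n x - u (phi k) x)).
  - by move=> k; exact: L2B.
  - by apply: measurable_funB => //; exact: L2_measurable.
  - by apply: aeS uv => x ux; apply: cvgB => //; exact: cvg_cst.
  - near=> k; apply: MP => //; apply: leq_trans (phige k).
    by near: k; exact: nbhs_infty_ge.
exists v.
  have [M /(_ M (leqnn _))[+ _]] := key 1 ltr01.
  move=> /(L2B (u2 M)); under [X in L2 X -> _]eq_fun do rewrite opprB addrC subrK.
  by [].
apply/cvgrPdist_le => e e0; have [M MP] := key _ e0.
near=> n; rewrite sub0r normrN ger0_norm ?sqn_ge0//.
by apply: (MP n _).2; near: n; exact: nbhs_infty_ge.
Unshelve. all: by end_near. Qed.

(** By Lebesgue's differentiation theorem the indefinite integral of [f], here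
    constant, has derivative [f] almost everywhere. *)
Lemma L2_itv_eq0 f : L2 f ->
  (forall a b, a < b -> \int[mu]_(x in `[a, b]) f x = 0) -> f = cst 0 %[ae mu].
Proof.
move=> f2 fI; have mf := L2_measurable f2.
have fi (K : set R) : measurable K -> (mu K < +oo)%E ->
    lebesgue_measure.-integrable K (EFin \o f).
  move=> mK Ky.
  have ig : lebesgue_measure.-integrable K (EFin \o (fun x => 1 + f x ^+ 2)).
    have i1 : lebesgue_measure.-integrable K (EFin \o cst (1 : R)).
      apply/integrableP; split; first by apply/measurable_EFinP; exact: measurable_cst.
      by rewrite /comp/= normr1 integral_cst//= mul1e.
    have i2 : lebesgue_measure.-integrable K (EFin \o (fun x => f x ^+ 2)).
      by apply: integrableS (L2_sqr f2).
    have := @integrableD _ _ _ lebesgue_measure K mK _ _ i1 i2; exact: eq_integrable.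
  apply: (@le_integrable _ _ _ lebesgue_measure K mK _ _ _ _ ig).
    by apply/measurable_EFinP; exact: measurable_funTS.
  move=> x _; rewrite /= lee_fin [leRHS]ger0_norm ?addr_ge0 ?sqr_ge0//.
  rewrite -[f x ^+ 2]real_normK ?num_real//.
  by have := sqr_ge0 (`|f x| - 1); have := normr_ge0 (f x); nra.
have loc : locally_integrable setT f.
  split => //; first exact: openT.
  move=> K _ cK; have mK : measurable K by apply: compact_measurable.
  by have /integrableP[_ ]:= fi K mK (compact_finite_measure cK).
have H (n : nat) : \forall x \ae (@lebesgue_measure R), - n%:R < x -> f x = 0.
  have /= := @FTC1 R f (BLeft (- n%:R)).
  have F0 : (fun x => \int[lebesgue_measure]_(t in `[- n%:R, x]) f t) = cst 0.
    apply/funext => x; have [nx|xn|->] := ltgtP (- n%:R) x.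
    - exact: fI.
    - by rewrite set_itv_ge ?Rintegral_set0// bnd_simp -ltNge.
    - by rewrite set_itv1 Rintegral_set1.
  rewrite F0 => /(_ _ loc) K; apply: aeS (K _).
    by move=> x xP; rewrite -lte_fin => /xP[_ <-]; rewrite derive1_cst.
  move=> y; apply: fi => //; rewrite lebesgue_measure_itv/=.
  by case: ifP => // _; rewrite -EFinB ltry.
have : \forall x \ae (@lebesgue_measure R), forall n : nat, - n%:R < x -> f x = 0.
  by apply/ae_foralln => n; exact: H.
move=> K; apply/ae_eqE; apply: aeS K => x /(_ (Num.truncn `|x|).+1); apply.
by rewrite ltrNl (le_lt_trans (ler_norm _))// normrN truncnS_gt.
Qed.
End Completeness.

(** * Integrals depending on a parameter *)
Section IntegralTools.
Context {R : realType}.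
Implicit Types f g h u v : R -> R.

Lemma Rdominated_cvg (u : nat -> R -> R) v g :
  (forall n, measurable_fun setT (u n)) -> measurable_fun setT v ->
  (\forall x \ae (@lebesgue_measure R), u n x @[n --> \oo] --> v x) ->
  L1 g -> (forall n x, `|u n x| <= g x) ->
  L1 v /\ \int[mu]_x u n x @[n --> \oo] --> \int[mu]_x v x.
Proof.
move=> um mv uv g1 ug.
have u1 n : L1 (u n) by exact: L1_le (ug n) g1.
have [] := @dominated_convergence _ _ _ (@lebesgue_measure R) setT measurableT
  (fun n x => (u n x)%:E) (EFin \o v) (EFin \o g).
- by move=> n; apply/measurable_EFinP; exact: um.
- by apply/measurable_EFinP; exact: mv.
- by apply: aeS uv => x uvx _; apply: cvg_EFin => //; exact: nearW.
- exact: g1.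
- by apply: aeW => x n _; rewrite lee_fin.
move=> v1 _ c; split => //.
by apply: fine_cvg; rewrite -L1_EFin.
Qed.

Definition trunc (n : nat) f : R -> R := f \_ `[- n%:R, n%:R].

Lemma truncE n f x : trunc n f x = if `|x| <= n%:R then f x else 0.
Proof.
rewrite /trunc patchE; case: ifPn => [|/negP h].
  by rewrite inE/= in_itv/= ler_norml => ->.
by case: ifPn => //; rewrite ler_norml => h'; exfalso; apply: h; rewrite inE/= in_itv.
Qed.

Lemma cvg_trunc f x : trunc n f x @[n --> \oo] --> f x.
Proof.
apply: cvg_near_cst; near=> n; rewrite truncE ifT//.
by near: n; exact: nbhs_infty_ger.
Unshelve. all: by end_near. Qed.

Lemma measurable_trunc n f : measurable_fun setT f -> measurable_fun setT (trunc n f).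
Proof.
by move=> mf; apply: ((measurable_restrictT f (measurable_itv `[- n%:R, n%:R])).1 (measurable_funTS mf)).
Qed.

Lemma norm_trunc_le n f x : `|trunc n f x| <= `|f x|.
Proof. by rewrite truncE; case: ifP => // _; rewrite normr0. Qed.

Lemma cvg_Rintegral_trunc f : L1 f ->
  \int[mu]_x trunc n f x @[n --> \oo] --> \int[mu]_x f x.
Proof.
move=> f1; apply: (Rdominated_cvg _ _ _ (L1_norm f1) _).2.
- by move=> n; apply: measurable_trunc; exact: L1_measurable.
- exact: L1_measurable.
- by apply: aeW => x; exact: cvg_trunc.
- by move=> n x; exact: norm_trunc_le.
Qed.

Lemma is_derive_cast (f : R -> R) (x a b : R) : is_derive x 1 f a -> a = b ->
  is_derive x 1 f b.
Proof. by move=> + <-. Qed.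

Lemma is_deriveMr (f g : R -> R) (x a b : R) : is_derive x 1 f a ->
  is_derive x 1 g b -> is_derive x 1 (fun x => f x * g x) (a * g x + f x * b).
Proof.
move=> fa gb; apply: is_derive_cast (@is_deriveM _ _ f g x 1 _ _ fa gb) _.
by rewrite /GRing.scale/= addrC mulrC.
Qed.

Lemma is_deriveZr (f : R -> R) (x a c : R) : is_derive x 1 f a ->
  is_derive x 1 (fun x => c * f x) (c * a).
Proof. by move=> fa; exact: (@is_deriveZ _ _ _ f). Qed.

Lemma is_derive_compr (f g : R -> R) (x a b : R) : is_derive (g x) 1 f a ->
  is_derive x 1 g b -> is_derive x 1 (fun x => f (g x)) (a * b).
Proof. exact: is_derive1_comp. Qed.

(** A primitive that is O(1/|x|) vanishes at both infinities; the point [m] is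
    the centre of the Gaussian to which this is applied. *)
Lemma Rintegral_derive_eq0 (F f : R -> R) m K :
  (forall x : R, is_derive x 1 F (f x)) -> continuous f -> L1 f ->
  (forall x, `|F x| * `|x - m| <= K) -> \int[mu]_x f x = 0.
Proof.
move=> dF cf f1 FK.
have cF : continuous F.
  by move=> x; apply/differentiable_continuous/derivable1_diffP; case: (dF x).
have F'E x : F^`()%classic x = f x by rewrite derive1E; case: (dF x).
have itvE n : \int[mu]_x trunc n.+1 f x = F n.+1%:R - F (- n.+1%:R).
  rewrite -Rintegral_mkcond /Rintegral (@continuous_FTC2 _ f F) ?gtrN//.
  - exact: continuous_subspaceT.
  - split.
    + by move=> x _; case: (dF x).
    + exact/cvg_at_right_filter/cF.
    + exact/cvg_at_left_filter/cF.
have F0 (s : nat -> R) : (forall n, `|s n| = n.+1%:R) -> F (s n) @[n --> \oo] --> 0.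
  move=> sn; apply/cvgr0Pnorm_le => e e0; near=> n.
  have h : `|m| + K / e < `|s n - m|.
    rewrite (lt_le_trans _ (lerB_dist _ _))// sn.
    rewrite ltrBrDl (@lt_trans _ _ n%:R) ?ltr_nat//.
    by near: n; exact: nbhs_infty_gtr.
  have K0 : 0 <= K by apply: le_trans (FK m); rewrite mulr_ge0.
  have := FK (s n); have Ke : K = K / e * e by rewrite divfK ?gt_eqF.
  have Ke0 : 0 <= K / e by rewrite divr_ge0// ltW.
  have sm : 0 < `|s n - m| by apply: le_lt_trans h; rewrite addr_ge0.
  rewrite -ler_pdivlMr// => /le_trans; apply; rewrite ler_pdivrMr// {1}Ke mulrC.
  by rewrite ler_pM2l// ltW// (le_lt_trans _ h)// lerDr.
have c1 := cvg_Rintegral_trunc f1.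
have c2 : \int[mu]_x trunc n.+1 f x @[n --> \oo] --> \int[mu]_x f x.
  by move: c1; rewrite -(cvg_shiftS (fun n => \int[mu]_x trunc n f x)).
have c3 : \int[mu]_x trunc n.+1 f x @[n --> \oo] --> 0.
  under eq_cvg do rewrite itvE.
  have : F n.+1%:R - F (- n.+1%:R) @[n --> \oo] --> (0 - 0 : R).
    by apply: cvgB; apply: F0 => n; rewrite ?normrN ger0_norm.
  by rewrite subr0.
exact: (cvg_unique _ c2 c3).
Unshelve. all: by end_near. Qed.

Lemma measurable_Rintegral_snd (F : R -> R -> R) :
  measurable_fun setT (fun z : R * R => F z.1 z.2) ->
  measurable_fun setT (fun x => \int[mu]_y F x y).
Proof.
move=> mF.
have mF' : measurable_fun setT (fun z : R * R => (F z.1 z.2)%:E).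
  exact/measurable_EFinP.
apply: (measurableT_comp (fine_measurable _)) => //.
under eq_fun do rewrite integralE.
apply: emeasurable_funB.
- have p0 z : (0 <= ((fun z : R * R => (F z.1 z.2)%:E)^\+ z))%E by exact: funepos_ge0.
  have := @measurable_fun_fubini_tonelli_F _ _ _ _ _ (@lebesgue_measure R) _
    (measurable_funepos mF') p0.
  congr (measurable_fun _ _); apply/funext => x; apply: eq_integral => y _.
  by rewrite !funeposE.
- have n0 z : (0 <= ((fun z : R * R => (F z.1 z.2)%:E)^\- z))%E by exact: funeneg_ge0.
  have := @measurable_fun_fubini_tonelli_F _ _ _ _ _ (@lebesgue_measure R) _
    (measurable_funeneg mF') n0.
  congr (measurable_fun _ _); apply/funext => x; apply: eq_integral => y _.
  by rewrite !funenegE.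
Qed.

Lemma RTonelli (F : R -> R -> R) :
  measurable_fun setT (fun z : R * R => F z.1 z.2) ->
  (forall x, L1 (F x)) -> (forall y, L1 (F^~ y)) ->
  L1 (fun x => \int[mu]_y `|F x y|) -> L1 (fun y => \int[mu]_x `|F x y|).
Proof.
move=> mF Fx Fy F1.
have mF2 : measurable_fun setT (fun z : R * R => `|F z.1 z.2|).
  exact: measurableT_comp.
have mF' : measurable_fun setT (fun z : R * R => `|F z.1 z.2|%:E).
  exact/measurable_EFinP.
apply: L1_lty.
- apply: (@measurable_Rintegral_snd (fun y x => `|F x y|)).
  exact: (measurableT_comp mF2 (measurable_fun_pair measurable_snd measurable_fst)).
- by move=> y; exact: Rintegral_ge0.
- have := @fubini_tonelli _ _ _ _ _ (@lebesgue_measure R) (@lebesgue_measure R)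
    _ mF' (fun z => (normr_ge0 (F z.1 z.2) : (0%:E <= `|F z.1 z.2|%:E)%E)).
  under eq_integral => x _ do rewrite (L1_EFin (L1_norm (Fx x))).
  under [in X in _ = X]eq_integral => y _ do rewrite (L1_EFin (L1_norm (Fy y))).
  by move=> <-; rewrite (L1_EFin F1) ltry.
Qed.

(** The inner integrals are asked to exist everywhere, so that the real-valued
    integrals agree with the extended ones at every point. *)
Lemma RFubini (F : R -> R -> R) :
  measurable_fun setT (fun z : R * R => F z.1 z.2) ->
  (forall x, L1 (F x)) -> (forall y, L1 (F^~ y)) ->
  L1 (fun x => \int[mu]_y `|F x y|) ->
  L1 (fun y => \int[mu]_x F x y) /\
  \int[mu]_x \int[mu]_y F x y = \int[mu]_y \int[mu]_x F x y.
Proof.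
move=> mF Fx Fy F1; split.
  apply: L1_le (RTonelli mF Fx Fy F1).
    apply: (@measurable_Rintegral_snd (fun y x => F x y)).
    exact: (measurableT_comp mF (measurable_fun_pair measurable_snd measurable_fst)).
  by move=> y; exact: le_normr_Rintegral.
have mF' : measurable_fun setT (fun z : R * R => (F z.1 z.2)%:E).
  exact/measurable_EFinP.
have iF := (integrable12ltyP lebesgue_measure lebesgue_measure mF').2.
have : ((\int[lebesgue_measure]_x \int[lebesgue_measure]_y `|(F x y)%:E|) < +oo)%E.
  under eq_integral => x _ do rewrite (L1_EFin (L1_norm (Fx x))).
  by rewrite (L1_EFin F1) ltry.
move=> /iF /Fubini/=.
under eq_integral => x _ do rewrite (L1_EFin (Fx x)).
under [in X in _ = X]eq_integral => y _ do rewrite (L1_EFin (Fy y)).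
by move=> h; rewrite /Rintegral h.
Qed.

(** Differentiation under the integral sign, with a global bound. *)
Lemma is_derive_Rintegral (f df : R -> R -> R) (G : R -> R) (y : R) :
  (forall z, L1 (f z)) -> (forall z x : R, is_derive z 1 (f^~ x) (df z x)) ->
  L1 G -> (forall z x, `|df z x| <= G x) ->
  is_derive y 1 (fun z => \int[mu]_x f z x) (\int[mu]_x df y x).
Proof.
move=> f1 fd G1 dG.
have Iy : `]y - 1, y + 1[%classic y by rewrite /= in_itv/= ltrBlDr ltrDl ltr01.
have E z x : partial1of2 f z x = df z x.
  by rewrite /partial1of2 derive1E; case: (fd z x).
have G0 x : 0 <= G x by apply: le_trans (dG 0 x).
have fdd (z x : R) : `]y - 1, y + 1[%classic z -> setT x -> derivable (f^~ x) z 1.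
  by move=> _ _; case: (fd z x).
have dG' (z x : R) : `]y - 1, y + 1[%classic z -> setT x -> `|partial1of2 f z x| <= G x.
  by move=> _ _; rewrite E.
have f1' (z : R) : `]y - 1, y + 1[%classic z -> L1 (f z) by [].
have -> : \int[mu]_x df y x = \int[mu]_x partial1of2 f y x.
  by apply: eq_Rintegral => x _; rewrite E.
apply: DeriveDef; first exact: (derivable_under_integral measurableT Iy f1' fdd G0 G1 dG').
rewrite -derive1E.
exact: (differentiation_under_integral measurableT Iy f1' fdd G0 G1 dG').
Qed.

End IntegralTools.

(** * Fourier integrals of Gaussians *)
Section Gaussian.
Context {R : realType} (m s : R).
Hypothesis s_gt0 : 0 < s.

Let s0 : s != 0. Proof. by rewrite gt_eqF. Qed.

Lemma gaussE x :
  normal_pdf m s x = normal_peak s * expR (- (x - m) ^+ 2 / (s ^+ 2 *+ 2)).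
Proof. by rewrite normal_pdfE. Qed.

Lemma is_derive_gauss (x : R) :
  is_derive x 1 (normal_pdf m s) (- (x - m) / s ^+ 2 * normal_pdf m s x).
Proof.
rewrite (_ : normal_pdf m s = fun x => normal_peak s * expR (- (x - m) ^+ 2 / (s ^+ 2 *+ 2))); last first.
  by apply/funext => y; rewrite gaussE.
have d1 : is_derive x 1 (fun x => - (x - m) ^+ 2 / (s ^+ 2 *+ 2)) (- (x - m) / s ^+ 2).
  rewrite (_ : (fun x => _) = (fun x => (- (s ^+ 2 *+ 2)^-1) *: (x - m) ^+ 2)); last first.
    by apply/funext => y; rewrite mulNr -mulrN mulrC.
  apply: is_derive_eq; rewrite /GRing.scale/=; field; exact: s0.
have d2 := is_derive_compr (is_derive_expR _) d1.
apply: (is_derive_cast (is_deriveZr _ d2)); rewrite mulrA mulrC//.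
Qed.

(** The first moment against a Gaussian twice as wide:
    w exp(- 3 w^2 / 8) is bounded by 1, since 1 + 3 w^2 / 8 >= w. *)
Lemma gauss_tail x :
  normal_pdf m s x * `|x - m| <=
  s * normal_peak s / normal_peak (2 * s) * normal_pdf m (2 * s) x.
Proof.
have s20 : 2 * s != 0 by rewrite mulf_neq0.
rewrite gaussE [in leRHS]normal_pdfE//= /normal_fun mulrA divfK; last first.
  by rewrite gt_eqF// normal_peak_gt0.
rewrite [s * _]mulrC -!mulrA ler_wpM2l ?normal_peak_ge0//.
set v := (x - m) ^+ 2 / s ^+ 2.
have v0 : 0 <= v by rewrite divr_ge0// sqr_ge0.
rewrite (_ : - (x - m) ^+ 2 / (s ^+ 2 *+ 2) = - (v * (3 / 8)) + - (v / 8)); last first.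
  by rewrite /v; field; exact: s0.
rewrite (_ : - (x - m) ^+ 2 / ((2 * s) ^+ 2 *+ 2) = - (v / 8)); last first.
  by rewrite /v; field; exact: s0.
rewrite expRD -mulrA mulrCA [leRHS]mulrC ler_wpM2l ?expR_ge0// expRN.
rewrite mulrC ler_pdivrMr ?expR_gt0//.
apply: (@le_trans _ _ (s * (1 + v * (3 / 8)))); last by rewrite ler_pM2l// expR_ge1Dx.
have -> : `|x - m| = s * Num.sqrt v.
  by rewrite /v -expr_div_n sqrtr_sqr normrM [`|s^-1|]gtr0_norm ?invr_gt0// mulrC divfK.
rewrite ler_pM2l//; set w := Num.sqrt v; have -> : v = w ^+ 2 by rewrite sqr_sqrtr.
by have := sqr_ge0 (w - 4/3); lra.
Qed.

Lemma L1_gauss_moment : L1 (fun x => normal_pdf m s x * `|x - m|).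
Proof.
apply: L1_le (L1Z (s * normal_peak s / normal_peak (2 * s))
  (integrable_normal_pdf m (2 * s))).
  apply: measurable_funM; first exact: measurable_normal_pdf.
  by apply: measurableT_comp => //; exact: measurable_funB.
by move=> x; rewrite ger0_norm ?mulr_ge0 ?normal_pdf_ge0//; exact: gauss_tail.
Qed.

(** Differentiating under the integral sign and integrating by parts, the left
    side [q] satisfies q' = - s^2 xi q after the shift [x - m]. *)
Lemma gauss_cos_center theta xi :
  \int[mu]_x (normal_pdf m s x * cos (xi * (x - m) - theta)) =
  expR (- (s ^+ 2 * xi ^+ 2 / 2)) * cos theta.
Proof.
pose q xi := \int[mu]_x (normal_pdf m s x * cos (xi * (x - m) - theta)).
pose p xi := \int[mu]_x (normal_pdf m s x * (x - m) * sin (xi * (x - m) - theta)).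
have mN : measurable_fun setT (normal_pdf m s) by exact: measurable_normal_pdf.
have clin y : continuous (fun x => y * (x - m) - theta).
  move=> x; apply: cvgB; last exact: cvg_cst.
  by apply: cvgM; [exact: cvg_cst|apply: cvgB; [exact: cvg_id|exact: cvg_cst]].
have ccos y : continuous (fun x => cos (y * (x - m) - theta)).
  by move=> x; apply: continuous_comp; [exact: clin|exact: continuous_cos].
have csin y : continuous (fun x => sin (y * (x - m) - theta)).
  by move=> x; apply: continuous_comp; [exact: clin|exact: continuous_sin].
have mxm : measurable_fun setT (fun x : R => x - m) by exact: measurable_funB.
have iN : L1 (normal_pdf m s) by exact: integrable_normal_pdf.
have icos y : L1 (fun x => normal_pdf m s x * cos (y * (x - m) - theta)).
  apply: L1_le iN; first by apply: measurable_funM => //; exact: continuous_measurable_fun.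
  move=> x; rewrite normrM ger0_norm ?normal_pdf_ge0// ler_piMr ?normal_pdf_ge0//.
  by rewrite ler_norml cos_geN1 cos_le1.
have isin y : L1 (fun x => normal_pdf m s x * (x - m) * sin (y * (x - m) - theta)).
  apply: L1_le L1_gauss_moment.
    by apply: measurable_funM; [exact: measurable_funM|exact: continuous_measurable_fun].
  move=> x; rewrite !normrM ger0_norm ?normal_pdf_ge0// ler_piMr ?mulr_ge0 ?normal_pdf_ge0//.
  by rewrite ler_norml sin_geN1 sin_le1.
have dq (y : R) : is_derive y 1 q (- p y).
  have d1 (z x : R) : is_derive z 1 (fun z => normal_pdf m s x * cos (z * (x - m) - theta))
      (- (normal_pdf m s x * (x - m) * sin (z * (x - m) - theta))).
    have e1 : is_derive z 1 (fun z => z * (x - m) - theta) (x - m).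
      rewrite (_ : (fun z => _) = (fun z : R => (x - m) *: z - theta)); last first.
        by apply/funext => y'; rewrite mulrC.
      by apply: is_derive_eq; rewrite subr0 /GRing.scale/= mulr1.
    have e2 := is_derive_compr (is_derive_cos _) e1.
    by apply: (is_derive_cast (is_deriveZr _ e2)); ring.
  have -> : - p y = \int[mu]_x - (normal_pdf m s x * (x - m) * sin (y * (x - m) - theta)).
    by rewrite /p -mulN1r -RintegralZl//; apply: eq_Rintegral => x _; rewrite mulN1r.
  apply: (is_derive_Rintegral y icos d1 L1_gauss_moment) => z x.
  rewrite normrN !normrM ger0_norm ?normal_pdf_ge0//.
  by rewrite ler_piMr ?mulr_ge0 ?normal_pdf_ge0// ler_norml sin_geN1 sin_le1.
have pq y : p y = s ^+ 2 * y * q y.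
  have d (x : R) : is_derive x 1 (fun x => normal_pdf m s x * sin (y * (x - m) - theta))
      (- (s ^+ 2)^-1 * (normal_pdf m s x * (x - m) * sin (y * (x - m) - theta)) +
        y * (normal_pdf m s x * cos (y * (x - m) - theta))).
    have e1 : is_derive x 1 (fun x => y * (x - m) - theta) y.
      rewrite (_ : (fun x => _) = (fun x : R => y *: (x - m) - theta)); last by [].
      by apply: is_derive_eq; rewrite !subr0 /GRing.scale/= mulr1.
    have e2 := is_derive_compr (is_derive_sin _) e1.
    have e3 := is_deriveMr (is_derive_gauss x) e2.
    by apply: (is_derive_cast e3); field; exact: s0.
  have cN : continuous (normal_pdf m s) by exact: continuous_normal_pdf.
  have := Rintegral_derive_eq0 (m := m) (K := s * normal_peak s / normal_peak (2 * s) * normal_peak (2 * s)) d _ _ _.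
  rewrite RintegralD ?RintegralZl//; try exact: L1Z.
  move=> H; have : - s ^- 2 * p y + y * q y = 0.
    apply: H.
    - move=> x; apply: cvgD.
        apply: cvgM; first exact: cvg_cst.
        apply: cvgM; last exact: csin.
        apply: cvgM; first exact: cN.
        by apply: cvgB; [exact: cvg_id|exact: cvg_cst].
      apply: cvgM; first exact: cvg_cst.
      by apply: cvgM; [exact: cN|exact: ccos].
    - by apply: L1D; exact: L1Z.
    - move=> x; have := gauss_tail x; rewrite normrM [`|normal_pdf m s x|]ger0_norm ?normal_pdf_ge0//.
      set t := sin _ => h; apply: (@le_trans _ _ (normal_pdf m s x * `|x - m|)).
        rewrite mulrAC ler_piMr ?mulr_ge0 ?normal_pdf_ge0//.
        by rewrite /t ler_norml sin_geN1 sin_le1.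
      apply: (le_trans h); rewrite ler_wpM2l//.
        by rewrite divr_ge0 ?mulr_ge0 ?normal_peak_ge0// ltW.
      by apply: normal_pdf_ub; rewrite mulf_neq0.
  move=> e; have -> : p y = - s ^+ 2 * ((- s ^- 2 * p y + y * q y) - y * q y).
    by field; exact: s0.
  by rewrite e; ring.
have [E] : exists E : R -> R, E = fun y => expR (s ^+ 2 * y ^+ 2 / 2) * q y by eexists.
move=> EE.
have dE (y : R) : is_derive y 1 E 0.
  have e1 : is_derive y 1 (fun y => s ^+ 2 * y ^+ 2 / 2) (s ^+ 2 * y).
    rewrite (_ : (fun y => _) = (fun y => (s ^+ 2 / 2) *: y ^+ 2)); last first.
      by apply/funext => z; rewrite /GRing.scale/=; ring.
    by apply: is_derive_eq; rewrite /GRing.scale/=; field.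
  have e2 := is_deriveMr (is_derive_compr (is_derive_expR _) e1) (dq y).
  by rewrite EE; apply: (is_derive_cast e2); rewrite pq; ring.
have := is_derive_0_is_cst xi 0 dE; rewrite EE.
rewrite expr0n/= mulr0 mul0r expR0 mul1r.
have -> : q 0 = cos theta.
  rewrite /q; under eq_Rintegral do rewrite mul0r sub0r cosN.
  by rewrite RintegralZr// /Rintegral integral_normal_pdf mul1r.
move=> <-; rewrite mulrA -expRD [X in expR X](_ : _ = 0) ?expR0 ?mul1r//.
by rewrite addrC subrr.
Qed.

(** The phase [theta] covers cosine and sine at once. *)
Lemma gauss_cos theta xi :
  \int[mu]_x (normal_pdf m s x * cos (xi * x - theta)) =
  expR (- (s ^+ 2 * xi ^+ 2 / 2)) * cos (xi * m - theta).
Proof.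
rewrite -[cos (_ - _)]cosN opprB -gauss_cos_center.
by apply: eq_Rintegral => x _; congr (_ * cos _); ring.
Qed.

End Gaussian.

(** * The Hartley integral of integrable functions *)
Section HartleyIntegral.
Context {R : realType}.
Implicit Types f g h u v : R -> R.

Lemma eq_Rint f g : f =1 g -> \int[mu]_x f x = \int[mu]_x g x.
Proof. by move=> fg; apply: eq_Rintegral => x _; exact: fg. Qed.

(** Hartley's kernel is [cas (xi * y)], real and symmetric in [xi] and [y]. *)
Definition cas (t : R) : R := cos t + sin t.

Definition kappa : R := (Num.sqrt (2 * pi))^-1.

Lemma kappa_gt0 : 0 < kappa.
Proof. by rewrite invr_gt0 sqrtr_gt0 mulr_gt0// pi_gt0. Qed.

Lemma normal_peakE (s : R) : 0 < s -> normal_peak s = kappa / s.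
Proof.
move=> s0; rewrite /normal_peak /kappa -mulrnAr -mulr_natl sqrtrM ?sqr_ge0//.
by rewrite sqrtr_sqr gtr0_norm// invfM mulrC.
Qed.

Lemma norm_cas_le t : `|cas t| <= 2.
Proof.
rewrite (le_trans (ler_normD _ _))// (_ : 2 = 1 + 1 :> R)//.
by apply: lerD; rewrite ler_norml ?cos_geN1 ?cos_le1 ?sin_geN1 ?sin_le1.
Qed.

Lemma cas_mul a b : cas a * cas b = cos (a - b) + sin (a + b).
Proof. by rewrite /cas cosB sinD; ring. Qed.

Lemma continuous_cas : continuous cas.
Proof. by move=> x; apply: cvgD; [exact: continuous_cos|exact: continuous_sin]. Qed.

Lemma measurable_cas : measurable_fun setT cas.
Proof. by apply: continuous_measurable_fun; exact: continuous_cas. Qed.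

Lemma measurable_casM xi : measurable_fun setT (fun y : R => cas (xi * y)).
Proof. by apply: (measurableT_comp measurable_cas); exact: measurable_funM. Qed.

Lemma L1_cas f xi : L1 f -> L1 (fun y => f y * cas (xi * y)).
Proof.
move=> f1; apply: L1_le (L1Z 2 (L1_norm f1)).
  by apply: measurable_funM; [exact: L1_measurable|exact: measurable_casM].
by move=> x; rewrite normrM mulrC ler_wpM2r ?norm_cas_le.
Qed.

(** Hartley's transform, as an absolutely convergent integral. *)
Definition hint f (xi : R) : R := kappa * \int[mu]_y (f y * cas (xi * y)).

Lemma measurable_hint f : L1 f -> measurable_fun setT (hint f).
Proof.
move=> f1; apply: measurable_funM => //.
apply: (@measurable_Rintegral_snd _ (fun xi y => f y * cas (xi * y))).
apply: measurable_funM; first exact: (measurableT_comp (L1_measurable f1)).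
by apply: (measurableT_comp measurable_cas); exact: measurable_funM.
Qed.

Lemma norm_hint_le f xi : L1 f -> `|hint f xi| <= kappa * (2 * \int[mu]_y `|f y|).
Proof.
move=> f1; rewrite normrM gtr0_norm ?kappa_gt0// ler_pM2l ?kappa_gt0//.
apply: (le_trans (le_normr_Rintegral _ _)) => //; first exact: L1_cas.
rewrite -RintegralZl//; last exact: L1_norm.
apply: le_Rintegral => //.
- exact/L1_norm/L1_cas.
- exact/L1Z/L1_norm.
- by move=> x _; rewrite normrM mulrC ler_wpM2r ?norm_cas_le.
Qed.

Lemma hintB f g xi : L1 f -> L1 g ->
  hint (fun x => f x - g x) xi = hint f xi - hint g xi.
Proof.
move=> f1 g1; rewrite /hint -mulrBr -RintegralB//; try exact: L1_cas.
by congr (_ * _); apply: eq_Rintegral => x _; rewrite mulrBl.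
Qed.

Lemma L1_mul_hint f g : L1 f -> L1 g -> L1 (fun x => f x * hint g x).
Proof.
move=> f1 g1; apply: L1_le (L1Z (kappa * (2 * \int[mu]_y `|g y|)) (L1_norm f1)).
  by apply: measurable_funM; [exact: L1_measurable|exact: measurable_hint].
by move=> x; rewrite normrM mulrC ler_wpM2r ?norm_hint_le.
Qed.

Lemma Rint_mul_hint f g : L1 f -> L1 g -> \int[mu]_x (f x * hint g x) =
  kappa * \int[mu]_x (f x * \int[mu]_y (g y * cas (x * y))).
Proof.
move=> f1 g1; have E x : f x * \int[mu]_y (g y * cas (x * y)) =
    kappa^-1 * (f x * hint g x) by rewrite mulrCA mulKf// gt_eqF ?kappa_gt0.
rewrite (eq_Rint (fun x => E x)) (RintZ _ (L1_mul_hint f1 g1)).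
by rewrite mulVKf// gt_eqF ?kappa_gt0.
Qed.

(** The kernel is symmetric, so the transform is its own transpose. *)
Lemma hint_transpose f g : L1 f -> L1 g ->
  \int[mu]_x (f x * hint g x) = \int[mu]_x (g x * hint f x).
Proof.
move=> f1 g1.
have mF : measurable_fun setT (fun z : R * R => f z.1 * (g z.2 * cas (z.1 * z.2))).
  apply: measurable_funM; first exact: (measurableT_comp (L1_measurable f1)).
  apply: measurable_funM; first exact: (measurableT_comp (L1_measurable g1)).
  by apply: (measurableT_comp measurable_cas); exact: measurable_funM.
have [] := @RFubini _ (fun x y => f x * (g y * cas (x * y))) mF.
- by move=> x; apply: L1Z; exact: L1_cas.
- move=> y; have := L1Z (g y) (L1_cas y f1).
  under eq_fun do rewrite mulrCA [y * _]mulrC; exact.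
- apply: L1_le (L1Z (2 * \int[mu]_y `|g y|) (L1_norm f1)).
    apply: (@measurable_Rintegral_snd _ (fun x y => `|f x * (g y * cas (x * y))|)).
    exact: measurableT_comp.
  move=> x; rewrite ger0_norm ?Rintegral_ge0// mulrAC -RintegralZl; last 2 first.
    exact: measurableT.
    exact: L1_norm.
  apply: le_Rintegral => //.
  + by apply: L1_norm; apply: L1Z; exact: L1_cas.
  + by apply: L1Z; exact: L1_norm.
  + move=> y _; have -> : 2 * `|f x| * `|g y| = `|f x| * (`|g y| * 2) by ring.
    by rewrite !normrM !ler_wpM2l// norm_cas_le.
move=> _ E.
have L z : \int[mu]_y (f z * (g y * cas (z * y))) = f z * \int[mu]_y (g y * cas (z * y)).
  exact: RintZ (L1_cas z g1).
have M z : \int[mu]_x (f x * (g z * cas (x * z))) = g z * \int[mu]_x (f x * cas (z * x)).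
  rewrite -(RintZ _ (L1_cas z f1)).
  by apply: eq_Rintegral => x _; rewrite mulrCA [x * z]mulrC.
rewrite (Rint_mul_hint f1 g1) (Rint_mul_hint g1 f1); congr (_ * _).
rewrite (eq_Rint (fun x => esym (L x))) E.
exact: eq_Rint (fun x => M x).
Qed.

(** The Gaussian weight that regularises the inversion integrals. *)
Definition gw (s xi : R) : R := expR (- (s ^+ 2 * xi ^+ 2 / 2)).

Lemma gw_ge0 s xi : 0 <= gw s xi.
Proof. exact: expR_ge0. Qed.

Lemma gw_le1 s xi : gw s xi <= 1.
Proof. by rewrite -expR0 ler_expR oppr_le0 divr_ge0// mulr_ge0// sqr_ge0. Qed.

Lemma measurable_gw s : measurable_fun setT (gw s).
Proof.
apply: (measurableT_comp (continuous_measurable_fun (@continuous_expR R))); apply: measurableT_comp => //.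
by apply: measurable_funM => //; apply: measurable_funM => //; exact: measurable_funX.
Qed.

Lemma gwE s xi : 0 < s -> gw s xi = s^-1 / kappa * normal_pdf 0 s^-1 xi.
Proof.
move=> s0; have k0 := kappa_gt0.
rewrite gaussE ?invr_gt0// normal_peakE ?invr_gt0// (_ : kappa / s^-1 = kappa * s); last by rewrite invrK.
rewrite [RHS]mulrA (_ : s^-1 / kappa * (kappa * s) = 1); last first.
  by field; rewrite !gt_eqF.
by rewrite mul1r /gw; congr expR; field; rewrite gt_eqF.
Qed.

Lemma L1_gw s : 0 < s -> L1 (gw s).
Proof.
move=> s0; rewrite (_ : gw s = fun xi => s^-1 / kappa * normal_pdf 0 s^-1 xi).
  by apply: L1Z; exact: integrable_normal_pdf.
by apply/funext => xi; exact: gwE.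
Qed.

Lemma hint_gauss m s xi : 0 < s ->
  hint (normal_pdf m s) xi = kappa * (gw s xi * cas (xi * m)).
Proof.
move=> s0; congr (_ * _).
have iN : L1 (normal_pdf m s) by exact: integrable_normal_pdf.
have ic theta : L1 (fun x => normal_pdf m s x * cos (xi * x - theta)).
  apply: L1_le iN.
    apply: measurable_funM; first exact: measurable_normal_pdf.
    apply: (measurableT_comp (continuous_measurable_fun (@continuous_cos R))).
    by apply: measurable_funB => //; exact: measurable_funM.
  move=> x; rewrite normrM ger0_norm ?normal_pdf_ge0// ler_piMr ?normal_pdf_ge0//.
  by rewrite ler_norml cos_geN1 cos_le1.
have E x : normal_pdf m s x * cas (xi * x) = normal_pdf m s x * cos (xi * x - 0) +
    normal_pdf m s x * cos (xi * x - pi / 2).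
  by rewrite subr0 cosBpihalf -mulrDr.
under eq_Rintegral do rewrite E.
by rewrite RintegralD// !gauss_cos// subr0 cosBpihalf -mulrDr.
Qed.

Lemma L1_gw_cas s m : 0 < s -> L1 (fun xi => gw s xi * cas (m * xi)).
Proof. by move=> s0; apply: L1_cas; exact: L1_gw. Qed.

(** With [hint_gauss], this is Fourier inversion for Gaussians: multiplying the
    kernel by the weight [gw s] and integrating gives a Gaussian of width [s]. *)
Lemma hint_gw_cas m s y : 0 < s ->
  hint (fun xi => gw s xi * cas (m * xi)) y = kappa^-1 * normal_pdf m s y.
Proof.
move=> s0; have k0 := kappa_gt0; have t0 : 0 < s^-1 by rewrite invr_gt0.
have iN : L1 (normal_pdf 0 s^-1) by exact: integrable_normal_pdf.
have ic z theta : L1 (fun x => normal_pdf 0 s^-1 x * cos (z * x - theta)).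
  apply: L1_le iN.
    apply: measurable_funM; first exact: measurable_normal_pdf.
    apply: (measurableT_comp (continuous_measurable_fun (@continuous_cos R))).
    by apply: measurable_funB => //; exact: measurable_funM.
  move=> x; rewrite normrM ger0_norm ?normal_pdf_ge0// ler_piMr ?normal_pdf_ge0//.
  by rewrite ler_norml cos_geN1 cos_le1.
have E xi : gw s xi * cas (m * xi) * cas (y * xi) = s^-1 / kappa *
    (normal_pdf 0 s^-1 xi * cos ((m - y) * xi - 0) +
     normal_pdf 0 s^-1 xi * cos ((m + y) * xi - pi / 2)).
  by rewrite -mulrA cas_mul -mulrBl -mulrDl gwE// subr0 cosBpihalf -mulrDr mulrA.
rewrite /hint; under eq_Rintegral do rewrite E.
rewrite RintegralZl//; last exact: L1D.
rewrite RintegralD// !gauss_cos// !mulr0 subr0 sub0r cosN cos_pihalf mulr0 addr0 cos0 mulr1.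
rewrite gaussE// normal_peakE//.
rewrite (_ : - (y - m) ^+ 2 / (s ^+ 2 *+ 2) = - (s^-1 ^+ 2 * (m - y) ^+ 2 / 2)).
  by field; rewrite !gt_eqF.
by field; rewrite gt_eqF.
Qed.

Lemma Rintegral_gaussZ (c m s : R) : \int[mu]_x (c * normal_pdf m s x) = c.
Proof.
rewrite (RintegralZl _ measurableT (integrable_normal_pdf m s)).
by rewrite /Rintegral integral_normal_pdf mulr1.
Qed.

Lemma gauss_sym (m s x : R) : 0 < s -> normal_pdf m s x = normal_pdf x s m.
Proof. by move=> s0; rewrite !gaussE// -[x - m]opprB sqrrN. Qed.

Lemma L1_mul_gauss f m s : 0 < s -> L1 f -> L1 (fun y => f y * normal_pdf m s y).
Proof.
move=> s0 f1; apply: L1_le (L1Z (normal_peak s) (L1_norm f1)).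
  by apply: measurable_funM; [exact: L1_measurable|exact: measurable_normal_pdf].
move=> x; rewrite normrM mulrC ler_wpM2r// ger0_norm ?normal_pdf_ge0//.
by apply: normal_pdf_ub; rewrite gt_eqF.
Qed.

(** Moving one transform across by [hint_transpose] twice leaves the transform of
    the weighted kernel, which is a Gaussian average of [f]. *)
Lemma hint_regularized f g s : 0 < s -> L1 f -> L1 g ->
  \int[mu]_xi (gw s xi * (hint f xi * hint g xi)) =
  \int[mu]_x (g x * \int[mu]_y (f y * normal_pdf x s y)).
Proof.
move=> s0 f1 g1; have h1 := L1_mul_hint (L1_gw s0) f1.
transitivity (\int[mu]_xi (gw s xi * hint f xi * hint g xi)).
  by apply: eq_Rintegral => xi _; rewrite mulrA.
rewrite hint_transpose//; apply: eq_Rintegral => x _; congr (_ * _).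
rewrite {1}/hint -[RHS]mul1r -(mulVf (x := kappa)) ?gt_eqF ?kappa_gt0//.
rewrite [_^-1 * _]mulrC -mulrA -[in RHS]RintegralZl//; last exact: L1_mul_gauss.
congr (_ * _).
transitivity (\int[mu]_y ((gw s y * cas (x * y)) * hint f y)).
  by apply: eq_Rintegral => y _; rewrite mulrAC.
rewrite hint_transpose//; last exact: L1_gw_cas.
by apply: eq_Rintegral => y _; rewrite hint_gw_cas// mulrCA.
Qed.

Lemma measurable_gauss2 s : 0 < s ->
  measurable_fun setT (fun z : R * R => normal_pdf z.2 s z.1).
Proof.
move=> s0; rewrite (_ : (fun z => _) = (fun z : R * R =>
  normal_peak s * expR (- (z.1 - z.2) ^+ 2 / (s ^+ 2 *+ 2)))); last first.
  by apply/funext => z; rewrite gaussE.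
apply: measurable_funM => //.
apply: (measurableT_comp (continuous_measurable_fun (@continuous_expR R))).
apply: measurable_funM => //; apply: measurableT_comp => //.
by apply: measurable_funX; exact: measurable_funB.
Qed.

Lemma measurable_average f s : 0 < s -> L1 f ->
  measurable_fun setT (fun x => \int[mu]_y (f y * normal_pdf x s y)).
Proof.
move=> s0 f1; apply: (@measurable_Rintegral_snd _ (fun x y => f y * normal_pdf x s y)).
apply: measurable_funM; first exact: (measurableT_comp (L1_measurable f1) measurable_snd).
exact: (measurableT_comp (measurable_gauss2 s0)
  (measurable_fun_pair measurable_snd measurable_fst)).
Qed.

Lemma norm_average_le f s x : 0 < s -> L1 f ->
  `|\int[mu]_y (f y * normal_pdf x s y)| <= normal_peak s * \int[mu]_y `|f y|.
Proof.
move=> s0 f1; have i1 := L1_mul_gauss x s0 f1.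
apply: (le_trans (Rint_norm_le i1)); rewrite -(RintZ _ (L1_norm f1)).
apply: (Rint_le (L1_norm i1) (L1Z _ (L1_norm f1))) => y.
rewrite normrM mulrC ler_wpM2r// ger0_norm ?normal_pdf_ge0//.
by apply: normal_pdf_ub; rewrite gt_eqF.
Qed.

Lemma L1_mul_average f s : 0 < s -> L1 f ->
  L1 (fun x => f x * \int[mu]_y (f y * normal_pdf x s y)).
Proof.
move=> s0 f1; apply: L1_le (L1Z (normal_peak s * \int[mu]_y `|f y|) (L1_norm f1)).
  by apply: measurable_funM; [exact: L1_measurable|exact: measurable_average].
by move=> x; rewrite normrM mulrC ler_wpM2r// norm_average_le.
Qed.

(** The weighted form integrates against a probability density. *)
Lemma amgm (a b w : R) : 0 <= w ->
  a * (b * w) <= 2^-1 * (a ^+ 2 * w + b ^+ 2 * w).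
Proof.
move=> w0; rewrite mulrA -mulrDl mulrA ler_wpM2r//.
by have := sqr_ge0 (a - b); lra.
Qed.

(** Averaging against a symmetric probability kernel is a contraction of L^2:
    apply [amgm] under the double integral. *)
Lemma gauss_average_le f s : 0 < s -> L1 f -> L2 f ->
  \int[mu]_x (f x * \int[mu]_y (f y * normal_pdf x s y)) <= sqn f.
Proof.
move=> s0 f1 f2; have q1 := L2_sqr f2.
have mN := measurable_gauss2 s0.
have [] := @RFubini _ (fun y x => f y ^+ 2 * normal_pdf x s y).
- apply: measurable_funM => //.
  exact: (measurableT_comp (L1_measurable q1) measurable_fst).
- move=> y; apply: L1Z; rewrite (_ : (fun x => _) = normal_pdf y s).
    exact: integrable_normal_pdf.
  by apply/funext => x; rewrite gauss_sym.
- by move=> x; exact: (L1_mul_gauss _ _ q1).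
- apply: (L1_le _ _ q1).
    apply: (@measurable_Rintegral_snd _ (fun y x => `|f y ^+ 2 * normal_pdf x s y|)).
    apply: measurableT_comp => //; apply: measurable_funM => //.
    exact: (measurableT_comp (L1_measurable q1) measurable_fst).
  move=> y; rewrite ger0_norm ?Rintegral_ge0//.
  under eq_Rintegral do rewrite normrM (ger0_norm (sqr_ge0 _))
    (ger0_norm (normal_pdf_ge0 _ _ _)) gauss_sym//.
  by rewrite Rintegral_gaussZ.
move=> A1 A2.
have E y : \int[mu]_x (f y ^+ 2 * normal_pdf x s y) = f y ^+ 2.
  rewrite (_ : \int[mu]_x _ = \int[mu]_x (f y ^+ 2 * normal_pdf y s x)); last first.
    by apply: eq_Rintegral => x _; rewrite (gauss_sym x y s0).
  by rewrite Rintegral_gaussZ.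
have B1 : L1 (fun x => 2^-1 * (f x ^+ 2 + \int[mu]_y (f y ^+ 2 * normal_pdf x s y))).
  by apply: L1Z; exact: L1D.
have C x : f x * \int[mu]_y (f y * normal_pdf x s y) <=
    2^-1 * (f x ^+ 2 + \int[mu]_y (f y ^+ 2 * normal_pdf x s y)).
  have -> : f x ^+ 2 = \int[mu]_y (f x ^+ 2 * normal_pdf x s y).
    by rewrite Rintegral_gaussZ.
  have i1 : L1 (fun y => f x ^+ 2 * normal_pdf x s y).
    by apply: L1Z; exact: integrable_normal_pdf.
  have i2 : L1 (fun y => f y ^+ 2 * normal_pdf x s y) by exact: L1_mul_gauss.
  have i3 : L1 (fun y => f y * normal_pdf x s y) by exact: L1_mul_gauss.
  rewrite -(RintD i1 i2) -(RintZ _ i3) -(RintZ _ (L1D i1 i2)).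
  apply: Rint_le; [exact: L1Z|by apply: L1Z; exact: L1D|].
  by move=> y; exact: amgm (normal_pdf_ge0 _ _ _).
have D1 := L1_mul_average s0 f1.
apply: (@le_trans _ _ (\int[mu]_x (2^-1 * (f x ^+ 2 +
    \int[mu]_y (f y ^+ 2 * normal_pdf x s y))))); first exact: Rint_le D1 B1 C.
rewrite (RintZ _ (L1D q1 A1)) (RintD q1 A1) -A2; under [X in _ * (_ + X)]eq_Rintegral do rewrite E.
by rewrite /sqn; move: (Rintegral _ _ _) => q; clear; lra.
Qed.

Lemma cvg_gw xi : gw n.+1%:R^-1 xi @[n --> \oo] --> (1 : R).
Proof.
have h : n.+1%:R^-1 @[n --> \oo] --> (0 : R) by exact: cvg_harmonic.
have : - (n.+1%:R^-1 * n.+1%:R^-1 * (xi ^+ 2 / 2)) @[n --> \oo] -->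
    - (0 * 0 * (xi ^+ 2 / 2)).
  by apply: cvgN; apply: cvgM; [exact: cvgM|exact: cvg_cst].
rewrite !mul0r oppr0; under eq_cvg do rewrite mulrA -expr2.
by move=> /(continuous_cvg _ (@continuous_expR R 0)); rewrite expR0.
Qed.

(** By [hint_regularized] and [gauss_average_le] the regularised norms are
    bounded, and Fatou's lemma removes the weight. *)
Lemma hint_bessel f : L1 f -> L2 f -> L2 (hint f) /\ sqn (hint f) <= sqn f.
Proof.
move=> f1 f2.
(* The width whose weight is the square root of the one of width n.+1^-1. *)
pose t n : R := (Num.sqrt 2)^-1 * n.+1%:R^-1.
have n0 n : 0 < n.+1%:R^-1 :> R by rewrite invr_gt0.
have tE n xi : gw (t n) xi ^+ 2 = gw n.+1%:R^-1 xi.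
  rewrite /gw -expRM_natl; congr expR; rewrite /t exprMn exprVn sqr_sqrtr//.
  by field; rewrite addrC natr1 pnatr_eq0.
have E n : sqn (fun xi => gw (t n) xi * hint f xi) =
    \int[mu]_xi (gw n.+1%:R^-1 xi * (hint f xi * hint f xi)).
  by apply: eq_Rintegral => xi _; rewrite exprMn tE expr2.
have mh := measurable_hint f1.
apply: (@sqn_fatou _ (fun n xi => gw (t n) xi * hint f xi)) => //.
- move=> n; apply/L2P; split; first by apply: measurable_funM => //; exact: measurable_gw.
  have := L1_mul_hint (L1_mul_hint (L1_gw (n0 n)) f1) f1.
  by under eq_fun do rewrite -mulrA -expr2 -tE -exprMn; exact.
- apply: aeW => xi; rewrite -[hint f xi in X in _ --> X]mul1r.
  apply: cvgM; last exact: cvg_cst.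
  have : Num.sqrt (gw n.+1%:R^-1 xi) @[n --> \oo] --> Num.sqrt 1.
    by apply: (continuous_cvg _ (@sqrt_continuous R 1)); exact: cvg_gw.
  rewrite sqrtr1; under eq_cvg do rewrite -tE sqrtr_sqr ger0_norm ?gw_ge0//.
  exact.
- by apply: nearW => n; rewrite E hint_regularized//; exact: gauss_average_le.
Qed.

Definition itvf (a b : R) : R -> R := \1_`[a, b].

Lemma itvfE a b x : itvf a b x = if (a <= x <= b) then 1 else 0.
Proof.
rewrite /itvf indicE; case: ifPn => h; first by rewrite mem_set//= in_itv.
by rewrite memNset//= in_itv/=; exact/negP.
Qed.

Lemma itvf_norm_le1 a b x : `|itvf a b x| <= 1.
Proof. by rewrite itvfE; case: ifP; rewrite ?normr1 ?normr0. Qed.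

Lemma L1_itvf a b : L1 (itvf a b).
Proof. exact: integrable_indic_itv. Qed.

Lemma L2_itvf a b : L2 (itvf a b).
Proof.
apply/L2P; split; first exact: L1_measurable (L1_itvf a b).
rewrite (_ : (fun x => _) = itvf a b); first exact: L1_itvf.
by apply/funext => x; rewrite itvfE; case: ifP => _; rewrite ?expr1n ?expr0n.
Qed.

(** At a point at distance [d] from the endpoints, a value [y] at which the
    indicator differs is at distance at least [d]: a Markov-type bound by the
    first absolute moment of the Gaussian. *)
Lemma cvg_gauss_itvf a b x : x != a -> x != b ->
  \int[mu]_y (itvf a b y * normal_pdf x n.+1%:R^-1 y) @[n --> \oo] --> itvf a b x.
Proof.
move=> xa xb; pose d := Num.min `|x - a| `|x - b|.
have d0 : 0 < d by rewrite lt_min !normr_gt0 !subr_eq0 xa.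
have key y : `|itvf a b y - itvf a b x| <= d^-1 * `|y - x|.
  have [yd|dy] := ltP `|y - x| d.
    suff -> : itvf a b y = itvf a b x by rewrite subrr normr0 mulr_ge0// invr_ge0 ltW.
    have side c : `|y - x| < `|x - c| -> (c <= y) = (c <= x).
      have [cx|xc] := leP c x.
        by rewrite [`|x - c|]ger0_norm ?subr_ge0// ltr_norml => /andP[h _]; apply/idP; lra.
      by rewrite [`|x - c|]ltr0_norm ?subr_lt0// ltr_norml => /andP[_ h]; apply/negP; lra.
    have side' c : `|y - x| < `|x - c| -> (y <= c) = (x <= c).
      have [xc|cx] := leP x c.
        by rewrite [`|x - c|]ler0_norm ?subr_le0// ltr_norml => /andP[_ h]; apply/idP; lra.
      by rewrite [`|x - c|]gtr0_norm ?subr_gt0// ltr_norml => /andP[h _]; apply/negP; lra.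
    by move: yd; rewrite lt_min => /andP[/side ya /side' yb]; rewrite !itvfE ya yb.
  rewrite -ler_pdivrMl ?invr_gt0// invrK.
  apply: le_trans dy; rewrite ler_piMr ?(ltW d0)// !itvfE.
  by case: ifP; case: ifP; rewrite ?subrr ?subr0 ?sub0r ?normrN ?normr0 ?normr1.
apply/cvgrPdist_le => e e0; near=> n.
have n0 : 0 < n.+1%:R^-1 :> R by rewrite invr_gt0.
have sn : n.+1%:R^-1 <= (d^-1 * 2)^-1 * e.
  rewrite -[leLHS]ger0_norm ?(ltW n0)// -normrN -sub0r; near: n.
  have /cvgrPdist_le := @cvg_harmonic R; apply.
  by rewrite !mulr_gt0 ?invr_gt0 ?mulr_gt0 ?invr_gt0.
set s := n.+1%:R^-1 in n0 sn *.
have iN : L1 (normal_pdf x s) by exact: integrable_normal_pdf.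
have -> : itvf a b x = \int[mu]_y (itvf a b x * normal_pdf x s y).
  by rewrite Rintegral_gaussZ.
have i1 := L1_mul_gauss x n0 (L1_itvf a b).
rewrite distrC -RintegralB//; last exact: L1Z.
apply: (le_trans (le_normr_Rintegral _ _)) => //; first by apply: L1B => //; exact: L1Z.
have i2 : L1 (fun y => d^-1 * (2 * s) * normal_pdf x (2 * s) y).
  by apply: L1Z; exact: integrable_normal_pdf.
apply: (@le_trans _ _ (\int[mu]_y (d^-1 * (2 * s) * normal_pdf x (2 * s) y))).
  apply: le_Rintegral => //.
    by apply: L1_norm; apply: L1B => //; exact: L1Z.
  move=> y _; rewrite -mulrBl normrM [`|normal_pdf _ _ _|]ger0_norm ?normal_pdf_ge0//.
  apply: (@le_trans _ _ (d^-1 * (normal_pdf x s y * `|y - x|))).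
    by rewrite mulrCA mulrC ler_wpM2l ?normal_pdf_ge0.
  rewrite -mulrA ler_wpM2l ?invr_ge0 ?(ltW d0)//.
  apply: (le_trans (gauss_tail x n0 y)); rewrite !normal_peakE ?mulr_gt0//.
  rewrite le_eqVlt; apply/orP; left; apply/eqP; congr (_ * _).
  by field; rewrite !gt_eqF ?kappa_gt0.
by rewrite Rintegral_gaussZ mulrA -ler_pdivlMl ?mulr_gt0 ?invr_gt0.
Unshelve. all: end_near. Qed.

(** In [hint_regularized] the averages of an indicator converge to it off the
    two endpoints, so that the isometry needs no continuity of the function. *)
Lemma hint_itvf a b a' b' :
  \int[mu]_x (hint (itvf a b) x * hint (itvf a' b') x) =
  \int[mu]_x (itvf a b x * itvf a' b' x).
Proof.
have f1 := L1_itvf a b; have g1 := L1_itvf a' b'.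
have [F2 _] := hint_bessel f1 (L2_itvf a b).
have [G2 _] := hint_bessel g1 (L2_itvf a' b').
have n0 n : 0 < n.+1%:R^-1 :> R by rewrite invr_gt0.
have FG := L2_mul F2 G2.
have A : \int[mu]_xi (gw n.+1%:R^-1 xi * (hint (itvf a b) xi * hint (itvf a' b') xi))
    @[n --> \oo] --> \int[mu]_xi (hint (itvf a b) xi * hint (itvf a' b') xi).
  apply: (Rdominated_cvg _ _ _ (L1_norm FG) _).2.
  - by move=> n; apply: measurable_funM; [exact: measurable_gw|exact: L1_measurable FG].
  - exact: L1_measurable FG.
  - apply: aeW => xi; rewrite -[X in _ --> X]mul1r.
    by apply: cvgM; [exact: cvg_gw|exact: cvg_cst].
  - by move=> n x; rewrite normrM ger0_norm ?gw_ge0// ler_piMl ?gw_le1.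
have B : \int[mu]_x (itvf a' b' x * \int[mu]_y (itvf a b y * normal_pdf x n.+1%:R^-1 y))
    @[n --> \oo] --> \int[mu]_x (itvf a' b' x * itvf a b x).
  apply: (Rdominated_cvg _ _ _ (L1_norm g1) _).2.
  - move=> n; apply: measurable_funM; first exact: L1_measurable g1.
    exact: measurable_average.
  - by apply: measurable_funM; [exact: L1_measurable g1|exact: L1_measurable f1].
  - have Na c : \forall x \ae (@lebesgue_measure R), x != c.
      exists [set c]; split => //; first exact: lebesgue_measure_set1.
      by move=> x /= /negP; rewrite negbK => /eqP.
    apply: aeS (aeI (Na a) (Na b)) => x [xa xb].
    by apply: cvgM; [exact: cvg_cst|exact: cvg_gauss_itvf].
  - move=> n x; rewrite normrM ler_piMr//.
    apply: (le_trans (Rint_norm_le _)); first exact: L1_mul_gauss.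
    apply: (@le_trans _ _ (\int[mu]_y normal_pdf x n.+1%:R^-1 y)); last first.
      by rewrite /Rintegral integral_normal_pdf.
    apply: le_Rintegral => //.
    + by apply: L1_norm; exact: L1_mul_gauss.
    + exact: integrable_normal_pdf.
    + move=> y _; rewrite normrM [`|normal_pdf _ _ _|]ger0_norm ?normal_pdf_ge0//.
      by rewrite ler_piMl ?normal_pdf_ge0 ?itvf_norm_le1.
move: A; under eq_cvg do rewrite hint_regularized//.
move=> /(cvg_unique _) /(_ B) ->//; by apply: eq_Rintegral => x _; rewrite mulrC.
Qed.

End HartleyIntegral.

(** * The Hartley transform on L^2 *)
Section HartleyL2.
Context {R : realType}.
Implicit Types f g h u v : R -> R.

Lemma L2_trunc n f : L2 f -> L2 (trunc n f).
Proof.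
move=> /L2P[mf f2]; apply/L2P; split; first exact: measurable_trunc.
apply: L1_le f2; first by apply: measurable_funX; exact: measurable_trunc.
move=> x; rewrite ger0_norm ?sqr_ge0// truncE; case: ifP => // _.
by rewrite expr0n sqr_ge0.
Qed.

Lemma L1_truncL2 n f : L2 f -> L1 (trunc n f).
Proof.
move=> f2; apply: L1_le (L1D (L1_itvf (- n%:R) n%:R) (L2_sqr f2)).
  by apply: measurable_trunc; exact: L2_measurable.
move=> x; rewrite truncE itvfE -ler_norml; case: ifP => _.
  rewrite -[f x ^+ 2]real_normK ?num_real//.
  by have := sqr_ge0 (`|f x| - 1); have := normr_ge0 (f x); nra.
by rewrite normr0 add0r sqr_ge0.
Qed.

Lemma cvg_sqn_trunc f : L2 f -> sqn (fun x => trunc n f x - f x) @[n --> \oo] --> 0.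
Proof.
move=> f2; have mf := L2_measurable f2.
have <- : \int[mu]_x (0 : R) = 0 :> R by rewrite Rintegral_cst// mul0r.
apply: (Rdominated_cvg _ _ _ (L2_sqr f2) _).2.
- by move=> n; apply: measurable_funX; apply: measurable_funB => //; exact: measurable_trunc.
- exact: measurable_cst.
- apply: aeW => x; have : (trunc n f x - f x) ^+ 2 @[n --> \oo] --> (f x - f x) ^+ 2.
    rewrite expr2; under eq_cvg do rewrite expr2.
    by apply: cvgM; apply: cvgB; try exact: cvg_trunc; exact: cvg_cst.
  by rewrite subrr expr0n.
- move=> n x; rewrite ger0_norm ?sqr_ge0// truncE; case: ifP => _.
    by rewrite subrr expr0n sqr_ge0.
  by rewrite sub0r sqrrN.
Qed.

(** The transform on L^2 as a relation: it is determined almost everywhere only,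
    and any representative is allowed. *)
Definition is_hartley f u : Prop :=
  L2 u /\ sqn (fun x => hint (trunc n f) x - u x) @[n --> \oo] --> 0.

Lemma L2_hint_trunc n f : L2 f -> L2 (hint (trunc n f)).
Proof. by move=> f2; case: (hint_bessel (L1_truncL2 n f2) (L2_trunc n f2)). Qed.

Lemma sqn_triangle f g h : L2 f -> L2 g -> L2 h ->
  sqn (fun x => f x - h x) <= 2 * (sqn (fun x => f x - g x) + sqn (fun x => g x - h x)).
Proof.
move=> f2 g2 h2; have := sqnD_le (L2B f2 g2) (L2B g2 h2).
by under [X in sqn X <= _]eq_fun do rewrite addrA subrK.
Qed.

(** Bessel's inequality makes the transforms of the truncations Cauchy. *)
Lemma is_hartley_exists f : L2 f -> exists u, is_hartley f u.
Proof.
move=> f2; have [|e e0|u u2 c] := @L2_complete _ (fun n => hint (trunc n f)).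
- by move=> n; exact: L2_hint_trunc.
- have /cvgrPdist_le/(_ (e / 4)) := cvg_sqn_trunc f2.
  rewrite divr_gt0// => /(_ isT)[N _ NP]; exists N => m n Nm Nn.
  have E x : hint (trunc m f) x - hint (trunc n f) x =
      hint (fun y => trunc m f y - trunc n f y) x.
    by rewrite hintB//; exact: L1_truncL2.
  under [X in sqn X]eq_fun do rewrite E.
  have d1 : L1 (fun y => trunc m f y - trunc n f y) by apply: L1B; exact: L1_truncL2.
  have d2 : L2 (fun y => trunc m f y - trunc n f y) by apply: L2B; exact: L2_trunc.
  apply: (le_trans (hint_bessel d1 d2).2).
  apply: (le_trans (sqn_triangle (L2_trunc m f2) f2 (L2_trunc n f2))).
  have := NP m Nm; have := NP n Nn; rewrite /= !sub0r !normrN !ger0_norm ?sqn_ge0//.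
  rewrite [sqn (fun x => f x - _)]sqnBC; lra.
- by exists u.
Qed.

Lemma cvg0_eq0 (x : R) (a : nat -> R) : 0 <= x -> (forall n, x <= a n) ->
  a n @[n --> \oo] --> 0 -> x = 0.
Proof.
move=> x0 xa a0; apply/eqP; rewrite eq_le x0 andbT.
have := cvg_lim (@Rhausdorff R) a0 => <-; apply: limr_ge; first by apply/cvg_ex; exists 0.
exact: nearW.
Qed.

Lemma sqnB_eq0 u v : L2 u -> L2 v -> sqn (fun x => u x - v x) = 0 -> u = v %[ae mu].
Proof.
move=> u2 v2 uv; have /ae_eqE H := sqn_eq0 (L2B u2 v2) uv.
by apply/ae_eqE; apply: aeS H => x /= /subr0_eq.
Qed.

Lemma L2_cvg_uniq (w : nat -> R -> R) u v : (forall n, L2 (w n)) -> L2 u -> L2 v ->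
  sqn (fun x => w n x - u x) @[n --> \oo] --> 0 ->
  sqn (fun x => w n x - v x) @[n --> \oo] --> 0 -> u = v %[ae mu].
Proof.
move=> w2 u2 v2 wu wv; apply: sqnB_eq0 => //.
apply: (@cvg0_eq0 _ (fun n => 2 * (sqn (fun x => w n x - u x) +
  sqn (fun x => w n x - v x)))); first exact: sqn_ge0.
  by move=> n; rewrite [sqn (fun x => _ - u x)]sqnBC; exact: sqn_triangle.
have : 2 * (sqn (fun x => w n x - u x) +
  sqn (fun x => w n x - v x)) @[n --> \oo] --> 2 * (0 + 0 : R).
  by apply: cvgM; [exact: cvg_cst|exact: cvgD].
by rewrite addr0 mulr0.
Qed.

Lemma is_hartley_uniq f u v : L2 f -> is_hartley f u -> is_hartley f v ->
  u = v %[ae mu].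
Proof.
move=> f2 [u2 fu] [v2 fv].
exact: L2_cvg_uniq (fun n => L2_hint_trunc n f2) u2 v2 fu fv.
Qed.

Lemma sqn_ae u v : measurable_fun setT u -> measurable_fun setT v ->
  u = v %[ae mu] -> sqn u = sqn v.
Proof.
move=> mu' mv /ae_eqE uv; apply: ae_eq_Rintegral; try exact: measurable_funX.
by apply/ae_eqE; apply: aeS uv => x ->.
Qed.

Lemma is_hartley_aer f u v : L2 f -> measurable_fun setT v -> u = v %[ae mu] ->
  is_hartley f u -> is_hartley f v.
Proof.
move=> f2 mv uv [u2 fu]; have v2 := L2_ae mv uv u2; split => //.
rewrite (_ : (fun n => _) = fun n => sqn (fun x => hint (trunc n f) x - u x))//.
apply/funext => n; apply: sqn_ae.
- by apply: measurable_funB => //; exact: L2_measurable (L2_hint_trunc n f2).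
- apply: measurable_funB; last exact: L2_measurable.
  exact: L2_measurable (L2_hint_trunc n f2).
- by move/ae_eqE : uv => uv; apply/ae_eqE; apply: aeS uv => x ->.
Qed.

Lemma is_hartley_ael f g u : L2 f -> L2 g -> f = g %[ae mu] ->
  is_hartley f u -> is_hartley g u.
Proof.
move=> f2 g2 /ae_eqE fg [u2 fu]; split; first exact: u2.
rewrite (_ : (fun n => _) = fun n => sqn (fun x => hint (trunc n f) x - u x)); first exact: fu.
apply/funext => n; congr sqn; apply/funext => x; congr (_ * _ - _).
apply: ae_eq_Rintegral.
- exact: L1_measurable (L1_cas x (L1_truncL2 n g2)).
- exact: L1_measurable (L1_cas x (L1_truncL2 n f2)).
- by apply/ae_eqE; apply: aeS fg => y fgy; rewrite !truncE fgy.
Qed.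

Lemma is_hartleyB f g u v : L2 f -> L2 g -> is_hartley f u -> is_hartley g v ->
  is_hartley (fun x => f x - g x) (fun x => u x - v x).
Proof.
move=> f2 g2 [u2 fu] [v2 gv]; split; first exact: L2B.
apply: (@squeeze_cvgr _ _ _ _ (cst 0) (fun n => 2 * (sqn (fun x => hint (trunc n f) x - u x) +
  sqn (fun x => hint (trunc n g) x - v x)))).
- apply: nearW => n; rewrite sqn_ge0/=.
  have := sqnD_le (L2B (L2_hint_trunc n f2) u2) (L2Z (-1) (L2B (L2_hint_trunc n g2) v2)).
  rewrite sqnZ ?sqrrN ?expr1n ?mul1r; last exact: L2B (L2_hint_trunc n g2) v2.
  apply: le_trans; rewrite le_eqVlt; apply/orP; left; apply/eqP; congr sqn.
  apply/funext => x; rewrite mulN1r.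
  rewrite (_ : trunc n _ = fun y => trunc n f y - trunc n g y); last first.
    by apply/funext => y; rewrite !truncE; case: ifP => // _; rewrite subrr.
  by rewrite hintB; [ring|exact: L1_truncL2..].
- exact: cvg_cst.
- have : 2 * (sqn (fun x => hint (trunc n f) x - u x) +
    sqn (fun x => hint (trunc n g) x - v x)) @[n --> \oo] --> 2 * (0 + 0 : R).
    by apply: cvgM; [exact: cvg_cst|exact: cvgD].
  by rewrite addr0 mulr0.
Qed.

(** [hint_transpose] for two truncations, then one limit after the other. *)
Lemma is_hartley_sym f g u v : L2 f -> L2 g -> is_hartley f u -> is_hartley g v ->
  ip u g = ip f v.
Proof.
move=> f2 g2 [u2 fu] [v2 gv].
have E m n : ip (hint (trunc n f)) (trunc m g) = ip (trunc n f) (hint (trunc m g)).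
  rewrite ipC /ip; apply: hint_transpose; exact: L1_truncL2.
have F m : ip u (trunc m g) = ip f (hint (trunc m g)).
  have c1 := cvg_ip (fun n => L2_hint_trunc n f2) u2 (L2_trunc m g2) fu.
  have c2 := cvg_ip (fun n => L2_trunc n f2) f2 (L2_hint_trunc m g2) (cvg_sqn_trunc f2).
  move: c1; under eq_cvg do rewrite E; move=> c1.
  exact: (cvg_unique (@Rhausdorff R) c1 c2).
have c1 := cvg_ip (fun n => L2_trunc n g2) g2 u2 (cvg_sqn_trunc g2).
have c2 := cvg_ip (fun n => L2_hint_trunc n g2) v2 f2 gv.
move: c1; under eq_cvg do rewrite ipC F ipC; move=> c1.
by rewrite ipC (cvg_unique (@Rhausdorff R) c1 c2) ipC.
Qed.

Lemma is_hartley_hint f : L1 f -> L2 f -> is_hartley f (hint f).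
Proof.
move=> f1 f2; split; first by case: (hint_bessel f1 f2).
apply: (@squeeze_cvgr _ _ _ _ (cst 0) (fun n => sqn (fun x => trunc n f x - f x))).
- apply: nearW => n; rewrite sqn_ge0/=.
  have d1 := L1B (L1_truncL2 n f2) f1; have d2 := L2B (L2_trunc n f2) f2.
  have [_] := hint_bessel d1 d2; apply: le_trans; rewrite le_eqVlt; apply/orP; left.
  apply/eqP; congr sqn; apply/funext => x; rewrite hintB//; exact: L1_truncL2.
- exact: cvg_cst.
- exact: cvg_sqn_trunc.
Qed.

Lemma ip_itvf f a b : ip f (itvf a b) = \int[mu]_(x in `[a, b]) f x.
Proof.
rewrite Rintegral_mkcond; apply: eq_Rint => x; rewrite patchE itvfE.
case: ifPn => h; first by rewrite mem_set/= ?in_itv// mulr1.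
by rewrite memNset ?mulr0//= in_itv/=; exact/negP.
Qed.

Lemma L2_eq_itvf f g : L2 f -> L2 g ->
  (forall a b, ip f (itvf a b) = ip g (itvf a b)) -> f = g %[ae mu].
Proof.
move=> f2 g2 fg.
have /ae_eqE H : (fun x => f x - g x) = cst 0 %[ae mu].
  apply: (L2_itv_eq0 (L2B f2 g2)) => a b _.
  by rewrite -ip_itvf (ipBl f2 g2 (L2_itvf a b)) fg subrr.
by apply/ae_eqE; apply: aeS H => x /= /subr0_eq.
Qed.

(** It suffices to test the double transform against indicators of intervals;
    symmetry moves it onto them, and on pairs of such indicators the transform
    is isometric by [hint_itvf]. *)
Lemma is_hartleyK f u : L2 f -> is_hartley f u -> is_hartley u f.
Proof.
move=> f2 fu; have u2 := fu.1.
have ii a b : is_hartley (itvf a b) (hint (itvf a b)).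
  by apply: is_hartley_hint; [exact: L1_itvf|exact: L2_itvf].
have hh a b : is_hartley (hint (itvf a b)) (itvf a b).
  have [w hw] := is_hartley_exists (ii a b).1.
  apply: (is_hartley_aer (ii a b).1 (L1_measurable (L1_itvf a b)) _ hw).
  apply: (L2_eq_itvf hw.1 (L2_itvf a b)) => a' b'.
  rewrite (is_hartley_sym (ii a b).1 (L2_itvf a' b') hw (ii a' b')).
  exact: hint_itvf.
have [w uw] := is_hartley_exists u2.
apply: (is_hartley_aer u2 (L2_measurable f2) _ uw).
apply: (L2_eq_itvf uw.1 f2) => a b.
rewrite (is_hartley_sym u2 (L2_itvf a b) uw (ii a b)).
exact: is_hartley_sym f2 (ii a b).1 fu (hh a b).
Qed.

Lemma is_hartley_parseval f g u v : L2 f -> L2 g -> is_hartley f u ->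
  is_hartley g v -> ip u v = ip f g.
Proof.
by move=> f2 g2 fu gv; exact: is_hartley_sym f2 gv.1 fu (is_hartleyK g2 gv).
Qed.

Lemma is_hartley_sqn f u : L2 f -> is_hartley f u -> sqn u = sqn f.
Proof. by move=> f2 fu; rewrite !sqnE; exact: is_hartley_parseval. Qed.

End HartleyL2.

(** * The Fourier transform as even and odd part *)
Section FourierHartley.
Context {R : realType}.
Implicit Types f u v w : R -> R.
Implicit Types g : R -> R[i].

Local Open Scope complex_scope.
Local Notation Re := complex.Re.
Local Notation Im := complex.Im.
Local Notation normc := ComplexField.Normc.normc.

Lemma normc_sqr (z : R[i]) : normc z ^+ 2 = Re z ^+ 2 + Im z ^+ 2.
Proof. by case: z => a b /=; rewrite sqr_sqrtr// addr_ge0// sqr_ge0. Qed.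

Lemma ReB (z w : R[i]) : Re (z - w) = Re z - Re w.
Proof. by case: z; case: w. Qed.

Lemma ImB (z w : R[i]) : Im (z - w) = Im z - Im w.
Proof. by case: z; case: w. Qed.

Lemma ReD (z w : R[i]) : Re (z + w) = Re z + Re w.
Proof. by case: z; case: w. Qed.

Lemma ImD (z w : R[i]) : Im (z + w) = Im z + Im w.
Proof. by case: z; case: w. Qed.

Lemma ReZ (c : R) (z : R[i]) : Re (c%:C * z) = c * Re z.
Proof. by case: z => a b /=; rewrite mul0r subr0. Qed.

Lemma ImZ (c : R) (z : R[i]) : Im (c%:C * z) = c * Im z.
Proof. by case: z => a b /=; rewrite mul0r addr0. Qed.

Lemma eq_ReIm (z w : R[i]) : Re z = Re w -> Im z = Im w -> z = w.
Proof. by case: z => a b; case: w => c d /= -> ->. Qed.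

(** For real [f] the real part of Fourier's transform is even and its imaginary
    part odd, hence they are, up to sign, the parts of Hartley's, their difference. *)
Definition evenp u x : R := (u x + u (- x)) / 2.
Definition oddp u x : R := (u x - u (- x)) / 2.

Definition hat u : R -> R[i] := fun xi => evenp u xi -i* oddp u xi.

Lemma Re_hat u xi : Re (hat u xi) = evenp u xi. Proof. by []. Qed.
Lemma Im_hat u xi : Im (hat u xi) = - oddp u xi. Proof. by []. Qed.

Lemma ge0_integral_refl f : measurable_fun setT f -> (forall x, 0 <= f x) ->
  (\int[mu]_x (f (- x))%:E = \int[mu]_x (f x)%:E)%E.
Proof.
move=> mf f0.
transitivity (\int[pushforward lebesgue_measure (-%R : _ -> measurableTypeR R)]_x (f x)%:E)%E.
  rewrite ge0_integral_pushforward//; first exact/measurable_EFinP.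
  by move=> x _; rewrite lee_fin.
by apply: eq_measure_integral => //= A mA _; rewrite lebesgue_measureN.
Qed.

Lemma L2_refl u : L2 u -> L2 (fun x => u (- x)).
Proof.
move=> u2; have mu' := L2_measurable u2; have mq := L1_measurable (L2_sqr u2).
apply/L2P; split; first exact: measurableT_comp.
apply: L1_lty.
- by apply: measurable_funX; exact: measurableT_comp.
- by move=> x; exact: sqr_ge0.
- rewrite (ge0_integral_refl mq); last by move=> x; exact: sqr_ge0.
  by rewrite (L1_EFin (L2_sqr u2)) ltry.
Qed.

Lemma sqn_refl u : L2 u -> sqn (fun x => u (- x)) = sqn u.
Proof.
move=> u2; rewrite /sqn /Rintegral (ge0_integral_refl (L1_measurable (L2_sqr u2)))//.
by move=> x; exact: sqr_ge0.
Qed.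

Lemma L2_evenp u : L2 u -> L2 (evenp u).
Proof.
move=> u2; have := L2Z 2^-1 (L2D u2 (L2_refl u2)).
by under [X in L2 X -> _]eq_fun do rewrite mulrC.
Qed.

Lemma L2_oddp u : L2 u -> L2 (oddp u).
Proof.
move=> u2; have := L2Z 2^-1 (L2B u2 (L2_refl u2)).
by under [X in L2 X -> _]eq_fun do rewrite mulrC.
Qed.

Lemma L2_opp u : L2 u -> L2 (fun x => - u x).
Proof. by move=> u2; have := L2Z (-1) u2; under [X in L2 X -> _]eq_fun do rewrite mulN1r. Qed.

Lemma L2C_hat u : L2 u -> L2C (hat u).
Proof. by move=> u2; split; [exact: L2_evenp|exact/L2_opp/L2_oddp]. Qed.

Lemma sqn_evenp_oddp u : L2 u -> sqn (evenp u) + sqn (oddp u) = sqn u.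
Proof.
move=> u2; have r2 := L2_refl u2.
rewrite /sqn -RintD; [|exact/L2_sqr/L2_evenp|exact/L2_sqr/L2_oddp].
have E x : evenp u x ^+ 2 + oddp u x ^+ 2 = 2^-1 * (u x ^+ 2 + u (- x) ^+ 2).
  by rewrite /evenp /oddp; field.
rewrite (eq_Rint E) (RintZ _ (L1D (L2_sqr u2) (L2_sqr r2))).
rewrite (RintD (L2_sqr u2) (L2_sqr r2)) -!/(sqn _) (sqn_refl u2).
by move: (sqn u) => q; clear; lra.
Qed.

Lemma fourier_integral_hat f n xi : L2 f ->
  fourier_integral `[- n%:R, n%:R] f xi = hat (hint (trunc n f)) xi.
Proof.
move=> f2; have t1 := L1_truncL2 n f2.
have ic y : L1 (fun x => trunc n f x * cos (y * x)).
  apply: L1_le (L1_norm t1).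
    apply: measurable_funM; first exact: L1_measurable t1.
    by apply: (measurableT_comp (continuous_measurable_fun (@continuous_cos R))); exact: measurable_funM.
  by move=> x; rewrite normrM ler_piMr// ler_norml cos_geN1 cos_le1.
have is_ y : L1 (fun x => trunc n f x * sin (y * x)).
  apply: L1_le (L1_norm t1).
    apply: measurable_funM; first exact: L1_measurable t1.
    by apply: (measurableT_comp (continuous_measurable_fun (@continuous_sin R))); exact: measurable_funM.
  by move=> x; rewrite normrM ler_piMr// ler_norml sin_geN1 sin_le1.
have h y : hint (trunc n f) y = kappa * (\int[mu]_x (trunc n f x * cos (y * x)) +
    \int[mu]_x (trunc n f x * sin (y * x))).
  by rewrite -(RintD (ic y) (is_ y)); congr (_ * _); apply: eq_Rint => x; rewrite /cas mulrDr.
have cE : \int[mu]_(y in `[- n%:R, n%:R]) (f y * cos (xi * y)) =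
    \int[mu]_x (trunc n f x * cos (xi * x)).
  rewrite Rintegral_mkcond; apply: eq_Rint => x; rewrite /trunc !patchE.
  by case: ifP => // _; rewrite mul0r.
have sE : \int[mu]_(y in `[- n%:R, n%:R]) (f y * sin (xi * y)) =
    \int[mu]_x (trunc n f x * sin (xi * x)).
  rewrite Rintegral_mkcond; apply: eq_Rint => x; rewrite /trunc !patchE.
  by case: ifP => // _; rewrite mul0r.
have cN : \int[mu]_x (trunc n f x * cos (- xi * x)) = \int[mu]_x (trunc n f x * cos (xi * x)).
  by apply: eq_Rint => x; rewrite mulNr cosN.
have sN : \int[mu]_x (trunc n f x * sin (- xi * x)) = - \int[mu]_x (trunc n f x * sin (xi * x)).
  by rewrite -[RHS]mulN1r -(RintZ _ (is_ xi)); apply: eq_Rint => x; rewrite mulNr sinN mulrN mulN1r.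
rewrite /fourier_integral cE sE; apply: eq_ReIm.
  by rewrite ReZ Re_hat /evenp !h cN sN /= -/kappa; field.
by rewrite ImZ Im_hat /oddp !h cN sN /= -/kappa; field.
Qed.

(** The square error of Fourier's transform splits into those of the even and odd
    parts, which turns the complex limit into two real ones. *)
Lemma fourier_error f g n : L2 f -> L2C g ->
  (\int[mu]_xi (normc (fourier_integral `[- n%:R, n%:R] f xi - g xi) ^+ 2)%:E =
  (sqn (fun xi => evenp (hint (trunc n f)) xi - Re (g xi))
   + sqn (fun xi => - oddp (hint (trunc n f)) xi - Im (g xi)))%:E)%E.
Proof.
move=> f2 [gr gi]; have h2 := L2_hint_trunc n f2.
have a2 := L2B (L2_evenp h2) gr; have b2 := L2B (L2_opp (L2_oddp h2)) gi.
rewrite /sqn -(RintD (L2_sqr a2) (L2_sqr b2)).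
rewrite -(L1_EFin (L1D (L2_sqr a2) (L2_sqr b2))).
by apply: eq_integral => xi _; rewrite normc_sqr fourier_integral_hat// ReB ImB.
Qed.

Lemma is_fourierP f g : L2 f -> is_fourier f g <->
  [/\ L2C g,
      sqn (fun xi => evenp (hint (trunc n f)) xi - Re (g xi)) @[n --> \oo] --> 0 &
      sqn (fun xi => - oddp (hint (trunc n f)) xi - Im (g xi)) @[n --> \oo] --> 0].
Proof.
move=> f2; split.
  move=> [gC]; under eq_cvg do rewrite fourier_error//.
  move=> /fine_cvg /= c; split => //.
    apply: (@squeeze_cvgr _ _ _ _ (cst 0) _ _ _ _ _ c); last exact: cvg_cst.
    by apply: nearW => n; rewrite sqn_ge0/= lerDl sqn_ge0.
  apply: (@squeeze_cvgr _ _ _ _ (cst 0) _ _ _ _ _ c); last exact: cvg_cst.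
  by apply: nearW => n; rewrite sqn_ge0/= lerDr sqn_ge0.
move=> [gC cr ci]; split => //; under eq_cvg do rewrite fourier_error//.
by apply: cvg_EFin; [exact: nearW|rewrite -[0]addr0; exact: cvgD].
Qed.

Lemma is_fourier_hat f u : L2 f -> is_hartley f u -> is_fourier f (hat u).
Proof.
move=> f2 [u2 fu]; apply/(is_fourierP _ f2).
have d2 n := L2B (L2_hint_trunc n f2) u2.
have le n : sqn (evenp (fun x => hint (trunc n f) x - u x)) <=
      sqn (fun x => hint (trunc n f) x - u x) /\
    sqn (oddp (fun x => hint (trunc n f) x - u x)) <=
      sqn (fun x => hint (trunc n f) x - u x).
  by rewrite -(sqn_evenp_oddp (d2 n)) lerDl lerDr !sqn_ge0.
split; first exact: L2C_hat.
  apply: (@squeeze_cvgr _ _ _ _ (cst 0) _ _ _ _ _ fu); last exact: cvg_cst.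
  apply: nearW => n; rewrite sqn_ge0/=; apply: le_trans (le n).1.
  rewrite le_eqVlt; apply/orP; left; apply/eqP; congr sqn; apply/funext => x.
  by rewrite /evenp; field.
apply: (@squeeze_cvgr _ _ _ _ (cst 0) _ _ _ _ _ fu); last exact: cvg_cst.
apply: nearW => n; rewrite sqn_ge0/=; apply: le_trans (le n).2.
rewrite le_eqVlt; apply/orP; left; apply/eqP; rewrite sqnBC; congr sqn; apply/funext => x.
by rewrite /= /oddp; field.
Qed.

Lemma is_fourier_uniq f g g' : L2 f -> is_fourier f g -> is_fourier f g' ->
  g = g' %[ae mu].
Proof.
move=> f2 /(is_fourierP _ f2)[[gr gi] cr ci] /(is_fourierP _ f2)[[gr' gi'] cr' ci'].
have h2 n := L2_hint_trunc n f2.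
have /ae_eqE A := L2_cvg_uniq (fun n => L2_evenp (h2 n)) gr gr' cr cr'.
have /ae_eqE B := L2_cvg_uniq (fun n => L2_opp (L2_oddp (h2 n))) gi gi' ci ci'.
by apply/ae_eqE; apply: aeS (aeI A B) => x [a b]; exact: eq_ReIm.
Qed.

Lemma fourierP f : L2 f -> is_fourier f (fourier f).
Proof.
move=> f2; have [u fu] := is_hartley_exists f2.
exact: (xgetPex (fun=> 0) (ex_intro [set g | is_fourier f g] _ (is_fourier_hat f2 fu))).
Qed.

Lemma fourier_hat f u : L2 f -> is_hartley f u -> fourier f = hat u %[ae mu].
Proof.
move=> f2 fu; apply: (is_fourier_uniq f2); first exact: fourierP.
exact: is_fourier_hat.
Qed.

(** Hartley's transform recovered from the chosen representative of Fourier's. *)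
Definition hart f (xi : R) : R := Re (fourier f xi) - Im (fourier f xi).

Lemma is_hartley_hart f : L2 f -> is_hartley f (hart f).
Proof.
move=> f2; have [u fu] := is_hartley_exists f2.
have /ae_eqE H := fourier_hat f2 fu.
apply: (is_hartley_aer f2 _ _ fu).
  by have [[a b] _] := fourierP f2; apply: measurable_funB; exact: L2_measurable.
apply/ae_eqE; apply: aeS H => x; rewrite /hart => ->.
by rewrite Re_hat Im_hat /evenp /oddp; field.
Qed.

End FourierHartley.

(** * The multipliers of the two source terms *)
Section Multipliers.
Context {R : realType}.
Implicit Types (a x tau T : R) (k : nat).

Lemma is_deriveDr (f g : R -> R) x (a b : R) : is_derive x 1 f a ->
  is_derive x 1 g b -> is_derive x 1 (fun x => f x + g x) (a + b).
Proof. exact: is_deriveD. Qed.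

Lemma is_deriveBr (f g : R -> R) x (a b : R) : is_derive x 1 f a ->
  is_derive x 1 g b -> is_derive x 1 (fun x => f x - g x) (a - b).
Proof. exact: is_deriveB. Qed.

Lemma is_derive_cstr (c x : R) : is_derive x 1 (fun _ : R => c) 0.
Proof. exact: is_derive_cst. Qed.

Lemma is_derive_sqr x : is_derive x 1 (fun x : R => x ^+ 2) (2 * x).
Proof.
apply: (is_derive_cast (is_deriveMr (is_derive_id x 1) (is_derive_id x 1))); ring.
Qed.

Lemma is_derive_cont (f : R -> R) x a : is_derive x 1 f a -> {for x, continuous f}.
Proof. by move=> [+ _] => /derivable1_diffP/differentiable_continuous. Qed.

Lemma le_of_derive (F f : R -> R) a b : a <= b ->
  (forall x, a <= x <= b -> {for x, continuous F}) ->
  (forall x, a < x < b -> is_derive x 1 F (f x)) ->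
  (forall x, a < x < b -> 0 <= f x) -> F a <= F b.
Proof.
rewrite le_eqVlt => /predU1P[->//|ab] cF dF f0.
have dF' x : x \in `]a, b[ -> is_derive x 1 F (f x) by rewrite in_itv/=; exact: dF.
have cF' : {within `[a, b], continuous F}.
  by apply: continuous_in_subspaceT => x; rewrite inE/= in_itv/=; exact: cF.
have [c + E] := MVT ab dF' cF'.
rewrite in_itv/= => cab; rewrite -subr_ge0 E.
by rewrite mulr_ge0 ?subr_ge0 ?f0// ltW.
Qed.

(** The integrand of [mult] after the substitution theta = u^2, which removes the
    singularity of the source at time 0. *)
Definition ker k a u : R := u ^+ (2 * k) * expR (a * u ^+ 2).

Lemma continuous_ker k a : continuous (ker k a).
Proof.
move=> x; apply: cvgM; first exact: exprn_continuous.
apply: (continuous_cvg _ (@continuous_expR R _)).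
by apply: cvgM; [exact: cvg_cst|exact: exprn_continuous].
Qed.

(** The integral of [ker k a] from 0 to [x]; the base point -1 makes it
    differentiable on both sides of 0. *)
Definition Phi k a x : R :=
  ip (ker k a) (itvf (-1) x) - ip (ker k a) (itvf (-1) 0).

Lemma Phi0 k a : Phi k a 0 = 0.
Proof. by rewrite /Phi subrr. Qed.

Lemma is_derive_Phi k a x : -1 < x -> is_derive x 1 (Phi k a) (ker k a x).
Proof.
move=> x1; have xx : x < x + 1 by rewrite ltrDl.
have iK : lebesgue_measure.-integrable `[-1, x + 1] (EFin \o ker k a).
  apply: continuous_compact_integrable; first exact: segment_compact.
  by apply: continuous_subspaceT; exact: continuous_ker.
have [d1 d2] := continuous_FTC1_closed xx iK x1 (@continuous_ker k a x).
have -> : Phi k a = (fun x => \int[lebesgue_measure]_(t in `[-1, x]) ker k a t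
    - ip (ker k a) (itvf (-1) 0)) by apply/funext => y; rewrite /Phi !ip_itvf.
rewrite -[ker k a x]subr0; apply: is_deriveBr.
by apply: DeriveDef; [exact: d1|rewrite -derive1E; exact: d2].
Qed.

Lemma is_derive_expsq a x :
  is_derive x 1 (fun x => expR (a * x ^+ 2)) (2 * a * x * expR (a * x ^+ 2)).
Proof.
apply: (is_derive_cast (is_derive_compr (is_derive_expR _)
  (is_deriveZr a (is_derive_sqr x)))); ring.
Qed.

Lemma ker0E a x : ker 0 a x = expR (a * x ^+ 2).
Proof. by rewrite /ker muln0 expr0 mul1r. Qed.

Lemma ker1E a x : ker 1 a x = x ^+ 2 * expR (a * x ^+ 2).
Proof. by []. Qed.

Lemma ker_ge0 k a x : 0 <= ker k a x.
Proof. by rewrite /ker exprM mulr_ge0 ?expR_ge0// exprn_ge0// sqr_ge0. Qed.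

Lemma Phi_le k a x y : 0 <= x -> x <= y -> Phi k a x <= Phi k a y.
Proof.
move=> x0 xy; apply: (le_of_derive xy (f := ker k a)) => z /andP[h _].
- by apply: is_derive_cont; apply: is_derive_Phi; lra.
- by apply: is_derive_Phi; lra.
- exact: ker_ge0.
Qed.

Lemma Phi_ge0 k a x : 0 <= x -> 0 <= Phi k a x.
Proof. by move=> x0; rewrite -(Phi0 k a) Phi_le. Qed.

(** The bounds on [Phi] below compare two functions by their derivatives. *)
Lemma ge0_of_derive (F f : R -> R) x : 0 <= x -> 0 <= F 0 ->
  (forall z : R, 0 <= z -> is_derive z 1 F (f z)) -> (forall z, 0 <= z -> 0 <= f z) ->
  0 <= F x.
Proof.
move=> x0 F0 dF f0; apply: (le_trans F0).
apply: (le_of_derive x0 (f := f)) => z /andP[h _].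
- by apply: is_derive_cont; exact: dF.
- by apply: dF; exact: ltW.
- by apply: f0; exact: ltW.
Qed.

Lemma dPhi k a x : 0 <= x -> is_derive x 1 (Phi k a) (ker k a x).
Proof. by move=> x0; apply: is_derive_Phi; lra. Qed.

Lemma Phi1_le a x : 0 <= x -> Phi 1 a x <= x ^+ 2 * Phi 0 a x.
Proof.
move=> x0; rewrite -subr_ge0.
apply: (@ge0_of_derive (fun x => x ^+ 2 * Phi 0 a x - Phi 1 a x)
  (fun x => 2 * x * Phi 0 a x) x x0).
- by rewrite !Phi0 mulr0 subr0.
- move=> z z0; apply: (is_derive_cast (is_deriveBr
    (is_deriveMr (is_derive_sqr z) (dPhi 0 a z0)) (dPhi 1 a z0))).
  by rewrite ker0E ker1E; ring.
- by move=> z z0; rewrite !mulr_ge0 ?Phi_ge0.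
Qed.

Lemma Phi0_le a x : 0 <= a -> 0 <= x -> Phi 0 a x <= x * expR (a * x ^+ 2).
Proof.
move=> a0 x0; rewrite -subr_ge0.
apply: (@ge0_of_derive (fun x => x * expR (a * x ^+ 2) - Phi 0 a x)
  (fun x => 2 * a * x ^+ 2 * expR (a * x ^+ 2)) x x0).
- by rewrite Phi0 mul0r subr0.
- move=> z z0; apply: (is_derive_cast (is_deriveBr
    (is_deriveMr (is_derive_id z 1) (is_derive_expsq a z)) (dPhi 0 a z0))).
  by rewrite ker0E; ring.
- by move=> z z0; rewrite !mulr_ge0 ?sqr_ge0 ?expR_ge0.
Qed.

(** Decay in the frequency: the derivative of the difference of the two sides is
    nonnegative by [Phi0_le]. *)
Lemma freq_Phi0_le a x : 0 <= a -> 0 <= x -> a * (x * Phi 0 a x) <= expR (a * x ^+ 2).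
Proof.
move=> a0 x0; rewrite -subr_ge0.
apply: (@ge0_of_derive (fun x => expR (a * x ^+ 2) - a * (x * Phi 0 a x))
  (fun x => a * (x * expR (a * x ^+ 2) - Phi 0 a x)) x x0).
- by rewrite Phi0 !mulr0 subr0 expR_ge0.
- move=> z z0; apply: (is_derive_cast (is_deriveBr (is_derive_expsq a z)
    (is_deriveZr a (is_deriveMr (is_derive_id z 1) (dPhi 0 a z0))))).
  by rewrite ker0E; ring.
- by move=> z z0; rewrite mulr_ge0// subr_ge0 Phi0_le.
Qed.

(** Decay no faster than the inverse of [a]: what bounds the inverse matrix. *)
Lemma Phi0_ge a x : 0 <= a -> 0 <= x ->
  x * expR (a * x ^+ 2) <= (1 + 2 * a * x ^+ 2) * Phi 0 a x.
Proof.
move=> a0 x0; rewrite -subr_ge0.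
apply: (@ge0_of_derive
  (fun x => (1 + 2 * a * x ^+ 2) * Phi 0 a x - x * expR (a * x ^+ 2))
  (fun x => 4 * a * x * Phi 0 a x) x x0).
- by rewrite Phi0 !mulr0 mul0r subr0.
- move=> z z0; apply: (is_derive_cast (is_deriveBr
    (is_deriveMr (is_deriveDr (is_derive_cstr 1 z)
      (is_deriveZr (2 * a) (is_derive_sqr z))) (dPhi 0 a z0))
    (is_deriveMr (is_derive_id z 1) (is_derive_expsq a z)))).
  by rewrite ker0E; ring.
- by move=> z z0; rewrite !mulr_ge0 ?Phi_ge0.
Qed.

(** The constant in the lower bound of the determinant; in this form it is easy
    to differentiate, and [gapE] shows that it is positive. *)
Definition gap (x1 x : R) : R := x ^+ 2 / 3 - x1 ^+ 2 + 2 * x1 ^+ 3 / 3 * x^-1.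

Lemma gapE x1 x : x != 0 -> gap x1 x = (x - x1) ^+ 2 * (x + 2 * x1) / (3 * x).
Proof. by move=> x0; rewrite /gap; field. Qed.

Lemma gap_gt0 x1 x2 : 0 < x1 -> x1 < x2 -> 0 < gap x1 x2.
Proof.
move=> x10 x12; have x20 : 0 < x2 by lra.
rewrite gapE ?gt_eqF// divr_gt0 ?mulr_gt0 ?exprn_gt0 ?subr_gt0 ?addr_gt0 ?mulr_gt0//.
Qed.

(** [gap x1] is the solution of (x gap)' = x^2 - x1^2 vanishing at [x1], so that
    [Phi0_le] makes the derivative of the difference nonnegative. *)
Lemma Phi_gap a x1 x2 : 0 <= a -> 0 < x1 -> x1 <= x2 ->
  gap x1 x2 * Phi 0 a x2 <=
  (Phi 1 a x2 - Phi 1 a x1) - x1 ^+ 2 * (Phi 0 a x2 - Phi 0 a x1).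
Proof.
move=> a0 x10 x12; rewrite -subr_ge0.
pose D x := (Phi 1 a x - Phi 1 a x1) - x1 ^+ 2 * (Phi 0 a x - Phi 0 a x1) -
  gap x1 x * Phi 0 a x.
have <- : D x1 = 0.
  by rewrite /D !subrr gapE ?gt_eqF// subrr expr0n/= !mul0r mulr0 !subr0.
pose dgap x := 2 * x / 3 - 2 * x1 ^+ 3 / 3 * x ^- 2.
have dD x : x1 <= x -> is_derive x 1 D (dgap x * (x * expR (a * x ^+ 2) - Phi 0 a x)).
  move=> xx; have x0 : 0 < x by lra.
  have xn : x != 0 by rewrite gt_eqF.
  have dV : is_derive x 1 (fun x : R => x^-1) (- x ^- 2).
    have := @is_deriveV R (fun x : R => x) x 1 1 xn (is_derive_id x 1).
    by move=> h; apply: (is_derive_cast h); rewrite /GRing.scale/= mulr1.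
  have dg : is_derive x 1 (gap x1) (dgap x).
    rewrite (_ : gap x1 = fun x => x ^+ 2 / 3 - x1 ^+ 2 + 2 * x1 ^+ 3 / 3 * x^-1)//.
    apply: (is_derive_cast (is_deriveDr (is_deriveBr
      (is_deriveMr (is_derive_sqr x) (is_derive_cstr 3^-1 x))
      (is_derive_cstr (x1 ^+ 2) x)) (is_deriveZr (2 * x1 ^+ 3 / 3) dV))).
    by rewrite /dgap; field; exact: xn.
  have h0 := ltW x0.
  apply: (is_derive_cast (is_deriveBr (is_deriveBr
    (is_deriveBr (dPhi 1 a h0) (is_derive_cstr (Phi 1 a x1) x))
    (is_deriveZr (x1 ^+ 2) (is_deriveBr (dPhi 0 a h0) (is_derive_cstr (Phi 0 a x1) x))))
    (is_deriveMr dg (dPhi 0 a h0)))).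
  by rewrite ker0E ker1E /dgap /gap; field; exact: xn.
apply: (@le_of_derive D (fun x => dgap x * (x * expR (a * x ^+ 2) - Phi 0 a x)) x1 x2 x12).
- by move=> x /andP[h _]; apply: is_derive_cont; exact: dD.
- by move=> x /andP[h _]; apply: dD; exact: ltW.
- move=> x /andP[h _]; have x0 : 0 < x by lra.
  apply: mulr_ge0; last by rewrite subr_ge0 Phi0_le// ltW.
  rewrite /dgap subr_ge0 ler_pdivrMr ?exprn_gt0//.
  have := @lerXn2r R 3 x1 x; rewrite !nnegrE => /(_ (ltW x10) (ltW x0) (ltW h)).
  by rewrite [2 * x / 3 * _](_ : _ = 2 / 3 * x ^+ 3); [lra|ring].
Qed.

(** The right side of [Phi_gap] times [Phi 0 a x1] is at most the determinant
    because the weight [u ^ 2] is at most [x1 ^ 2] up to [x1], by [Phi1_le]. *)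
Lemma Phi_det a x1 x2 : 0 <= a -> 0 < x1 -> x1 <= x2 ->
  gap x1 x2 * (Phi 0 a x1 * Phi 0 a x2) <=
  Phi 0 a x1 * Phi 1 a x2 - Phi 0 a x2 * Phi 1 a x1.
Proof.
move=> a0 x10 x12.
have p0 : 0 <= Phi 0 a x1 by rewrite Phi_ge0// ltW.
have := ler_wpM2l p0 (Phi_gap a0 x10 x12).
have d0 : 0 <= Phi 0 a x2 - Phi 0 a x1 by rewrite subr_ge0 Phi_le// ltW.
have := ler_wpM2l d0 (Phi1_le a (ltW x10)).
nra.
Qed.

(** The integral over [0 < theta < tau] of
    exp (- a (tau - theta)) theta ^ (k - 1/2), halved. *)
Definition mult k a tau : R := expR (- (a * tau)) * Phi k a (Num.sqrt tau).

Lemma mult_0 k a : mult k a 0 = 0.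
Proof. by rewrite /mult sqrtr0 Phi0 mulr0. Qed.

Lemma mult_ge0 k a tau : 0 <= mult k a tau.
Proof. by rewrite mulr_ge0 ?expR_ge0 ?Phi_ge0 ?sqrtr_ge0. Qed.

Lemma continuous_mult k a : continuous (mult k a).
Proof.
move=> t; apply: cvgM.
  apply: (continuous_cvg _ (@continuous_expR R _)).
  by apply: cvgN; apply: cvgM; [exact: cvg_cst|exact: cvg_id].
apply: (@continuous_cvg _ _ _ _ _ _ (Phi k a)); last exact: sqrt_continuous.
by apply: is_derive_cont; apply: dPhi; exact: sqrtr_ge0.
Qed.

Lemma is_derive_mult k a tau : 0 < tau -> is_derive tau 1 (mult k a)
  (- (a * mult k a tau) + tau ^+ k / (2 * Num.sqrt tau)).
Proof.
move=> t0; have d1 : is_derive tau 1 (fun t : R => - (a * t)) (- a).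
  apply: (is_derive_cast (@is_deriveN _ _ _ (fun t : R => a * t) tau 1 _
    (is_deriveZr a (is_derive_id tau 1)))); by rewrite mulr1.
have d2 := is_derive_compr (dPhi k a (sqrtr_ge0 tau)) (is_derive1_sqrt t0).
apply: (is_derive_cast (is_deriveMr (is_derive_compr (is_derive_expR _) d1) d2)).
rewrite /mult /ker sqr_sqrtr ?(ltW t0)// exprM sqr_sqrtr ?(ltW t0)//.
have e : expR (- (a * tau)) * expR (a * tau) = 1 by rewrite -expRD addNr expR0.
transitivity (- (a * (expR (- (a * tau)) * Phi k a (Num.sqrt tau))) +
  tau ^+ k / (2 * Num.sqrt tau) * (expR (- (a * tau)) * expR (a * tau))); first by ring.
by rewrite e mulr1.
Qed.

Lemma mult1_le a tau : 0 <= tau -> mult 1 a tau <= tau * mult 0 a tau.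
Proof.
move=> t0; have := Phi1_le a (sqrtr_ge0 tau); rewrite sqr_sqrtr// => h.
by rewrite /mult mulrCA ler_wpM2l ?expR_ge0.
Qed.

Lemma expR_sqrtK a tau : 0 <= tau ->
  expR (- (a * tau)) * expR (a * Num.sqrt tau ^+ 2) = 1.
Proof. by move=> t0; rewrite sqr_sqrtr// -expRD addNr expR0. Qed.

Lemma freq_mult0_le a tau : 0 <= a -> 0 <= tau -> a * (Num.sqrt tau * mult 0 a tau) <= 1.
Proof.
move=> a0 t0; rewrite -(expR_sqrtK a t0) /mult.
rewrite (_ : a * _ = expR (- (a * tau)) * (a * (Num.sqrt tau * Phi 0 a (Num.sqrt tau)))); last by ring.
by rewrite ler_wpM2l ?expR_ge0// freq_Phi0_le ?sqrtr_ge0.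
Qed.

Lemma mult0_le a tau : 0 <= a -> 0 <= tau -> mult 0 a tau <= Num.sqrt tau.
Proof.
move=> a0 t0; rewrite -[leRHS]mulr1 -(expR_sqrtK a t0) mulrCA /mult.
by rewrite ler_wpM2l ?expR_ge0// Phi0_le ?sqrtr_ge0.
Qed.

Lemma mult0_ge a tau : 0 <= a -> 0 <= tau ->
  Num.sqrt tau <= (1 + 2 * a * tau) * mult 0 a tau.
Proof.
move=> a0 t0; rewrite -[leLHS]mulr1 -[X in _ * X <= _](expR_sqrtK a t0) [in leLHS]mulrCA /mult [in leRHS]mulrCA.
rewrite ler_wpM2l ?expR_ge0//; have := Phi0_ge a0 (sqrtr_ge0 tau).
by rewrite sqr_sqrtr.
Qed.

Lemma mult_det a t1 t2 : 0 <= a -> 0 < t1 -> t1 <= t2 ->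
  gap (Num.sqrt t1) (Num.sqrt t2) * (mult 0 a t1 * mult 0 a t2) <=
  mult 0 a t1 * mult 1 a t2 - mult 0 a t2 * mult 1 a t1.
Proof.
move=> a0 t10 t12; have s1 : 0 < Num.sqrt t1 by rewrite sqrtr_gt0.
have s12 : Num.sqrt t1 <= Num.sqrt t2 by rewrite ler_wsqrtr.
have e0 : 0 <= expR (- (a * t1)) * expR (- (a * t2)) by rewrite mulr_ge0 ?expR_ge0.
have := ler_wpM2l e0 (Phi_det a0 s1 s12); rewrite /mult.
set p := Phi 0 a _; set q := Phi 0 a _; set r := Phi 1 a _; set u := Phi 1 a _.
set e1 := expR _; set e2 := expR _.
by move: (gap _ _) => g; clear; lra.
Qed.

(** Uniform in the frequency: [freq_mult0_le] bounds the derivative of [mult k a]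
    by a multiple of that of the square root, whatever the value of [a]. *)
Lemma mult_lip k a T t t' : (k <= 1)%N -> 0 <= a -> 1 <= T -> 0 <= t -> t <= t' -> t' <= T ->
  `|mult k a t' - mult k a t| <= T * (Num.sqrt t' - Num.sqrt t).
Proof.
move=> k1 a0 T1 t0 tt' t'T.
have bnd x : 0 < x -> x <= T ->
    `|- (a * mult k a x) + x ^+ k / (2 * Num.sqrt x)| <= T * (2 * Num.sqrt x)^-1.
  move=> x0 xT; have sx : 0 < Num.sqrt x by rewrite sqrtr_gt0.
  have s2 : Num.sqrt x ^+ 2 = x by rewrite sqr_sqrtr// ltW.
  have am0 : 0 <= a * mult 0 a x <= (Num.sqrt x)^-1.
    rewrite mulr_ge0 ?mult_ge0//= -[leRHS]mul1r ler_pdivlMr//.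
    by have := freq_mult0_le a0 (ltW x0); rewrite mulrCA mulrC.
  have iE : (2 * Num.sqrt x)^-1 = (Num.sqrt x)^-1 / 2 by field; rewrite gt_eqF.
  rewrite iE; set i := (Num.sqrt x)^-1 in am0 *.
  have i0 : 0 <= i by rewrite invr_ge0 ltW.
  case: k k1 => [|[|//]] _.
    rewrite expr0 mul1r ler_norml; apply/andP; split; nra.
  rewrite expr1 ler_norml; have m1 := mult1_le a (ltW x0).
  have m0 := mult_ge0 1 a x.
  have am1 : 0 <= a * mult 1 a x <= x * i.
    rewrite mulr_ge0//=; apply: le_trans (ler_wpM2l a0 m1) _.
    by case/andP: am0 => _ h; rewrite mulrCA ler_wpM2l// ltW.
  apply/andP; split; nra.
rewrite ler_norml; apply/andP; split.
  set p := mult k a.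
  have : (fun x => T * Num.sqrt x + p x) t <= (fun x => T * Num.sqrt x + p x) t'.
    apply: (@le_of_derive (fun x => T * Num.sqrt x + p x)
      (fun x => T * (2 * Num.sqrt x)^-1 + (- (a * p x) + x ^+ k / (2 * Num.sqrt x))) t t' tt').
    - move=> x _; apply: cvgD; last exact: continuous_mult.
      by apply: cvgM; [exact: cvg_cst|exact: sqrt_continuous].
    - move=> x /andP[h _]; have x0 : 0 < x by lra.
      by apply: is_deriveDr; [exact: is_deriveZr (is_derive1_sqrt x0)|exact: is_derive_mult].
    - move=> x /andP[h h']; have := bnd x; rewrite ler_norml.
      by move=> /(_ ltac:(lra) ltac:(lra)) /andP[]; rewrite -subr_ge0 opprK addrC.
  rewrite /= mulrBr; move: (T * Num.sqrt t) (T * Num.sqrt t') (p t) (p t'); clear.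
  move=> *; lra.
set p := mult k a.
have : (fun x => T * Num.sqrt x - p x) t <= (fun x => T * Num.sqrt x - p x) t'.
  apply: (@le_of_derive (fun x => T * Num.sqrt x - p x)
    (fun x => T * (2 * Num.sqrt x)^-1 - (- (a * p x) + x ^+ k / (2 * Num.sqrt x))) t t' tt').
  - move=> x _; apply: cvgB; last exact: continuous_mult.
    by apply: cvgM; [exact: cvg_cst|exact: sqrt_continuous].
  - move=> x /andP[h _]; have x0 : 0 < x by lra.
    by apply: is_deriveBr; [exact: is_deriveZr (is_derive1_sqrt x0)|exact: is_derive_mult].
  - move=> x /andP[h h']; have := bnd x; rewrite ler_norml.
    by move=> /(_ ltac:(lra) ltac:(lra)) /andP[_]; rewrite -subr_ge0.
rewrite /= mulrBr; move: (T * Num.sqrt t) (T * Num.sqrt t') (p t) (p t'); clear.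
  move=> *; lra.
Qed.

End Multipliers.

(** * Sobolev norms *)
Section Hart.
Context {R : realType}.
Implicit Types (f g u h : R -> R) (xi : R).
Local Open Scope complex_scope.
Local Notation Re := complex.Re.
Local Notation Im := complex.Im.
Local Notation normc := ComplexField.Normc.normc.

Lemma L2_hart f : L2 f -> L2 (hart f).
Proof. by move=> f2; have [] := is_hartley_hart f2. Qed.

Lemma hart_ae f u : L2 f -> is_hartley f u -> hart f = u %[ae mu].
Proof. by move=> f2; apply: is_hartley_uniq (is_hartley_hart f2). Qed.

Lemma eq_hart f g : L2 f -> L2 g -> f = g %[ae mu] -> hart f = hart g %[ae mu].
Proof.
move=> f2 g2 fg; apply: is_hartley_uniq (is_hartley_hart g2) => //.
exact: is_hartley_ael fg (is_hartley_hart f2).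
Qed.

Lemma hart_inj f g : L2 f -> L2 g -> hart f = hart g %[ae mu] -> f = g %[ae mu].
Proof.
move=> f2 g2 fg; have hf := is_hartley_hart f2; have hg := is_hartley_hart g2.
have gf := is_hartley_ael hf.1 hg.1 fg (is_hartleyK f2 hf).
exact: is_hartley_uniq hg.1 gf (is_hartleyK g2 hg).
Qed.

Lemma normc_fourier f : L2 f -> \forall xi \ae (@lebesgue_measure R),
  normc (fourier f xi) ^+ 2 = (hart f xi ^+ 2 + hart f (- xi) ^+ 2) / 2.
Proof.
move=> f2; have /ae_eqE := fourier_hat f2 (is_hartley_hart f2).
by apply: aeS => xi ->; rewrite normc_sqr Re_hat Im_hat /evenp /oddp; field.
Qed.

(** The squared Japanese bracket. *)
Definition jap xi : R := 1 + xi ^+ 2.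

Lemma jap_ge1 xi : 1 <= jap xi.
Proof. by rewrite lerDl sqr_ge0. Qed.

Lemma measurable_jap : measurable_fun setT jap.
Proof. by apply: measurable_funD => //; exact: measurable_funX. Qed.

(** The weight is even, so [hart f xi] and [hart f (- xi)] contribute equally to
    the squared modulus of [fourier f xi]. *)
Lemma integral_fourier l f : L2 f ->
  (\int[mu]_xi ((1 + xi ^+ 2) ^+ l * normc (fourier f xi) ^+ 2)%:E =
   \int[mu]_xi (jap xi ^+ l * hart f xi ^+ 2)%:E)%E.
Proof.
move=> f2; have mh := L2_measurable (L2_hart f2).
have [[/L2_measurable mRe /L2_measurable mIm] _] := fourierP f2.
have mj : measurable_fun setT (fun xi => jap xi ^+ l).
  by apply: measurable_funX; exact: measurable_jap.
have mq : measurable_fun setT (fun xi => jap xi ^+ l * hart f xi ^+ 2).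
  by apply: measurable_funM => //; exact: measurable_funX.
have mqN : measurable_fun setT (fun xi => jap xi ^+ l * hart f (- xi) ^+ 2).
  apply: measurable_funM => //; apply: measurable_funX.
  by apply: (measurableT_comp mh); exact: oppr_measurable.
have j0 xi : 0 <= jap xi ^+ l by rewrite exprn_ge0// (le_trans ler01 (jap_ge1 xi)).
have q0 xi : 0 <= jap xi ^+ l * hart f xi ^+ 2 by rewrite mulr_ge0// sqr_ge0.
have qN0 xi : 0 <= jap xi ^+ l * hart f (- xi) ^+ 2 by rewrite mulr_ge0// sqr_ge0.
transitivity (\int[lebesgue_measure]_xi ((2^-1)%:E *
    ((jap xi ^+ l * hart f xi ^+ 2)%:E + (jap xi ^+ l * hart f (- xi) ^+ 2)%:E))%E)%E.
  apply: ae_eq_integral => //.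
  - apply/measurable_EFinP; apply: measurable_funM => //.
    under eq_fun do rewrite normc_sqr.
    by apply: measurable_funD; exact: measurable_funX.
  - apply: emeasurable_funM => //.
    by apply: emeasurable_funD; apply/measurable_EFinP.
  - have := normc_fourier f2; apply: aeS => xi E _.
    by rewrite E -EFinD -EFinM; congr EFin; rewrite /jap; field.
rewrite ge0_integralZl//; last 2 first.
- by apply: emeasurable_funD; apply/measurable_EFinP.
- by move=> xi _; rewrite -EFinD lee_fin addr_ge0.
rewrite ge0_integralD//; last 4 first.
- by move=> xi _; rewrite lee_fin.
- by apply/measurable_EFinP; exact: mq.
- by move=> xi _; rewrite lee_fin.
- by apply/measurable_EFinP; exact: mqN.
have -> : (\int[lebesgue_measure]_xi (jap xi ^+ l * hart f (- xi) ^+ 2)%:E =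
    \int[lebesgue_measure]_xi (jap xi ^+ l * hart f xi ^+ 2)%:E)%E.
  rewrite -(ge0_integral_refl mq q0); apply: eq_integral => xi _.
  by rewrite /jap sqrrN.
have : (0 <= \int[lebesgue_measure]_xi (jap xi ^+ l * hart f xi ^+ 2)%:E)%E.
  by apply: integral_ge0 => xi _; rewrite lee_fin.
case: (\int[_]_xi _)%E => [r r0| |//].
  by rewrite -EFinD -EFinM; congr EFin; field.
by move=> _; rewrite addey// gt0_muley// lte_fin invr_gt0.
Qed.

Lemma sobolev_normE l f : L2 f -> L1 (fun xi => jap xi ^+ l * hart f xi ^+ 2) ->
  sobolev_norm l f = (Num.sqrt (\int[mu]_xi (jap xi ^+ l * hart f xi ^+ 2)))%:E.
Proof.
move=> f2 i; rewrite /sobolev_norm integral_fourier// L1_EFin// poweR_EFin.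
rewrite powR12_sqrt//; apply: Rintegral_ge0 => xi _.
by rewrite mulr_ge0 ?sqr_ge0// exprn_ge0// (le_trans ler01 (jap_ge1 xi)).
Qed.

Lemma sobolev_L1 l f : sobolev l f -> L1 (fun xi => jap xi ^+ l * hart f xi ^+ 2).
Proof.
move=> [f2]; rewrite /sobolev_norm integral_fourier// => h.
apply: L1_lty.
- apply: measurable_funM; apply: measurable_funX; first exact: measurable_jap.
  exact: L2_measurable (L2_hart f2).
- by move=> xi; rewrite mulr_ge0 ?sqr_ge0// exprn_ge0// (le_trans ler01 (jap_ge1 xi)).
- by apply: lty_poweRy h.
Qed.

Lemma sobolev0_norm f : L2 f -> sobolev_norm 0 f = (Num.sqrt (sqn (hart f)))%:E.
Proof.
move=> f2; rewrite sobolev_normE//; last first.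
  by under eq_fun do rewrite expr0 mul1r; exact: L2_sqr (L2_hart f2).
by congr (Num.sqrt _)%:E; apply: eq_Rint => xi; rewrite expr0 mul1r.
Qed.

Lemma sobolev0 f : L2 f -> sobolev 0 f.
Proof. by move=> f2; split=> //; rewrite sobolev0_norm// ltry. Qed.

Lemma L2_jap_hart f : sobolev 2 f -> L2 (fun xi => jap xi * hart f xi).
Proof.
move=> sf; apply/L2P; split.
  by apply: measurable_funM; [exact: measurable_jap|exact: L2_measurable (L2_hart sf.1)].
by under eq_fun do rewrite exprMn; exact: sobolev_L1.
Qed.

Lemma sobolev2_norm f : sobolev 2 f ->
  sobolev_norm 2 f = (Num.sqrt (sqn (fun xi => jap xi * hart f xi)))%:E.
Proof.
move=> sf; rewrite sobolev_normE; [|exact: sf.1|exact: sobolev_L1].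
by congr (Num.sqrt _)%:E; apply: eq_Rint => xi; rewrite exprMn.
Qed.

Lemma Lnorm2E f : L2 f -> ('N[mu]_2%:E[EFin \o f] = (Num.sqrt (sqn f))%:E)%E.
Proof.
move=> f2; rewrite unlock /= (_ : (\int[_]_x _)%E = (sqn f)%:E); last first.
  rewrite /sqn -(L1_EFin (L2_sqr f2)); apply: eq_integral => x _ /=.
  by rewrite -[X in _ `^ X]/(2%:R) powR_mulrn// real_normK// num_real.
by rewrite poweR_EFin powR12_sqrt// sqn_ge0.
Qed.

End Hart.

(** * Duhamel's formula *)
Section InverseProblem.
Context {R : realType} (s sigma : R).
Hypotheses (s_gt0 : 0 < s) (sigma_gt0 : 0 < sigma).
Implicit Types (a tau theta xi y T : R) (k : nat) (f u h : R -> R).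
Local Open Scope complex_scope.
Local Notation Re := complex.Re.
Local Notation Im := complex.Im.

(** The decay rate of the mode of frequency [xi] under the heat equation. *)
Definition freq xi : R := sigma ^+ 2 / 2 * xi ^+ 2.

Lemma freq_ge0 xi : 0 <= freq xi.
Proof. by rewrite mulr_ge0 ?sqr_ge0// divr_ge0// sqr_ge0. Qed.

Lemma freqN xi : freq (- xi) = freq xi.
Proof. by rewrite /freq sqrrN. Qed.

Lemma measurable_freq : measurable_fun setT freq.
Proof. by apply: measurable_funM => //; exact: measurable_funX. Qed.

Lemma measurable_expR_comp d (T : measurableType d) (f : T -> R) :
  measurable_fun setT f -> measurable_fun setT (fun x => expR (f x)).
Proof.
by apply: (measurableT_comp (continuous_measurable_fun (@continuous_expR R))).
Qed.

Lemma measurable_mult k tau : measurable_fun setT (fun xi => mult k (freq xi) tau).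
Proof.
apply: measurable_funM.
  apply: measurable_expR_comp; apply: measurableT_comp => //.
  by apply: measurable_funM => //; exact: measurable_freq.
have mP x : measurable_fun setT (fun xi => ip (ker k (freq xi)) (itvf (-1) x)).
  have m2 : measurable_fun setT (fun z : R * R => ker k (freq z.1) z.2 * itvf (-1) x z.2).
    apply: measurable_funM; last exact: (measurableT_comp (L1_measurable (L1_itvf _ _))).
    apply: measurable_funM; first exact: measurable_funX.
    apply: measurable_expR_comp; apply: measurable_funM; last exact: measurable_funX.
    exact: (measurableT_comp measurable_freq).
  exact: (measurable_Rintegral_snd m2).
by apply: measurable_funB; exact: mP.
Qed.

Lemma L1_oneDsqrV : L1 (fun xi : R => (1 + xi ^+ 2)^-1).
Proof.
have c : continuous (fun xi : R => (1 + xi ^+ 2)^-1) by exact: continuous_oneDsqrV.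
have p (xi : R) : 0 <= (1 + xi ^+ 2)^-1 by rewrite invr_ge0 addr_ge0// sqr_ge0.
apply: L1_lty => //; first exact: continuous_measurable_fun.
rewrite ge0_symfun_integralT//; last by move=> x /=; rewrite sqrrN.
rewrite (_ : [set x | _] = `[0, +oo[%classic); last first.
  by apply/seteqP; split => x /=; rewrite in_itv/= andbT.
by rewrite integral0y_oneDsqr -EFinM ltry.
Qed.

(** For positive times a heat semigroup smooths: the multipliers are in L^2, so
    the solution is given by an absolutely convergent integral. *)
Lemma mult_decay k tau : (k <= 1)%N -> 0 < tau ->
  exists2 K, 0 <= K & forall xi, mult k (freq xi) tau <= K * (1 + xi ^+ 2)^-1.
Proof.
move=> k1 t0; have st : 0 < Num.sqrt tau by rewrite sqrtr_gt0.
pose K := Num.sqrt tau + 2 / (sigma ^+ 2 * Num.sqrt tau).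
have K0 : 0 <= K by rewrite addr_ge0 ?sqrtr_ge0// divr_ge0// mulr_ge0 ?sqr_ge0 ?sqrtr_ge0.
have m0 xi : mult 0 (freq xi) tau <= K * (1 + xi ^+ 2)^-1.
  rewrite ler_pdivlMr; last by rewrite ltr_wpDr// sqr_ge0.
  rewrite mulrDr mulr1; apply: lerD; first exact: mult0_le (freq_ge0 xi) (ltW t0).
  rewrite ler_pdivlMr ?mulr_gt0 ?exprn_gt0//.
  have := freq_mult0_le (freq_ge0 xi) (ltW t0); rewrite /freq.
  move: (mult _ _ _) (Num.sqrt tau) => q r; lra.
case: k k1 => [|[|//]] _; first by exists K.
exists (tau * K); first by rewrite mulr_ge0// ltW.
move=> xi; apply: (le_trans (mult1_le _ (ltW t0))).
by rewrite -mulrA ler_wpM2l// ltW.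
Qed.

Lemma L2_mult k tau : (k <= 1)%N -> 0 < tau -> L2 (fun xi => mult k (freq xi) tau).
Proof.
move=> k1 t0; have [K K0 mK] := mult_decay k1 t0.
apply/L2P; split; first exact: measurable_mult.
apply: L1_le (L1Z (K ^+ 2) L1_oneDsqrV).
  by apply: measurable_funX; exact: measurable_mult.
move=> xi; rewrite ger0_norm ?sqr_ge0//.
have q0 : 0 <= (1 + xi ^+ 2)^-1 by rewrite invr_ge0 addr_ge0// sqr_ge0.
have q1 : (1 + xi ^+ 2)^-1 <= 1.
  by rewrite invf_le1 ?lerDl ?sqr_ge0// ltr_wpDr// sqr_ge0.
apply: (@le_trans _ _ ((K * (1 + xi ^+ 2)^-1) ^+ 2)).
  by rewrite lerXn2r// ?nnegrE ?mult_ge0// mulr_ge0.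
by rewrite exprMn ler_wpM2l ?sqr_ge0// expr2 ler_piMr.
Qed.

(** Integrals over [0 < theta < tau] become integrals over the line, to which
    Fubini's theorem applies. *)
Definition oitv tau theta : R := \1_`]0, tau[ theta.

Lemma oitvE tau theta : oitv tau theta = if 0 < theta < tau then 1 else 0.
Proof.
rewrite /oitv indicE; case: ifPn => h; first by rewrite mem_set//= in_itv.
by rewrite memNset//= in_itv/=; exact/negP.
Qed.

Lemma measurable_oitv tau : measurable_fun setT (oitv tau).
Proof. exact: measurable_indic. Qed.

Lemma Rintegral_oitv tau f :
  \int[mu]_(theta in `]0, tau[) f theta = \int[mu]_theta (oitv tau theta * f theta).
Proof.
rewrite Rintegral_mkcond; apply: eq_Rint => x; rewrite patchE oitvE.
have [h|h] := boolP (0 < x < tau); first by rewrite mem_set/= ?in_itv// mul1r.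
by rewrite memNset ?mul0r//= in_itv/=; exact/negP.
Qed.

(** What a source of size theta ^ k / sqrt theta at time [theta] contributes to the
    mode of rate [a] at time [tau]. *)
Definition wker k a tau theta : R :=
  expR (- (a * (tau - theta))) * (theta ^+ k / Num.sqrt theta).

Lemma wker_ge0 k a tau theta : 0 < theta -> 0 <= wker k a tau theta.
Proof. by move=> t0; rewrite mulr_ge0 ?expR_ge0// divr_ge0 ?sqrtr_ge0// exprn_ge0// ltW. Qed.

Lemma measurable_sqrt : measurable_fun setT (@Num.sqrt R).
Proof. by apply: continuous_measurable_fun; exact: sqrt_continuous. Qed.

Lemma measurable_sqrtV : measurable_fun setT (fun x : R => (Num.sqrt x)^-1).
Proof.
under eq_fun do rewrite -powR_inv1 ?sqrtr_ge0//.
exact: (measurableT_comp (measurable_powR (-1)) measurable_sqrt).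
Qed.

Lemma measurable_wker2 k tau :
  measurable_fun setT (fun z : R * R => wker k (freq z.1) tau z.2).
Proof.
apply: measurable_funM.
  apply: measurable_expR_comp; apply: measurableT_comp => //.
  apply: measurable_funM; first exact: (measurableT_comp measurable_freq).
  exact: measurable_funB.
apply: measurable_funM; first exact: measurable_funX.
exact: (measurableT_comp measurable_sqrtV).
Qed.

Lemma measurable_wker k a tau : measurable_fun setT (wker k a tau).
Proof.
apply: measurable_funM.
  apply: measurable_expR_comp; apply: measurableT_comp => //.
  by apply: measurable_funM => //; exact: measurable_funB.
apply: measurable_funM; first exact: measurable_funX.
exact: measurable_sqrtV.
Qed.

Lemma wker_itv k a tau l r : 0 < l -> l < r ->
  (\int[mu]_(theta in `[l, r]) (wker k a tau theta)%:E =
  (2 * (expR (- (a * (tau - r))) * mult k a r) -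
   2 * (expR (- (a * (tau - l))) * mult k a l))%:E)%E.
Proof.
move=> l0 lr; pose P t : R := 2 * (expR (- (a * (tau - t))) * mult k a t).
have dP (t : R) : 0 < t -> is_derive t 1 P (wker k a tau t).
  move=> t0; have d1 : is_derive t 1 (fun t : R => - (a * (tau - t))) a.
    rewrite (_ : (fun t => _) = fun t => a * t - a * tau); last first.
      by apply/funext => z; ring.
    apply: (is_derive_cast (is_deriveBr (is_deriveZr a (is_derive_id t 1))
      (is_derive_cstr (a * tau) t))); ring.
  apply: (is_derive_cast (is_deriveZr 2 (is_deriveMr
    (is_derive_compr (is_derive_expR _) d1) (is_derive_mult k a t0)))).
  rewrite /wker; field; rewrite gt_eqF// sqrtr_gt0//.
have cP : continuous P.
  move=> t; apply: cvgM; first exact: cvg_cst.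
  apply: cvgM; last exact: continuous_mult.
  apply: (continuous_cvg _ (@continuous_expR R _)).
  by apply: cvgN; apply: cvgM; [exact: cvg_cst|apply: cvgB; [exact: cvg_cst|exact: cvg_id]].
rewrite (@continuous_FTC2 _ (wker k a tau) P)//.
- apply: continuous_in_subspaceT => t; rewrite inE/= in_itv/= => /andP[lt _].
  have t0 : 0 < t by lra.
  apply: cvgM.
    apply: (continuous_cvg _ (@continuous_expR R _)).
    by apply: cvgN; apply: cvgM; [exact: cvg_cst|apply: cvgB; [exact: cvg_cst|exact: cvg_id]].
  apply: cvgM; first exact: exprn_continuous.
  by apply: cvgV; [rewrite gt_eqF// sqrtr_gt0|exact: sqrt_continuous].
- split.
  + move=> t; rewrite in_itv/= => /andP[lt _].
    by have [] := dP t (lt_trans l0 lt).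
  + exact/cvg_at_right_filter/cP.
  + exact/cvg_at_left_filter/cP.
- move=> t; rewrite in_itv/= => /andP[lt _]; rewrite derive1E.
  by have [] := dP t (lt_trans l0 lt).
Qed.

(** The integrand is singular at 0, where only its primitive is continuous. *)
Lemma mult_integral k a tau : 0 < tau ->
  L1 (fun theta => oitv tau theta * wker k a tau theta) /\
  \int[mu]_theta (oitv tau theta * wker k a tau theta) = 2 * mult k a tau.
Proof.
move=> t0; pose l n : R := tau / n.+3%:R; pose r n : R := tau - l n.
have l0 n : 0 < l n by rewrite divr_gt0.
have lle m n : (m <= n)%N -> l n <= l m.
  by move=> mn; rewrite ler_pM2l// lef_pV2 ?posrE// ler_nat !ltnS.
have l3 n : l n <= tau / 3 by rewrite ler_pM2l// lef_pV2 ?posrE// ler_nat.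
have lr n : l n < r n by have := l3 n; rewrite /r; lra.
have cl : l n @[n --> \oo] --> (0 : R).
  rewrite -(mulr0 tau); apply: cvgM; first exact: cvg_cst.
  have h : n.+1%:R^-1 @[n --> \oo] --> (0 : R) by exact: cvg_harmonic.
  by move: h; rewrite -cvg_shiftS -cvg_shiftS.
have cr : r n @[n --> \oo] --> tau.
  by rewrite -[X in _ --> X]subr0; apply: cvgB => //; exact: cvg_cst.
have mg : measurable_fun setT (fun theta => oitv tau theta * wker k a tau theta).
  by apply: measurable_funM; [exact: measurable_oitv|exact: measurable_wker].
have g0 theta : 0 <= oitv tau theta * wker k a tau theta.
  rewrite oitvE; case: ifP => [/andP[h _]|_]; last by rewrite mul0r.
  by rewrite mul1r wker_ge0.
have E : (\int[lebesgue_measure]_theta (oitv tau theta * wker k a tau theta)%:E =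
    (2 * mult k a tau)%:E)%E.
  have -> : (\int[lebesgue_measure]_theta (oitv tau theta * wker k a tau theta)%:E =
      \int[lebesgue_measure]_(theta in `]0%R, tau[) (wker k a tau theta)%:E)%E.
    rewrite [RHS]integral_mkcond; apply: eq_integral => x _; rewrite patchE oitvE.
    have [h|h] := boolP (0 < x < tau); first by rewrite mem_set/= ?in_itv// mul1r.
    by rewrite memNset ?mul0r//= in_itv/=; exact/negP.
  have U : `]0, tau[%classic = \bigcup_n `[l n, r n]%classic.
    apply/seteqP; split => x /=; rewrite in_itv/=.
      move=> /andP[x0 xt].
      have : \forall n \near \oo, l n < Num.min x (tau - x).
        by apply: (cvgr_lt _ cl); rewrite lt_min x0 subr_gt0.
      move=> [N _ /(_ N (leqnn N))]; rewrite lt_min => /andP[h1 h2].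
      by exists N => //=; rewrite in_itv/= /r ltW//=; lra.
    move=> [n _ /=]; rewrite in_itv/= => /andP[h1 h2].
    by apply/andP; have := l0 n; rewrite /r in h2; split; lra.
  rewrite U; apply: (@cvg_unique _ (@ereal_hausdorff R) _ _ _ _
    (ge0_nondecreasing_set_cvg_integral _ _ _ _)).
  - move=> m n mn; apply/subsetPset => x /=; rewrite !in_itv/= /r => /andP[h1 h2].
    by apply/andP; have := lle m n mn; split; lra.
  - by move=> n.
  - by move=> n; apply/measurable_EFinP; apply: measurable_funTS; exact: measurable_wker.
  - move=> n x /=; rewrite in_itv/= => /andP[h _]; rewrite lee_fin wker_ge0//.
    exact: lt_le_trans (l0 n) h.
  - suff : (\int[lebesgue_measure]_(x in `[l n, r n]) (wker k a tau x)%:E)%E @[n --> \oo] -->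
        (2 * mult k a tau)%:E by [].
    under eq_cvg do rewrite wker_itv//.
    apply: cvg_EFin; first exact: nearW.
    have cP : continuous (fun t => 2 * (expR (- (a * (tau - t))) * mult k a t)).
      move=> t; apply: cvgM; first exact: cvg_cst.
      apply: cvgM; last exact: continuous_mult.
      apply: (continuous_cvg _ (@continuous_expR R _)).
      by apply: cvgN; apply: cvgM; [exact: cvg_cst|apply: cvgB; [exact: cvg_cst|exact: cvg_id]].
    set P := (fun t => _) in cP.
    have -> : 2 * mult k a tau = P tau - P 0.
      by rewrite /P subrr !mulr0 oppr0 expR0 mul1r mult_0 !mulr0 subr0.
    exact: cvgB (continuous_cvg _ (cP tau) cr) (continuous_cvg _ (cP 0) cl).
split; last by rewrite /Rintegral E.
by apply: L1_lty => //; rewrite E ltry.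
Qed.

Lemma L2_gw (t : R) : 0 < t -> L2 (gw t).
Proof.
move=> t0; apply/L2P; split; first exact: measurable_gw.
apply: L1_le (L1_gw t0); first by apply: measurable_funX; exact: measurable_gw.
by move=> x; rewrite ger0_norm ?sqr_ge0// expr2 ler_piMr ?gw_ge0 ?gw_le1.
Qed.

Lemma L2_gauss (m t : R) : 0 < t -> L2 (normal_pdf m t).
Proof.
move=> t0; apply/L2P; split; first exact: measurable_normal_pdf.
apply: L1_le (L1Z (normal_peak t) (integrable_normal_pdf m t)).
  by apply: measurable_funX; exact: measurable_normal_pdf.
move=> x; rewrite ger0_norm ?sqr_ge0// expr2 ler_wpM2r ?normal_pdf_ge0//.
by apply: normal_pdf_ub; rewrite gt_eqF.
Qed.

(** Parseval's identity against the Gaussian, whose transform is explicit, takes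
    the place of the convolution theorem. *)
Lemma gauss_conv f u t y : 0 < t -> L2 f -> is_hartley f u ->
  \int[mu]_z (normal_pdf z t y * f z) =
  kappa * \int[mu]_xi (gw t xi * (cas (y * xi) * u xi)).
Proof.
move=> t0 f2 fu; have n2 := L2_gauss y t0.
have nh := is_hartley_hint (integrable_normal_pdf y t) n2.
transitivity (ip (normal_pdf y t) f).
  by apply: eq_Rint => z; rewrite gauss_sym.
rewrite -(is_hartley_parseval n2 f2 nh fu) /ip -RintZ; last first.
  apply: (L1_le _ _ (L1Z 2 (L1_norm (L2_mul (L2_gw t0) fu.1)))).
    apply: measurable_funM; first exact: measurable_gw.
    by apply: measurable_funM; [exact: measurable_casM|exact: L2_measurable fu.1].
  move=> x; rewrite mulrCA normrM; apply: ler_wpM2r => //; exact: norm_cas_le.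
by apply: eq_Rint => xi; rewrite hint_gauss// [xi * y]mulrC; ring.
Qed.

Lemma L1_wker_xi k tau theta h y : L2 h ->
  L1 (fun xi => oitv tau theta * wker k (freq xi) tau theta * (cas (y * xi) * h xi)).
Proof.
move=> h2; rewrite oitvE; case: ifPn => [/andP[t0 tt]|_]; last first.
  by under eq_fun do rewrite !mul0r; exact: integrable0.
have st : 0 < sigma * Num.sqrt (tau - theta) by rewrite mulr_gt0// sqrtr_gt0 subr_gt0.
have E xi : expR (- (freq xi * (tau - theta))) = gw (sigma * Num.sqrt (tau - theta)) xi.
  rewrite /gw exprMn sqr_sqrtr ?subr_ge0 ?(ltW tt)// /freq; congr expR; ring.
have i1 : L1 (fun xi => gw (sigma * Num.sqrt (tau - theta)) xi * h xi * cas (y * xi)).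
  exact: L1_cas (L2_mul (L2_gw st) h2).
have := L1Z (theta ^+ k / Num.sqrt theta) i1.
congr (lebesgue_measure.-integrable _ (_ \o _)); apply/funext => xi.
by rewrite /wker E; ring.
Qed.

(** Exchanging the integrals in time and frequency is legitimate because the
    integral in time is a multiplier in L^2, against [h] in L^2. *)
Lemma wker_fubini k tau h y : (k <= 1)%N -> 0 < tau -> L2 h ->
  L1 (fun theta => \int[mu]_xi
    (oitv tau theta * wker k (freq xi) tau theta * (cas (y * xi) * h xi))) /\
  \int[mu]_theta \int[mu]_xi
    (oitv tau theta * wker k (freq xi) tau theta * (cas (y * xi) * h xi)) =
  \int[mu]_xi (2 * mult k (freq xi) tau * (cas (y * xi) * h xi)).
Proof.
move=> k1 t0 h2; pose F xi theta :=
  oitv tau theta * wker k (freq xi) tau theta * (cas (y * xi) * h xi).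
have mF : measurable_fun setT (fun z : R * R => F z.1 z.2).
  apply: measurable_funM.
    apply: measurable_funM; first exact: (measurableT_comp (measurable_oitv tau)).
    exact: measurable_wker2.
  apply: measurable_funM; first exact: (measurableT_comp (measurable_casM y)).
  exact: (measurableT_comp (L2_measurable h2)).
have Fxi xi : L1 (F xi).
  have := L1Z (cas (y * xi) * h xi) (mult_integral k (freq xi) t0).1.
  by congr (lebesgue_measure.-integrable _ (_ \o _)); apply/funext => z; rewrite /F mulrC.
have FE xi : \int[mu]_theta F xi theta = 2 * mult k (freq xi) tau * (cas (y * xi) * h xi).
  have [i1 i2] := mult_integral k (freq xi) t0.
  rewrite -i2 mulrC -(RintZ _ i1); apply: eq_Rint => z; rewrite /F mulrC//.
have aF xi : \int[mu]_theta `|F xi theta| = 2 * mult k (freq xi) tau * `|cas (y * xi) * h xi|.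
  have [i1 i2] := mult_integral k (freq xi) t0.
  rewrite -i2 mulrC -(RintZ _ i1); apply: eq_Rint => z; rewrite /F normrM mulrC.
  congr (_ * _); rewrite ger0_norm// oitvE; case: ifP => [/andP[p _]|_]; last by rewrite mul0r.
  by rewrite mul1r wker_ge0.
have [|A B] := RFubini mF Fxi (fun theta => L1_wker_xi k tau theta y h2).
  apply: (L1_le _ _ (L1Z 4 (L1_norm (L2_mul (L2_mult k1 t0) h2)))).
    apply: (@measurable_Rintegral_snd _ (fun xi theta => `|F xi theta|)).
    exact: measurableT_comp.
  move=> xi; rewrite aF ger0_norm; last exact: mulr_ge0 (mulr_ge0 (ler0n _ 2) (mult_ge0 _ _ _)) (normr_ge0 _).
  rewrite (normrM (cas _)) (normrM (mult _ _ _)) (ger0_norm (mult_ge0 k (freq xi) tau)).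
  have := norm_cas_le (y * xi); have := mult_ge0 k (freq xi) tau; have := normr_ge0 (h xi).
  move: (mult _ _ _) `|h xi| `|cas _| => m q c q0 m0 c2.
  have := mulr_ge0 m0 q0; nra.
split; first exact: A.
by rewrite -B; apply: eq_Rint.
Qed.

Definition mcoef : R := s * kappa / sigma.

(** The transform of the solution, for sources with transforms [h0] and [h1]; the
    factor 2 compensates the halving in [mult]. *)
Definition solh (h0 h1 : R -> R) tau xi : R :=
  2 * mcoef * (mult 0 (freq xi) tau * h0 xi + mult 1 (freq xi) tau * h1 xi).

(** In space, the heat kernel acts on the source by [gauss_conv]; in time,
    [wker_fubini] integrates the resulting Gaussian weights to the multipliers. *)
Lemma duhamel_hint (f0 f1 h0 h1 : R -> R) tau y : 0 < tau ->
  L2 f0 -> L2 f1 -> is_hartley f0 h0 -> is_hartley f1 h1 ->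
  duhamel sigma (source s sigma f0 f1) tau y = hint (solh h0 h1 tau) y.
Proof.
move=> t0 f02 f12 fh0 fh1.
have [A0 B0] := wker_fubini y (leq0n 1) t0 fh0.1.
have [A1 B1] := wker_fubini y (leqnn 1) t0 fh1.1.
have inner theta : oitv tau theta * \int[mu]_z
    (normal_pdf z (sigma * Num.sqrt (tau - theta)) y * source s sigma f0 f1 theta z) =
    mcoef * kappa * (\int[mu]_xi (oitv tau theta * wker 0 (freq xi) tau theta * (cas (y * xi) * h0 xi))
     + \int[mu]_xi (oitv tau theta * wker 1 (freq xi) tau theta * (cas (y * xi) * h1 xi))).
  rewrite oitvE; case: ifPn => [/andP[th0 tht]|_]; last first.
    rewrite mul0r; under eq_Rintegral do rewrite !mul0r.
    under [X in _ + X]eq_Rintegral do rewrite !mul0r.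
    by rewrite Rintegral_cst// mul0r addr0 mulr0.
  have st : 0 < sigma * Num.sqrt (tau - theta) by rewrite mulr_gt0// sqrtr_gt0 subr_gt0.
  have sth : 0 < Num.sqrt theta by rewrite sqrtr_gt0.
  have E xi : expR (- (freq xi * (tau - theta))) = gw (sigma * Num.sqrt (tau - theta)) xi.
    rewrite /gw exprMn sqr_sqrtr ?subr_ge0 ?(ltW tht)// /freq; congr expR; ring.
  have cE : s / (Num.sqrt (2 * pi * theta) * sigma) = mcoef / Num.sqrt theta.
    rewrite sqrtrM ?mulr_ge0 ?pi_ge0// /mcoef /kappa.
    have : Num.sqrt (2 * pi) != 0 :> R by rewrite gt_eqF// sqrtr_gt0 mulr_gt0// pi_gt0.
    by move=> ?; rewrite !invfM; ring.
  have n2 : L2 (fun z => normal_pdf z (sigma * Num.sqrt (tau - theta)) y).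
    have := L2_gauss y st; congr L2; apply/funext => z; exact: gauss_sym.
  have i0 := L2_mul n2 f02; have i1 := L2_mul n2 f12.
  have j0 := L1_wker_xi 0 tau theta y fh0.1; have j1 := L1_wker_xi 1 tau theta y fh1.1.
  rewrite mul1r (eq_Rint (g := fun z => mcoef / Num.sqrt theta *
    (normal_pdf z (sigma * Num.sqrt (tau - theta)) y * f0 z + theta *
     (normal_pdf z (sigma * Num.sqrt (tau - theta)) y * f1 z)))); last first.
    by move=> z; rewrite /source cE; ring.
  rewrite (RintZ _ (L1D i0 (L1Z theta i1))) (RintD i0 (L1Z theta i1)) (RintZ _ i1).
  rewrite (gauss_conv y st f02 fh0) (gauss_conv y st f12 fh1).
  have g k h : L2 h -> \int[mu]_xi (1 * wker k (freq xi) tau theta * (cas (y * xi) * h xi)) =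
      theta ^+ k / Num.sqrt theta *
      \int[mu]_xi (gw (sigma * Num.sqrt (tau - theta)) xi * (cas (y * xi) * h xi)).
    move=> h2; rewrite -RintZ; last first.
      have := L1_cas y (L2_mul (L2_gw st) h2).
      congr (lebesgue_measure.-integrable _ (_ \o _)); apply/funext => xi; ring.
    by apply: eq_Rint => xi; rewrite /wker E; ring.
  rewrite (g 0 _ fh0.1) (g 1 _ fh1.1) expr0 expr1; ring.
rewrite /duhamel Rintegral_oitv (eq_Rint inner) (RintZ _ (L1D A0 A1)) (RintD A0 A1) B0 B1.
have C k h : (k <= 1)%N -> L2 h -> L1 (fun xi => 2 * mult k (freq xi) tau * (cas (y * xi) * h xi)).
  move=> k1 h2; have := L1Z 2 (L1_cas y (L2_mul (L2_mult k1 t0) h2)).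
  by congr (lebesgue_measure.-integrable _ (_ \o _)); apply/funext => xi; ring.
have C0 := C 0 h0 (leq0n 1) fh0.1; have C1 := C 1 h1 (leqnn 1) fh1.1.
rewrite -(RintD C0 C1) [mcoef * kappa]mulrC -mulrA -(RintZ _ (L1D C0 C1)).
by rewrite /hint; congr (_ * _); apply: eq_Rint => xi; rewrite /solh; ring.
Qed.

(** * The Cauchy problem *)

Lemma mcoef_gt0 : 0 < mcoef.
Proof. by rewrite divr_gt0// mulr_gt0// kappa_gt0. Qed.

Lemma source_coef tau : 0 < tau ->
  s / (Num.sqrt (2 * pi * tau) * sigma) = mcoef / Num.sqrt tau.
Proof.
move=> t0; rewrite sqrtrM ?mulr_ge0 ?pi_ge0// /mcoef /kappa.
by rewrite !invfM; ring.
Qed.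

(** The solution of the ODE for one frequency, with the transforms of the two
    source terms as parameters; it serves for real parts, imaginary parts and
    Hartley transforms alike. *)
Definition evol a (r0 r1 tau : R) : R :=
  2 * mcoef * (mult 0 a tau * r0 + mult 1 a tau * r1).

Lemma solhE h0 h1 tau xi : solh h0 h1 tau xi = evol (freq xi) (h0 xi) (h1 xi) tau.
Proof. by []. Qed.

Lemma evol_0 a r0 r1 : evol a r0 r1 0 = 0.
Proof. by rewrite /evol !mult_0 !mul0r addr0 mulr0. Qed.

Lemma continuous_evol a r0 r1 : continuous (evol a r0 r1).
Proof.
move=> t; apply: cvgM; first exact: cvg_cst.
by apply: cvgD; apply: cvgM; [exact: continuous_mult|exact: cvg_cst|
  exact: continuous_mult|exact: cvg_cst].
Qed.

Lemma is_derive_evol a (r0 r1 tau : R) : 0 < tau ->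
  is_derive tau 1 (evol a r0 r1) (- a * evol a r0 r1 tau +
    s / (Num.sqrt (2 * pi * tau) * sigma) * (r0 + tau * r1)).
Proof.
move=> t0; rewrite (source_coef t0).
have d k r : is_derive tau 1 (fun t : R => mult k a t * r)
    ((- (a * mult k a tau) + tau ^+ k / (2 * Num.sqrt tau)) * r).
  rewrite (_ : (fun t => _) = fun t => r * mult k a t); last first.
    by apply/funext => t; rewrite mulrC.
  by apply: (is_derive_cast (is_deriveZr r (is_derive_mult k a t0))); rewrite mulrC.
apply: (is_derive_cast (is_deriveZr (2 * mcoef) (is_deriveDr (d 0 r0) (d 1 r1)))).
rewrite /evol; field; by rewrite gt_eqF// sqrtr_gt0.
Qed.

(** The integrating factor exp(a t) makes the difference of two solutions
    constant on the open interval, and continuity carries this to both ends. *)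
Lemma evol_uniq a (r0 r1 T : R) (w : R -> R) : w 0 = 0 ->
  {within `[0, T], continuous w} ->
  (forall tau, 0 < tau < T -> is_derive tau 1 w (- a * w tau +
    s / (Num.sqrt (2 * pi * tau) * sigma) * (r0 + tau * r1))) ->
  forall tau, 0 <= tau <= T -> w tau = evol a r0 r1 tau.
Proof.
move=> w0 cw dw tau /andP[tau0 tauT].
pose g t : R := expR (a * t) * (w t - evol a r0 r1 t).
have dg t : t \in `]0, tau[ -> is_derive t 1 g ((fun=> 0) t).
  rewrite in_itv/= => /andP[t0 tt].
  have tT : 0 < t < T by rewrite t0 (lt_le_trans tt).
  have d1 := is_derive_compr (is_derive_expR (a * t)) (is_deriveZr a (is_derive_id t 1)).
  apply: (is_derive_cast (is_deriveMr d1 (is_deriveBr (dw t tT) (is_derive_evol a r0 r1 t0)))).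
  by ring.
have cg : {within `[0, tau], continuous g}.
  have sub : `[0, tau]%classic `<=` `[0, T]%classic.
    move=> t /=; rewrite !in_itv/= => /andP[-> h]; exact: le_trans h tauT.
  move=> t; apply: cvgM.
    apply: continuous_subspaceT => z.
    apply: (continuous_cvg _ (@continuous_expR R _)).
    by apply: cvgM; [exact: cvg_cst|exact: cvg_id].
  apply: cvgB; first exact: continuous_subspaceW sub cw t.
  by apply: continuous_subspaceT; exact: continuous_evol.
move: tau0; rewrite le_eqVlt => /predU1P[<-|tau0]; first by rewrite w0 evol_0.
have [c _] := MVT tau0 dg cg; rewrite mul0r => /eqP.
rewrite subr_eq0 {2}/g w0 evol_0 subrr mulr0 /g mulf_eq0 gt_eqF ?expR_gt0//=.
by rewrite subr_eq0 => /eqP.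
Qed.

Lemma mult_bound k a tau : (k <= 1)%N -> 0 <= a -> 0 <= tau ->
  `|mult k a tau| <= (1 + tau) * Num.sqrt tau.
Proof.
move=> k1 a0 t0; rewrite ger0_norm ?mult_ge0//.
have m0 := mult0_le a0 t0; have st := sqrtr_ge0 tau.
case: k k1 => [|[|//]] _; first by move: m0 st; clear -t0; move: (mult _ _ _) => q; nra.
apply: (le_trans (mult1_le _ t0)).
by move: m0 st; clear -t0; move: (mult _ _ _) => q; nra.
Qed.

Lemma L2_solh h0 h1 tau : 0 <= tau -> L2 h0 -> L2 h1 -> L2 (solh h0 h1 tau).
Proof.
move=> t0 h02 h12; apply: L2Z; apply: L2D.
  apply: L2_mulb h02; first exact: measurable_mult.
  by move=> xi; apply: mult_bound t0 => //; exact: freq_ge0.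
apply: L2_mulb h12; first exact: measurable_mult.
by move=> xi; apply: mult_bound t0 => //; exact: freq_ge0.
Qed.

Lemma solh_0 h0 h1 : solh h0 h1 0 = fun=> 0.
Proof. by apply/funext => xi; rewrite solhE evol_0. Qed.

Lemma L1_solh h0 h1 tau : 0 <= tau -> L2 h0 -> L2 h1 -> L1 (solh h0 h1 tau).
Proof.
rewrite le_eqVlt => /predU1P[<-|t0] h02 h12.
  by rewrite solh_0; exact: integrable0.
apply: L1Z; apply: L1D; apply: L2_mul => //; exact: L2_mult.
Qed.

(** At positive times its values are those of Duhamel's formula, at every point. *)
Definition sol h0 h1 tau : R -> R := hint (solh h0 h1 tau).

Lemma is_hartley_sol h0 h1 tau : 0 <= tau -> L2 h0 -> L2 h1 ->
  is_hartley (sol h0 h1 tau) (solh h0 h1 tau).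
Proof.
move=> t0 h02 h12; have s2 := L2_solh t0 h02 h12.
exact: (is_hartleyK s2 (is_hartley_hint (L1_solh t0 h02 h12) s2)).
Qed.

Lemma L2_sol h0 h1 tau : 0 <= tau -> L2 h0 -> L2 h1 -> L2 (sol h0 h1 tau).
Proof.
move=> t0 h02 h12.
by have [] := is_hartley_hint (L1_solh t0 h02 h12) (L2_solh t0 h02 h12).
Qed.

(** The modulus of continuity [mult_lip] is the same for all frequencies, so it
    passes to the L^2 norm by Parseval's identity. *)
Lemma sqn_sol_le h0 h1 T : 0 <= T -> L2 h0 -> L2 h1 ->
  exists2 D, 0 <= D & forall t tau, 0 <= t <= T -> 0 <= tau <= T ->
    sqn (fun y => sol h0 h1 t y - sol h0 h1 tau y) <= D * (Num.sqrt t - Num.sqrt tau) ^+ 2.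
Proof.
move=> T0 h02 h12; pose c := 2 * mcoef * (1 + T).
exists (2 * c ^+ 2 * (sqn h0 + sqn h1)).
  by rewrite mulr_ge0 ?addr_ge0 ?sqn_ge0// mulr_ge0 ?sqr_ge0.
move=> t tau /andP[t0 tT] /andP[u0 uT].
have st := L2_sol t0 h02 h12; have su := L2_sol u0 h02 h12.
have ht := is_hartley_sol t0 h02 h12; have hu := is_hartley_sol u0 h02 h12.
have hB := is_hartleyB st su ht hu.
rewrite -(is_hartley_sqn (L2B st su) hB); set d := Num.sqrt t - Num.sqrt tau.
have E : L1 (fun xi => 2 * c ^+ 2 * d ^+ 2 * (h0 xi ^+ 2 + h1 xi ^+ 2)).
  by apply: L1Z; apply: L1D; exact: L2_sqr.
have -> : 2 * c ^+ 2 * (sqn h0 + sqn h1) * d ^+ 2 =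
    \int[mu]_xi (2 * c ^+ 2 * d ^+ 2 * (h0 xi ^+ 2 + h1 xi ^+ 2)).
  rewrite (RintZ _ (L1D (L2_sqr h02) (L2_sqr h12))) (RintD (L2_sqr h02) (L2_sqr h12)).
  by rewrite /sqn; ring.
apply: (Rint_le (L2_sqr hB.1) E) => xi.
have lip k : (k <= 1)%N -> (mult k (freq xi) t - mult k (freq xi) tau) ^+ 2 <= (1 + T) ^+ 2 * d ^+ 2.
  move=> k1; rewrite -exprMn -real_normK ?num_real// -[leRHS]real_normK ?num_real//.
  have a0 := freq_ge0 xi; have T1 : 1 <= 1 + T by rewrite lerDl.
  have tT' : t <= 1 + T by apply: le_trans tT _; rewrite lerDr.
  have uT' : tau <= 1 + T by apply: le_trans uT _; rewrite lerDr.
  rewrite lerXn2r ?nnegrE ?normr_ge0// normrM (ger0_norm (le_trans ler01 T1)).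
  have [tu|ut] := leP t tau.
    rewrite distrC [`|d|]distrC (ger0_norm (_ : 0 <= Num.sqrt tau - Num.sqrt t)).
      exact: mult_lip.
    by rewrite subr_ge0 ler_wsqrtr.
  rewrite (ger0_norm (_ : 0 <= d)); first exact: mult_lip (ltW ut) tT'.
  by rewrite subr_ge0 ler_wsqrtr// ltW.
have l0 := lip 0 isT; have l1 := lip 1 isT; rewrite /solh.
set m0 := mult 0 _ t in l0 *; set n0 := mult 0 _ tau in l0 *.
set m1 := mult 1 _ t in l1 *; set n1 := mult 1 _ tau in l1 *.
rewrite (_ : _ - _ = 2 * mcoef * ((m0 - n0) * h0 xi + (m1 - n1) * h1 xi)); last by ring.
rewrite [leLHS]exprMn; set e := (2 * mcoef) ^+ 2.
have e0 : 0 <= e by exact: sqr_ge0.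
rewrite [leRHS](_ : _ = e * (2 * ((1 + T) ^+ 2 * d ^+ 2 * h0 xi ^+ 2 +
  (1 + T) ^+ 2 * d ^+ 2 * h1 xi ^+ 2))); last by rewrite /e /c; ring.
apply: ler_wpM2l => //.
have q0 := ler_wpM2r (sqr_ge0 (h0 xi)) l0; have q1 := ler_wpM2r (sqr_ge0 (h1 xi)) l1.
have := sqr_ge0 ((m0 - n0) * h0 xi - (m1 - n1) * h1 xi).
move: q0 q1; rewrite -!exprMn; clear.
move: ((m0 - n0) * h0 xi) ((m1 - n1) * h1 xi) ((1 + T) * d * h0 xi) ((1 + T) * d * h1 xi).
by move=> x y A B; rewrite !expr2; nra.
Qed.

Lemma continuous_sol h0 h1 T tau : L2 h0 -> L2 h1 -> 0 <= tau <= T ->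
  'N[mu]_2%:E[EFin \o (sol h0 h1 t \- sol h0 h1 tau)%R]%E
      @[t --> within `[0, T] (nbhs tau)] --> 0%E.
Proof.
move=> h02 h12 tT; have T0 : 0 <= T by case/andP: tT; exact: le_trans.
have [D D0 HD] := sqn_sol_le T0 h02 h12.
have [/andP[u0 _]] := tT.
have cb : (Num.sqrt D * `|Num.sqrt t - Num.sqrt tau|)%:E
    @[t --> within `[0, T] (nbhs tau)] --> 0%E.
  apply: cvg_EFin; first exact: nearW.
  rewrite [X in _ --> X](_ : _ = Num.sqrt D * `|Num.sqrt tau - Num.sqrt tau|); last first.
    by rewrite subrr normr0 mulr0.
  apply: cvg_within_filter; apply: cvgM; first exact: cvg_cst.
  apply: cvg_norm; apply: cvgB; last exact: cvg_cst.
  exact: sqrt_continuous.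
apply: (squeeze_cvge _ _ cb); last exact: cvg_cst.
near=> t.
have tT' : 0 <= t <= T by near: t; apply: withinT => //; exact: nbhs_filter.
have [/andP[t0 _]] := tT'.
rewrite Lnorm2E; last exact: L2B (L2_sol t0 h02 h12) (L2_sol u0 h02 h12).
rewrite !lee_fin sqrtr_ge0/= -sqrtr_sqr -sqrtrM// ler_wsqrtr//.
exact: HD.
Unshelve. all: by end_near. Qed.

(** The rate [freq] is even, so the multipliers act on even and odd parts
    separately; this is why they act alike on both transforms. *)
Lemma evenp_solh h0 h1 tau xi :
  evenp (solh h0 h1 tau) xi = evol (freq xi) (evenp h0 xi) (evenp h1 xi) tau.
Proof. by rewrite /evenp !solhE freqN /evol; field. Qed.

Lemma oddp_solh h0 h1 tau xi :
  oddp (solh h0 h1 tau) xi = evol (freq xi) (oddp h0 xi) (oddp h1 xi) tau.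
Proof. by rewrite /oddp !solhE freqN /evol; field. Qed.

Lemma evolN a r0 r1 tau : evol a (- r0) (- r1) tau = - evol a r0 r1 tau.
Proof. by rewrite /evol; ring. Qed.

Lemma evolB a (r0 r1 q0 q1 tau : R) :
  evol a r0 r1 tau - evol a q0 q1 tau = evol a (r0 - q0) (r1 - q1) tau.
Proof. by rewrite /evol; ring. Qed.

Lemma cauchy_solution_sol f0 f1 T : L2 f0 -> L2 f1 ->
  cauchy_solution s sigma T f0 f1 (sol (hart f0) (hart f1)).
Proof.
move=> f02 f12; have h02 := L2_hart f02; have h12 := L2_hart f12; split.
- by move=> tau /andP[t0 _]; exact: L2_sol.
- by move=> tau tT; exact: continuous_sol.
- apply/ae_eqE; apply: aeW => y; rewrite /sol solh_0 /hint.
  by under eq_Rintegral do rewrite mul0r; rewrite Rintegral_cst// mul0r mulr0.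
- move=> tau /andP[t0 _]; apply/ae_eqE; apply: aeW => y.
  by rewrite (duhamel_hint _ t0 f02 f12 (is_hartley_hart f02) (is_hartley_hart f12)).
- (* At each frequency this representative is a solution of the equation. *)
  exists (fun tau xi => evol (freq xi) (Re (fourier f0 xi)) (Re (fourier f1 xi)) tau +i*
    evol (freq xi) (Im (fourier f0 xi)) (Im (fourier f1 xi)) tau); split.
    move=> tau /andP[t0 _].
    have /ae_eqE E := fourier_hat (L2_sol t0 h02 h12) (is_hartley_sol t0 h02 h12).
    have /ae_eqE E0 := fourier_hat f02 (is_hartley_hart f02).
    have /ae_eqE E1 := fourier_hat f12 (is_hartley_hart f12).
    apply/ae_eqE; have := aeI E (aeI E0 E1); apply: aeS => xi [-> [-> ->]].
    apply: eq_ReIm; rewrite /= ?Re_hat ?Im_hat.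
      by rewrite evenp_solh.
    by rewrite oddp_solh evolN.
  apply: aeW => xi; split.
  + by rewrite /= !evol_0.
  + by apply: continuous_subspaceT; exact: continuous_evol.
  + by apply: continuous_subspaceT; exact: continuous_evol.
  + move=> tau /andP[t0 _] rhs; split.
      apply: (is_derive_cast (is_derive_evol _ _ _ t0)).
      by rewrite /rhs ReD !ReZ ReD ReZ.
    apply: (is_derive_cast (is_derive_evol _ _ _ t0)).
    by rewrite /rhs ImD !ImZ ImD ImZ.
Qed.

(** The transformed equation alone determines the transform of a solution. *)
Lemma cauchy_solution_hart f0 f1 T W tau : cauchy_solution s sigma T f0 f1 W ->
  0 <= tau <= T -> hart (W tau) = solh (hart f0) (hart f1) tau %[ae mu].
Proof.
move=> [_ _ _ _ [What [eW eqW]]] tT; apply/ae_eqE.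
have /ae_eqE e := eW _ tT.
have := aeI e eqW; apply: aeS => xi [E [w0 cRe cIm dw]].
have ReE : Re (What tau xi) = evol (freq xi) (Re (fourier f0 xi)) (Re (fourier f1 xi)) tau.
  apply: (evol_uniq (T := T) (w := fun t => Re (What t xi))) => //; first by rewrite w0.
  move=> t tt; have [d _] := dw t tt; apply: (is_derive_cast d).
  by rewrite ReD !ReZ ReD ReZ.
have ImE : Im (What tau xi) = evol (freq xi) (Im (fourier f0 xi)) (Im (fourier f1 xi)) tau.
  apply: (evol_uniq (T := T) (w := fun t => Im (What t xi))) => //; first by rewrite w0.
  move=> t tt; have [_ d] := dw t tt; apply: (is_derive_cast d).
  by rewrite ImD !ImZ ImD ImZ.
have -> : hart (W tau) xi = Re (What tau xi) - Im (What tau xi) by rewrite /hart E.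
by rewrite ReE ImE evolB.
Qed.

(** * Inversion of the system at two times *)

(* Unification may otherwise unfold the integrals at two different times. *)
Local Opaque mult hart.

Variables t1 t2 : R.
Hypotheses (t1_gt0 : 0 < t1) (t12 : t1 < t2).

Let t2_gt0 : 0 < t2. Proof. exact: lt_trans t12. Qed.

(** Cramer's rule for the system [evol a r0 r1 t1 = w1], [evol a r0 r1 t2 = w2]. *)
Definition det a : R := mult 0 a t1 * mult 1 a t2 - mult 0 a t2 * mult 1 a t1.

Definition inv0 a (w1 w2 : R) : R :=
  (mult 1 a t2 * w1 - mult 1 a t1 * w2) / (2 * mcoef * det a).

Definition inv1 a (w1 w2 : R) : R :=
  (mult 0 a t1 * w2 - mult 0 a t2 * w1) / (2 * mcoef * det a).

Lemma mult0_gt0 a t : 0 <= a -> 0 < t -> 0 < mult 0 a t.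
Proof.
move=> a0 t0; rewrite lt0r mult_ge0 andbT; apply/negP => /eqP m0.
by have := mult0_ge a0 (ltW t0); rewrite m0 mulr0 leNgt sqrtr_gt0 t0.
Qed.

Lemma sgap_gt0 : 0 < gap (Num.sqrt t1) (Num.sqrt t2).
Proof. by apply: gap_gt0; rewrite ?sqrtr_gt0// ltr_sqrt. Qed.

Lemma det_gt0 a : 0 <= a -> 0 < det a.
Proof.
move=> a0; apply: lt_le_trans (mult_det a0 t1_gt0 (ltW t12)).
by apply: mulr_gt0; [exact: sgap_gt0|apply: mulr_gt0; exact: mult0_gt0].
Qed.

Lemma cramer (c p1 p2 q1 q2 : R) : c != 0 -> p1 * q2 - p2 * q1 != 0 -> forall x y : R,
  let e1 := c * (p1 * x + q1 * y) in let e2 := c * (p2 * x + q2 * y) in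
  (q2 * e1 - q1 * e2) / (c * (p1 * q2 - p2 * q1)) = x /\
  (p1 * e2 - p2 * e1) / (c * (p1 * q2 - p2 * q1)) = y.
Proof. by move=> c0 d0 x y /=; split; field; apply/andP. Qed.

Lemma cramer_inv (c p1 p2 q1 q2 : R) : c != 0 -> p1 * q2 - p2 * q1 != 0 -> forall x y : R,
  let r0 := (q2 * x - q1 * y) / (c * (p1 * q2 - p2 * q1)) in
  let r1 := (p1 * y - p2 * x) / (c * (p1 * q2 - p2 * q1)) in
  c * (p1 * r0 + q1 * r1) = x /\ c * (p2 * r0 + q2 * r1) = y.
Proof. by move=> c0 d0 x y /=; split; field; apply/andP. Qed.

Lemma mcoef2_neq0 : 2 * mcoef != 0.
Proof. by rewrite gt_eqF// mulr_gt0// mcoef_gt0. Qed.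

Lemma inv_evol a (r0 r1 : R) : 0 <= a ->
  inv0 a (evol a r0 r1 t1) (evol a r0 r1 t2) = r0 /\
  inv1 a (evol a r0 r1 t1) (evol a r0 r1 t2) = r1.
Proof. by move=> a0; apply: cramer; [exact: mcoef2_neq0|rewrite gt_eqF// det_gt0]. Qed.

Lemma evol_inv a (w1 w2 : R) : 0 <= a ->
  evol a (inv0 a w1 w2) (inv1 a w1 w2) t1 = w1 /\
  evol a (inv0 a w1 w2) (inv1 a w1 w2) t2 = w2.
Proof. by move=> a0; apply: cramer_inv; [exact: mcoef2_neq0|rewrite gt_eqF// det_gt0]. Qed.

(** An entry [c] of the matrix over its determinant [m * D]: in the lower bound of
    [D] the factor [A'] cancels [c], and the inverse of [A] remains. *)
Lemma quotient_le (c A A' g D K T j m : R) : 0 < A -> 0 < A' -> 0 < g -> 0 < m ->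
  0 <= T -> A^-1 <= K * j -> c <= T * A' -> g * (A * A') <= D ->
  c / (m * D) <= T * K / g / m * j.
Proof.
move=> A0 A'0 g0 m0 T0 AK cT gD.
have D0 : 0 < D by apply: lt_le_trans gD; rewrite !mulr_gt0.
have K0 : 0 <= K * j by apply: le_trans AK; rewrite invr_ge0 ltW.
rewrite ler_pdivrMr ?mulr_gt0//; apply: (le_trans cT).
have -> : T * K / g / m * j * (m * D) = T * (K * j / g * D) by field; rewrite !gt_eqF.
apply: ler_wpM2l => //.
have -> : A' = A^-1 / g * (g * (A * A')) by field; rewrite !gt_eqF.
apply: ler_pM => //; first by rewrite divr_ge0 ?invr_ge0// ltW.
  by rewrite ltW// !mulr_gt0.
by apply: ler_wpM2r => //; rewrite invr_ge0 ltW.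
Qed.

Lemma quotientB_le (p q D L j : R) : 0 <= p -> 0 <= q -> 0 < D -> p / D <= L * j ->
  q / D <= L * j -> forall x y : R,
  `|(p * x - q * y) / D| <= L * (j * `|x| + j * `|y|).
Proof.
move=> p0 q0 D0 hp hq x y.
have pe : `|p / D * x| <= L * j * `|x|.
  by rewrite normrM ger0_norm ?divr_ge0 ?(ltW D0)//; exact: ler_wpM2r.
have qe : `|q / D * y| <= L * j * `|y|.
  by rewrite normrM ger0_norm ?divr_ge0 ?(ltW D0)//; exact: ler_wpM2r.
rewrite (_ : (p * x - q * y) / D = p / D * x - q / D * y); last by rewrite mulrBl; ring.
apply: (le_trans (ler_normB _ _)); apply: (le_trans (lerD pe qe)).
by rewrite mulrDr !mulrA.
Qed.

(** The determinant is at least a constant multiple of the product of the values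
    of [mult 0] at the two times, each of which decays no faster than the inverse
    square of the frequency: inverting the system costs two derivatives. *)
Lemma inv_le : exists2 M, 0 <= M & forall (xi w1 w2 : R),
  `|inv0 (freq xi) w1 w2| <= M * (jap xi * `|w1| + jap xi * `|w2|) /\
  `|inv1 (freq xi) w1 w2| <= M * (jap xi * `|w1| + jap xi * `|w2|).
Proof.
pose g := gap (Num.sqrt t1) (Num.sqrt t2).
have g0 : 0 < g := sgap_gt0.
have m0 : 0 < 2 * mcoef by apply: mulr_gt0 => //; exact: mcoef_gt0.
pose N t := (1 + sigma ^+ 2 * t) / Num.sqrt t.
have N0 t : 0 < t -> 0 <= N t.
  by move=> t0; rewrite divr_ge0 ?sqrtr_ge0// addr_ge0// mulr_ge0 ?sqr_ge0// ltW.
have mN t xi : 0 < t -> (mult 0 (freq xi) t)^-1 <= N t * jap xi.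
  move=> t0; have m00 := mult0_gt0 (freq_ge0 xi) t0.
  have st : 0 < Num.sqrt t by rewrite sqrtr_gt0.
  have -> : N t * jap xi = (1 + sigma ^+ 2 * t) * jap xi / Num.sqrt t by rewrite /N mulrAC.
  rewrite -[leLHS]mul1r ler_pdivrMr// mulrAC ler_pdivlMr// mul1r.
  apply: (le_trans (mult0_ge (freq_ge0 xi) (ltW t0))).
  apply: ler_wpM2r; first exact: ltW.
  rewrite /freq /jap; have := sqr_ge0 xi; have := sqr_ge0 sigma.
  by move: (sigma ^+ 2) (xi ^+ 2) => p q p0 q0; have := mulr_ge0 p0 (ltW t0); nra.
pose L := (1 + t2) * (N t1 + N t2) / g / (2 * mcoef).
have T0 : 0 <= 1 + t2 by rewrite addr_ge0// ltW.
have N1 := N0 _ t1_gt0; have N2 := N0 _ t2_gt0.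
have L0 : 0 <= L.
  apply: divr_ge0; last exact: ltW.
  apply: divr_ge0; last exact: ltW.
  by apply: mulr_ge0 => //; exact: addr_ge0.
exists L => // xi w1 w2; set a := freq xi; have a0 : 0 <= a := freq_ge0 xi.
have d0 := det_gt0 a0; have A1 := mult0_gt0 a0 t1_gt0; have A2 := mult0_gt0 a0 t2_gt0.
have dd : g * (mult 0 a t1 * mult 0 a t2) <= det a := mult_det a0 t1_gt0 (ltW t12).
have dd' : g * (mult 0 a t2 * mult 0 a t1) <= det a by rewrite [X in _ * X]mulrC.
have j0 : 0 <= jap xi := le_trans ler01 (jap_ge1 xi).
have NL1 : (mult 0 a t1)^-1 <= (N t1 + N t2) * jap xi.
  by apply: (le_trans (mN t1 xi t1_gt0)); apply: ler_wpM2r => //; rewrite lerDl.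
have NL2 : (mult 0 a t2)^-1 <= (N t1 + N t2) * jap xi.
  by apply: (le_trans (mN t2 xi t2_gt0)); apply: ler_wpM2r => //; rewrite lerDr.
have b0 t : mult 0 a t <= (1 + t2) * mult 0 a t.
  by rewrite ler_peMl ?mult_ge0// lerDl ltW.
have b1 t : 0 < t -> t <= t2 -> mult 1 a t <= (1 + t2) * mult 0 a t.
  move=> tt tt2; apply: (le_trans (mult1_le _ (ltW tt))).
  by apply: ler_wpM2r; [exact: mult_ge0|apply: le_trans tt2 _; rewrite lerDr].
have k1 := quotient_le A1 A2 g0 m0 T0 NL1 (b1 _ t2_gt0 (lexx _)) dd.
have k2 := quotient_le A2 A1 g0 m0 T0 NL2 (b1 _ t1_gt0 (ltW t12)) dd'.
have k3 := quotient_le A1 A2 g0 m0 T0 NL1 (b0 t2) dd.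
have k4 := quotient_le A2 A1 g0 m0 T0 NL2 (b0 t1) dd'.
have D0 : 0 < 2 * mcoef * det a by exact: mulr_gt0.
split; first exact: (quotientB_le (mult_ge0 1 a t2) (mult_ge0 1 a t1) D0 k1 k2 w1 w2).
by rewrite addrC; exact: (quotientB_le (mult_ge0 0 a t1) (mult_ge0 0 a t2) D0 k4 k3 w2 w1).
Qed.

Lemma measurable_inv f h : measurable_fun setT f -> measurable_fun setT h ->
  measurable_fun setT (fun xi => inv0 (freq xi) (f xi) (h xi)) /\
  measurable_fun setT (fun xi => inv1 (freq xi) (f xi) (h xi)).
Proof.
move=> mf mh.
have m k t : measurable_fun setT (fun xi => mult k (freq xi) t) by exact: measurable_mult.
have mdet : measurable_fun setT (fun xi => (2 * mcoef * det (freq xi))^-1).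
  have e xi : (2 * mcoef * det (freq xi))^-1 = (2 * mcoef * det (freq xi)) `^ (-1).
    rewrite powR_inv1// ltW//.
    apply: mulr_gt0; last by apply: det_gt0; exact: freq_ge0.
    by apply: mulr_gt0 => //; exact: mcoef_gt0.
  under eq_fun do rewrite e.
  apply: (measurableT_comp (measurable_powR (-1))).
  by apply: measurable_funM => //; apply: measurable_funB; apply: measurable_funM.
by split; apply: measurable_funM => //; apply: measurable_funB; apply: measurable_funM.
Qed.

(** The estimate for Hartley transforms; it also shows that the inverted data are
    transforms of square-integrable functions. *)
Lemma L2_inv : exists2 M, 0 <= M & forall w1 w2,
  measurable_fun setT w1 -> measurable_fun setT w2 ->
  L2 (fun xi => jap xi * w1 xi) -> L2 (fun xi => jap xi * w2 xi) ->
  let B := M * (sqn (fun xi => jap xi * w1 xi) + sqn (fun xi => jap xi * w2 xi)) in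
  let h0 xi := inv0 (freq xi) (w1 xi) (w2 xi) in
  let h1 xi := inv1 (freq xi) (w1 xi) (w2 xi) in
  [/\ L2 h0, L2 h1, sqn h0 <= B & sqn h1 <= B].
Proof.
have [M M0 HM] := inv_le; exists (2 * M ^+ 2); first by rewrite mulr_ge0// sqr_ge0.
move=> w1 w2 mw1 mw2 j1 j2 B h0 h1; have [mh0 mh1] := measurable_inv mw1 mw2.
have i1 := L2_sqr j1; have i2 := L2_sqr j2; have i := L1Z (2 * M ^+ 2) (L1D i1 i2).
have bE : B = \int[mu]_xi (2 * M ^+ 2 * ((jap xi * w1 xi) ^+ 2 + (jap xi * w2 xi) ^+ 2)).
  by rewrite (RintZ _ (L1D i1 i2)) (RintD i1 i2).
have le (h : R -> R) xi : `|h xi| <= M * (jap xi * `|w1 xi| + jap xi * `|w2 xi|) ->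
    h xi ^+ 2 <= 2 * M ^+ 2 * ((jap xi * w1 xi) ^+ 2 + (jap xi * w2 xi) ^+ 2).
  move=> hx; have j0 : 0 <= jap xi := le_trans ler01 (jap_ge1 xi).
  rewrite -[leLHS]real_normK ?num_real//.
  apply: (@le_trans _ _ ((M * (jap xi * `|w1 xi| + jap xi * `|w2 xi|)) ^+ 2)).
    by rewrite lerXn2r ?nnegrE// (le_trans _ hx).
  have -> : 2 * M ^+ 2 * ((jap xi * w1 xi) ^+ 2 + (jap xi * w2 xi) ^+ 2) =
      M ^+ 2 * (2 * ((jap xi * w1 xi) ^+ 2 + (jap xi * w2 xi) ^+ 2)) by ring.
  rewrite [leLHS]exprMn; apply: ler_wpM2l; first exact: sqr_ge0.
  rewrite -[(_ * w1 xi) ^+ 2]real_normK ?num_real// -[(_ * w2 xi) ^+ 2]real_normK ?num_real//.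
  rewrite !normrM (ger0_norm j0); move: (jap xi * `|w1 xi|) (jap xi * `|w2 xi|) => x y.
  by rewrite !expr2; have := sqr_ge0 (x - y); rewrite expr2; nra.
have gen (h : R -> R) : measurable_fun setT h ->
    (forall xi, `|h xi| <= M * (jap xi * `|w1 xi| + jap xi * `|w2 xi|)) ->
    L2 h /\ sqn h <= B.
  move=> mh hM; have h2 : L2 h.
    apply/L2P; split=> //; apply: (L1_le _ _ i); first exact: measurable_funX.
    by move=> xi; rewrite ger0_norm ?sqr_ge0//; exact: le.
  split=> //; rewrite bE; apply: (Rint_le (L2_sqr h2) i) => xi; exact: le.
have [a0 b0] := gen h0 mh0 (fun xi => (HM xi (w1 xi) (w2 xi)).1).
have [a1 b1] := gen h1 mh1 (fun xi => (HM xi (w1 xi) (w2 xi)).2).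
by split.
Qed.

Lemma inverse_solution_hart W1 W2 f0 f1 : L2 W1 -> L2 W2 ->
  inverse_solution s sigma t1 t2 W1 W2 f0 f1 ->
  hart f0 = (fun xi => inv0 (freq xi) (hart W1 xi) (hart W2 xi)) %[ae mu] /\
  hart f1 = (fun xi => inv1 (freq xi) (hart W1 xi) (hart W2 xi)) %[ae mu].
Proof.
move=> w1 w2 [sf0 sf1 [W [CW e1 e2]]].
have h1 : 0 <= t1 <= t2 by rewrite !ltW.
have h2 : 0 <= t2 <= t2 by rewrite lexx ltW.
have c1 := cauchy_solution_hart CW h1.
have c2 := cauchy_solution_hart CW h2.
have E1 := eq_hart (cauchy_L2 CW h1) w1 e1.
have E2 := eq_hart (cauchy_L2 CW h2) w2 e2.
have H : \forall xi \ae (@lebesgue_measure R),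
    hart W1 xi = evol (freq xi) (hart f0 xi) (hart f1 xi) t1 /\
    hart W2 xi = evol (freq xi) (hart f0 xi) (hart f1 xi) t2.
  move/ae_eqE: c1 => c1; move/ae_eqE: c2 => c2.
  move/ae_eqE: E1 => E1; move/ae_eqE: E2 => E2.
  have := aeI (aeI c1 c2) (aeI E1 E2); by apply: aeS => xi [[p1 p2] [<- <-]]; split; [exact: p1|exact: p2].
by split; apply/ae_eqE; move: H; apply: aeS => xi [-> ->];
  have [] := inv_evol (hart f0 xi) (hart f1 xi) (freq_ge0 xi).
Qed.

Lemma inverse_solution_uniq W1 W2 f0 f1 g0 g1 : L2 W1 -> L2 W2 ->
  inverse_solution s sigma t1 t2 W1 W2 f0 f1 ->
  inverse_solution s sigma t1 t2 W1 W2 g0 g1 ->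
  g0 = f0 %[ae mu] /\ g1 = f1 %[ae mu].
Proof.
move=> w1 w2 F G; have [F0 F1] := inverse_solution_hart w1 w2 F.
have [G0 G1] := inverse_solution_hart w1 w2 G.
have [[f02 _] [f12 _] _] := F; have [[g02 _] [g12 _] _] := G.
split; apply: hart_inj => //.
- exact: ae_eq_trans G0 (ae_eq_sym F0).
- exact: ae_eq_trans G1 (ae_eq_sym F1).
Qed.

(** The inverted data are transforms of a pair of sources by surjectivity of the
    transform, and the solution with these sources has the given transforms at the
    two times, hence the given values. *)
Lemma inverse_solution_exists W1 W2 : sobolev 2 W1 -> sobolev 2 W2 ->
  exists f0 f1, inverse_solution s sigma t1 t2 W1 W2 f0 f1.
Proof.
move=> s1 s2; have [M _ HM] := L2_inv.
have [] := HM _ _ (L2_measurable (L2_hart s1.1)) (L2_measurable (L2_hart s2.1))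
  (L2_jap_hart s1) (L2_jap_hart s2).
pose h0 xi := inv0 (freq xi) (hart W1 xi) (hart W2 xi).
pose h1 xi := inv1 (freq xi) (hart W1 xi) (hart W2 xi).
move=> h02 h12 _ _.
have [f0 hf0] := is_hartley_exists h02; have [f1 hf1] := is_hartley_exists h12.
have f02 := hf0.1; have f12 := hf1.1.
have /ae_eqE E0 := hart_ae f02 (is_hartleyK h02 hf0).
have /ae_eqE E1 := hart_ae f12 (is_hartleyK h12 hf1).
exists f0, f1; split; [exact: sobolev0|exact: sobolev0|].
exists (sol (hart f0) (hart f1)).
have at_t t W : 0 <= t -> L2 W ->
    (forall xi, evol (freq xi) (h0 xi) (h1 xi) t = hart W xi) ->
    sol (hart f0) (hart f1) t = W %[ae mu].
  move=> tt W2' e; apply: hart_inj => //; first exact: L2_sol (L2_hart f02) (L2_hart f12).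
  have S := is_hartley_sol tt (L2_hart f02) (L2_hart f12).
  have /ae_eqE SE := hart_ae (L2_sol tt (L2_hart f02) (L2_hart f12)) S.
  apply/ae_eqE; have := aeI SE (aeI E0 E1); apply: aeS => xi [-> [e0 e1]].
  by rewrite solhE e0 e1 e.
split.
- exact: cauchy_solution_sol.
- apply: at_t; [exact: ltW|exact: s1.1|move=> xi].
  exact: (evol_inv (hart W1 xi) (hart W2 xi) (freq_ge0 xi)).1.
- apply: at_t; [exact: ltW|exact: s2.1|move=> xi].
  exact: (evol_inv (hart W1 xi) (hart W2 xi) (freq_ge0 xi)).2.
Qed.

Lemma sqrt_le_add (M x y z : R) : 0 <= M -> 0 <= x -> 0 <= y -> z <= M * (x + y) ->
  Num.sqrt z <= Num.sqrt M * (Num.sqrt x + Num.sqrt y).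
Proof.
move=> M0 x0 y0 zle; apply: (le_trans (ler_wsqrtr zle)).
rewrite sqrtrM//; apply: ler_wpM2l; first exact: sqrtr_ge0.
rewrite -[leRHS]ger0_norm ?addr_ge0 ?sqrtr_ge0// -sqrtr_sqr ler_wsqrtr//.
rewrite sqrrD !sqr_sqrtr// -addrA lerD2l lerDr mulrn_wge0// mulr_ge0 ?sqrtr_ge0//.
Qed.

Lemma inverse_solution_estimate : exists C : R, forall W1 W2,
  sobolev 2 W1 -> sobolev 2 W2 -> forall f0 f1,
  inverse_solution s sigma t1 t2 W1 W2 f0 f1 ->
  (sobolev_norm 0 f0 + sobolev_norm 0 f1
    <= C%:E * (sobolev_norm 2 W1 + sobolev_norm 2 W2))%E.
Proof.
have [M M0 HM] := L2_inv; exists (2 * Num.sqrt M) => W1 W2 s1 s2 f0 f1 F.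
have [F0 F1] := inverse_solution_hart s1.1 s2.1 F.
have [[f02 _] [f12 _] _] := F.
have [] := HM _ _ (L2_measurable (L2_hart s1.1)) (L2_measurable (L2_hart s2.1))
  (L2_jap_hart s1) (L2_jap_hart s2) => h02 h12 b0 b1.
have E0 := sqn_ae (L2_measurable (L2_hart f02)) (L2_measurable h02) F0.
have E1 := sqn_ae (L2_measurable (L2_hart f12)) (L2_measurable h12) F1.
rewrite -E0 in b0; rewrite -E1 in b1.
rewrite (sobolev0_norm f02) (sobolev0_norm f12) (sobolev2_norm s1) (sobolev2_norm s2).
rewrite -!EFinD -EFinM lee_fin -mulrA mulr_natl mulr2n.
have j1 := sqn_ge0 (fun xi => jap xi * hart W1 xi).
have j2 := sqn_ge0 (fun xi => jap xi * hart W2 xi).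
exact: lerD (sqrt_le_add M0 j1 j2 b0) (sqrt_le_add M0 j1 j2 b1).
Qed.

End InverseProblem.

Theorem theorem3p1 (R : realType) (s sigma0 tau1 tau2 : R)
    (s_gt0 : 0 < s) (sigma0_gt0 : 0 < sigma0)
    (tau1_gt0 : 0 < tau1) (tau1_lt_tau2 : tau1 < tau2) :
  (forall W1 W2 : R -> R, sobolev 2 W1 -> sobolev 2 W2 ->
    exists f0 f1 : R -> R,
      inverse_solution s sigma0 tau1 tau2 W1 W2 f0 f1 /\
      forall g0 g1 : R -> R,
        inverse_solution s sigma0 tau1 tau2 W1 W2 g0 g1 ->
        g0 = f0 %[ae lebesgue_measure] /\ g1 = f1 %[ae lebesgue_measure]) /\
  exists C : R, forall W1 W2 : R -> R, sobolev 2 W1 -> sobolev 2 W2 ->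
    forall f0 f1 : R -> R,
      inverse_solution s sigma0 tau1 tau2 W1 W2 f0 f1 ->
      (sobolev_norm 0 f0 + sobolev_norm 0 f1
        <= C%:E * (sobolev_norm 2 W1 + sobolev_norm 2 W2))%E.
Proof.
split; last exact: inverse_solution_estimate.
move=> W1 W2 sW1 sW2.
have [f0 [f1 F]] := inverse_solution_exists s_gt0 sigma0_gt0 tau1_gt0 tau1_lt_tau2 sW1 sW2.
exists f0, f1; split=> // g0 g1 G.
exact: (inverse_solution_uniq s_gt0 sigma0_gt0 tau1_gt0 tau1_lt_tau2 sW1.1 sW2.1 F G).
Qed.
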